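(* Let $\Omega\subset\mathbb{R}^N$ be a bounded open set with $C^3$-smooth boundary, let $p>2$, $a\in\mathbb{R}\setminus\{0\}$, and let $u_0\in C_0^+(\overline{\Omega})\cap C^1(\overline{\Omega})$ be a non-negative function. Assume that either $a<0$, or $a>0$ and $\|u_0\|_{C^1(\overline{\Omega})}\le\varepsilon_0$, where $\varepsilon_0>0$ is the small-data constant described in the context. Let $u$ be the unique classical solution in $Q_\infty$ to $$u_t-\Delta u=a|\nabla u|^p \ \text{ in } (0,\infty)\times\Omega,\qquad u=0\ \text{ on } (0,\infty)\times\partial\Omega,\qquad u(0,\cdot)=u_0\ \text{ in }\Omega.$$ Then there exist non-negative functions $w_0,W_0\in C_0^+(\overline{\Omega})\cap C^1(\overline{\Omega})$ (with $w_0\not\equiv0$ and $W_0\not\equiv0$ if $u_0\not\equiv0$) such that $$e^{t\Delta}w_0\le u(t)\le e^{t\Delta}W_0\quad\text{for } t \text{ large enough}.$$ Moreover, $w_0=u_0$ if $a>0$, $W_0=u_0$ if $a<0$, and there is a constant $K>0$ depending only on $u_0$, $\Omega$, $a$ and $p$ such that $$\|\nabla u(t)\|_\infty\le K(1+t^{-1/2})e^{-t\lambda_1}\quad\text{for all } t>0,$$ where $\lambda_1>0$ is the first eigenvalue of the Laplace operator (i.e. of $-\Delta$) with homogeneous Dirichlet boundary conditions in $\Omega$.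
   Context: $C_0(\overline{\Omega})$ is the space of continuous functions on $\overline{\Omega}$ vanishing on $\partial\Omega$, and $C_0^+(\overline{\Omega})$ is its positive cone (the non-negative functions in it); $\|\cdot\|_\infty$ is the norm of $L^\infty(\Omega)$. $(e^{t\Delta})_{t\ge0}$ is the linear heat semigroup in $\Omega$ with homogeneous Dirichlet boundary conditions. For $T\in(0,\infty]$, $Q_T=(0,T)\times\Omega$, and $C^{1,2}(Q_T)$ is the space of functions in $C(Q_T)$ that are differentiable in $t$ and twice differentiable in $x$ with $u_t,u_{x_i},u_{x_ix_j}\in C(Q_T)$. A classical solution in $Q_T$ with initial datum $u_0\in C_0(\overline\Omega)$ is a function $u\in C([0,T)\times\overline{\Omega})\cap C^{1,2}(Q_T)$ with $u(0)=u_0$, satisfying the equation pointwise in $Q_T$ and vanishing on $(0,T)\times\partial\Omega$. It also satisfies $u(t)=e^{t\Delta}u_0+a\int_0^t e^{(t-s)\Delta}|\nabla u(s)|^p\,ds$ for $t\in[0,T)$. Known existence results: for $p>2$, $a<0$ and $u_0\in C_0^+(\overline{\Omega})$ there is a unique classical solution in $Q_\infty$. For $p>2$ and $a>0$, there is a constant $\varepsilon_0>0$ (due to Souplet) such that for every $u_0\in C_0^+(\overline{\Omega})\cap C^1(\overline{\Omega})$ with $\|u_0\|_{C^1(\overline{\Omega})}\le\varepsilon_0$ there is a unique classical solution $u$ in $Q_\infty$, and this solution is bounded in $C^1(\overline{\Omega})$, i.e. $\sup_{t\ge0}\|u(t)\|_{C^1(\overline\Omega)}<\infty$. The number $\varepsilon_0$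 in the claim is this constant. *)

(* Defs.v *)
From HB Require Import structures.
From mathcomp Require Import all_boot all_order all_algebra.
From mathcomp Require Import all_classical all_reals all_analysis.

Set Implicit Arguments.
Unset Strict Implicit.
Unset Printing Implicit Defensive.

Import Order.TTheory GRing.Theory Num.Theory.
Import numFieldNormedType.Exports.

Local Open Scope classical_set_scope.
Local Open Scope ring_scope.

(* R^n is 'rV[R]_n with its library topology. The library norm `|x| of 'rV is
   the sup norm, so the Euclidean length of the gradient is [enorm] below.

   A function on the closure of Omega is a total function 'rV[R]_n -> R whose
   values outside the closure are irrelevant, and a function of (t, x) is a
   total function R -> 'rV[R]_n -> R used only for 0 <= t and x in the
   closure. *)

Section Calculus.
Context {R : realType} {n : nat}.
Local Notation V := 'rV[R]_n.
Implicit Types (D : set V) (f : V -> R).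

Definition bdry D : set V := closure D `\` D°.

Definition enorm (v : V) : R := Num.sqrt (\sum_i v 0 i ^+ 2).

Definition partial (i : 'I_n) f (x : V) : R := 'D_(delta_mx 0 i) f x.

Definition grad f (x : V) : V := \row_i partial i f x.

Definition laplacian f (x : V) : R := \sum_i partial i (partial i f) x.

(* C^k on an open set D *)
Fixpoint Ck (k : nat) D f : Prop :=
  match k with
  | 0 => forall x, D x -> {for x, continuous f}
  | k'.+1 => (forall x, D x -> differentiable f x) /\
             (forall i, Ck k' D (partial i f))
  end.

(* C^1 up to the boundary: the derivatives extend continuously. *)
Definition C1_closure D f : Prop :=
  [/\ {within closure D, continuous f},
      Ck 1 D f &
      forall i, exists g : V -> R,
        {within closure D, continuous g} /\
        (forall x, D x -> g x = partial i f x)].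

Definition C0_closure D f : Prop :=
  {within closure D, continuous f} /\ (forall x, bdry D x -> f x = 0).

Definition C0plus_closure D f : Prop :=
  C0_closure D f /\ (forall x, closure D x -> 0 <= f x).

(* The L^oo norm over the open set D; it is only applied to continuous
   functions, for which the essential supremum is the supremum. *)
Definition supnorm D f : \bar R := ereal_sup [set `|f x|%:E | x in D].

Definition grad_supnorm D f : \bar R := supnorm D (fun x => enorm (grad f x)).

Definition C1norm D f : \bar R := (supnorm D f + grad_supnorm D f)%E.

(* Near each boundary point, D is the region strictly on one side of the graph
   of a C^3 function gamma of the other n - 1 coordinates, after relabeling
   and reorienting the axes: i is the distinguished coordinate, b its
   orientation. "gamma does not depend on x_i" replaces a function on
   R^(n-1). *)
Definition C3_boundary D : Prop :=
  forall x0, bdry D x0 ->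
  exists (i : 'I_n) (b : bool) (gamma : V -> R),
    [/\ Ck 3 setT gamma,
        forall x c, gamma (x + c *: delta_mx 0 i) = gamma x &
        \forall x \near x0, D x <-> gamma x < (-1) ^+ b * x 0 i].

End Calculus.

Section Parabolic.
Context {R : realType} {n : nat}.
Local Notation V := 'rV[R]_n.
Implicit Types (Omega : set V) (u : R -> V -> R).

Definition cylinder Omega : set (R * V) :=
  [set z | 0 < z.1 /\ Omega z.2].

(* C^{1,2}(Q) for Q = (0,oo) x Omega *)
Definition C12 Omega u : Prop :=
  let Q := cylinder Omega in
  let continuous_Q (w : R -> V -> R) :=
    {within Q, continuous (fun z : R * V => w z.1 z.2)} in
  [/\ forall t x, Q (t, x) ->
        [/\ derivable (u^~ x) t 1,
            differentiable (u t) x &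
            forall i, differentiable (partial i (u t)) x],
      continuous_Q u,
      continuous_Q (fun t x => derive1 (u^~ x) t),
      forall i, continuous_Q (fun t => partial i (u t)) &
      forall i j, continuous_Q (fun t => partial j (partial i (u t)))].

(* Global classical solution of u_t - Delta u = F(grad u) in (0,oo) x Omega,
   u = 0 on (0,oo) x bdry Omega, u(0) = u0. *)
Definition classical_solution Omega (F : V -> R) (u0 : V -> R) u : Prop :=
  [/\ {within [set z : R * V | 0 <= z.1 /\ closure Omega z.2],
         continuous (fun z : R * V => u z.1 z.2)},
      C12 Omega u,
      forall t x, 0 < t -> Omega x ->
        derive1 (u^~ x) t - laplacian (u t) x = F (grad (u t) x),
      forall t x, 0 < t -> bdry Omega x -> u t x = 0 &
      forall x, closure Omega x -> u 0 x = u0 x].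

Definition vhj_solution Omega (a p : R) (u0 : V -> R) u : Prop :=
  classical_solution Omega (fun q => a * enorm q `^ p) u0 u.

Definition heat_solution Omega (f : V -> R) u : Prop :=
  classical_solution Omega (fun=> 0) f u.

(* e^{t Delta} f for f in C_0(closure Omega): t |-> e^{t Delta} f is the
   classical solution of the Dirichlet heat equation with initial datum f,
   unique on [0,oo) x closure Omega. *)
Definition heat_semigroup Omega (t : R) (f : V -> R) : V -> R :=
  xget (fun _ _ => 0) [set u | heat_solution Omega f u] t.

Definition dirichlet_eigenvalue Omega (lam : R) : Prop :=
  exists phi : V -> R,
    [/\ C0_closure Omega phi, Ck 2 Omega phi,
        exists2 x, Omega x & phi x != 0 &
        forall x, Omega x -> - laplacian phi x = lam * phi x].

Definition first_dirichlet_eigenvalue Omega (lam : R) : Prop :=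
  dirichlet_eigenvalue Omega lam /\
  (forall mu, dirichlet_eigenvalue Omega mu -> lam <= mu).

(* eps0 is a threshold as in Souplet's global existence theorem for small
   data. *)
Definition small_data_constant Omega (a p eps0 : R) : Prop :=
  0 < eps0 /\
  forall u0 : V -> R,
    C0plus_closure Omega u0 -> C1_closure Omega u0 ->
    (C1norm Omega u0 <= eps0%:E)%E ->
    exists u,
      [/\ vhj_solution Omega a p u0 u,
          forall v, vhj_solution Omega a p u0 v ->
            forall t x, 0 <= t -> closure Omega x -> v t x = u t x,
          forall t, 0 <= t -> C1_closure Omega (u t) &
          (ereal_sup [set C1norm Omega (u t) | t in [set t | (0 <= t)%R]]
             < +oo)%E].

End Parabolic.

(* Main.v *)
Require Import Defs.
From mathcomp Require Import all_boot all_order all_algebra.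
From mathcomp Require Import all_classical all_reals all_analysis.
From mathcomp Require Import ring lra zify.
Import Order.TTheory GRing.Theory Num.Theory.
Import numFieldNormedType.Exports.
Local Open Scope classical_set_scope.
Local Open Scope ring_scope.
Set Implicit Arguments.
Unset Strict Implicit.
Unset Printing Implicit Defensive.

(** Once |grad u| <= M is known, put c = a M^(p-2) and z = (e^(cu) - 1) / c.
    The exponential absorbs the nonlinearity: z is a subsolution of the heat
    equation when a > 0 and a supersolution when a < 0. Since z >= u for a > 0
    and z <= u for a < 0, the parabolic maximum principle squeezes u between the
    heat flows of u0 and of (e^(c u0) - 1) / c.

    The gradient bounds come from doubling the variables: at an interior maximum
    of u(t, y + s e_i) - u(t, y - s e_i) - K s (2D - s) both gradients coincide,
    so the nonlinear terms cancel. Hence a bound u <= C |x - w| for w on the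
    boundary gives a gradient bound of the same order after a unit time, and it
    is enough that heat flows decay like e^(-lambda1 t), also in this
    boundary-weighted sense.

    The heat flow is built as the limit, along an ultrafilter on the mesh sizes,
    of a lazy random walk on h Z^n killed outside Omega; an exterior ball, given
    by the C^3 boundary, provides barriers, and comparison of reflected
    differences gives interior Lipschitz bounds on every discrete derivative.
    The walk is a symmetric matrix P, so m |-> |P^m f|^2 is log-convex: the ratios
    of consecutive terms increase to a limit rho^2, |P^m f| <= rho^m |f|, and the
    normalised iterates accumulate at a nonnegative eigenvector of P for rho.
    Rescaled, these eigenvectors converge to a Dirichlet eigenfunction with
    eigenvalue mu = lim - log rho / tau; as lambda1 <= mu, the decay rate of the
    walk is at least lambda1. *)

(** * Directional derivatives and the maximum principle *)

(** [heat_semigroup] is a choice with default zero, so the two-sided bound requires that the heat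
    flow be constructed; this accounts for most of the length. The construction is used twice, since
    the matrix that approximates the flow also supplies the eigenfunction, and the limits of both
    are handled by one smoothness theory. The main obstacle is uniformity in the mesh. Spectral
    information controls only the [l^2] norm of the walk. It becomes a sup bound because after two
    units of time the walk is Lipschitz with a constant independent of [h], so that a large value at
    one point occupies a ball of fixed size and is seen by the normalised [l^2] norm. The constant
    [K] is chosen before [u]. Hence the bound [M] on the gradient, which fixes the exponential, has
    to come from [u0] alone: for [a < 0] by comparison with a heat flow and doubling from time zero,
    for [a > 0] from the small-data hypothesis and uniqueness. *)

Section DirectionalDerivatives.
Context {R : realType} {V : normedModType R}.
Implicit Types (f : V -> R) (x v : V) (d : R).

(** Differentiability along [v] without a quotient: the lattice estimates deliver bounds on
    increments in exactly this form, and [s = 0] is no exception. *)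
Definition dird f x v d := forall e, 0 < e -> exists2 r, 0 < r &
  forall s : R, `|s| < r -> `|f (x + s *: v) - f x - s * d| <= e * `|s|.

Lemma dirdP f x v d : is_derive x v f d <-> dird f x v d.
Proof.
split=> [[df dfE] e e0|H].
  have /cvgrPdist_le /(_ e e0) : h^-1 *: ((f \o shift x) (h *: v) - f x) @[h --> 0^'] --> d.
    by rewrite -dfE.
  move=> /nbhs_ballP[r /= r0 Hr]; exists r => // s sr.
  have [->|s0] := eqVneq s 0; first by rewrite scale0r addr0 subrr mul0r subrr normr0 mulr0.
  have := Hr s; rewrite /= /ball/= sub0r normrN sr => /(_ isT s0).
  rewrite (addrC (s *: v)) => Hs.
  rewrite (_ : _ - _ - _ = - (s * (d - s^-1 * (f (x + s *: v) - f x)))).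
    rewrite normrN normrM mulrC ler_wpM2r//.
  rewrite mulrBr mulrA divff// mul1r; ring.
suff C : h^-1 *: ((f \o shift x) (h *: v) - f x) @[h --> 0^'] --> d.
  by split; [apply/cvg_ex; exists d|exact/cvg_lim].
apply/cvgrPdist_le => e e0; have [r r0 Hr] := H e e0.
apply/nbhs_ballP; exists r => //= s; rewrite /ball/= sub0r normrN => sr s0.
rewrite (addrC (s *: v)).
have sp : 0 < `|s| by rewrite normr_gt0.
rewrite -(ler_pM2r sp) (le_trans _ (Hr s sr))// -normrM -normrN le_eqVlt; apply/orP; left.
apply/eqP; congr `|_|; rewrite /GRing.scale/= mulrBl mulrAC mulVf// mul1r; ring.
Qed.

Lemma dird_derive f x v : derivable f x v -> dird f x v ('D_v f x).
Proof. by move=> ?; apply/dirdP/derivableP. Qed.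

Lemma dird_is f x v d : dird f x v d -> derivable f x v /\ 'D_v f x = d.
Proof. by move/dirdP => [? ?]. Qed.

Lemma dird_eq f g x v d : (exists2 r, 0 < r & forall s : R, `|s| < r ->
  f (x + s *: v) = g (x + s *: v)) -> dird f x v d -> dird g x v d.
Proof.
move=> [r r0 E] H e e0; have [r' r'0 H'] := H e e0.
exists (Num.min r r') => [|s]; first by rewrite lt_min r0.
rewrite lt_min => /andP[sr sr'].
have := E 0; rewrite normr0 scale0r addr0 => /(_ r0) <-.
by rewrite -E// H'.
Qed.

Lemma dirdD f g x v a b : dird f x v a -> dird g x v b ->
  dird (fun y => f y + g y) x v (a + b).
Proof. by move=> /dirdP ? /dirdP ?; apply/dirdP; exact: is_deriveD. Qed.

Lemma dirdB f g x v a b : dird f x v a -> dird g x v b ->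
  dird (fun y => f y - g y) x v (a - b).
Proof. by move=> /dirdP ? /dirdP ?; apply/dirdP; exact: is_deriveB. Qed.

Lemma dirdN f x v a : dird f x v a -> dird (fun y => - f y) x v (- a).
Proof. by move=> /dirdP ?; apply/dirdP; exact: is_deriveN. Qed.

Lemma dirdZ f x v a k : dird f x v a -> dird (fun y => k * f y) x v (k * a).
Proof. by move=> /dirdP ?; apply/dirdP; exact: is_deriveZ. Qed.

Lemma dirdM f g x v a b : dird f x v a -> dird g x v b ->
  dird (fun y => f y * g y) x v (f x * b + g x * a).
Proof. by move=> /dirdP ? /dirdP ?; apply/dirdP; exact: is_deriveM. Qed.

Lemma dird_cst c x v : dird (fun=> c) x v 0.
Proof. by move=> e e0; exists 1 => // s _; rewrite subrr mulr0 subrr normr0 mulr_ge0// ltW. Qed.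

Lemma diff_dird f x v : differentiable f x -> dird f x v ('D_v f x).
Proof. by move=> df; apply: dird_derive; exact: diff_derivable. Qed.

End DirectionalDerivatives.

Section OneVariable.
Context {R : realType}.
Implicit Types (f : R -> R) (x d : R).

Lemma dird_slice {V : normedModType R} (f : V -> R) (x v : V) d s : dird f (x + s *: v) v d ->
  dird (fun s : R => f (x + s *: v)) s 1 d.
Proof.
move=> H e e0; have [r r0 Hr] := H e e0; exists r => // t tr.
by rewrite [t *: 1]mulr1 scalerDl addrA Hr.
Qed.

Lemma dird_chain {V : normedModType R} (phi : R -> R) (f : V -> R) (x v : V) a b :
  dird f x v a -> dird phi (f x) 1 b -> dird (fun y => phi (f y)) x v (b * a).
Proof.
move=> Hf Hp e e0.
pose C := `|a| + 1; have C0 : 0 < C by rewrite /C ltr_wpDl.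
pose B := `|b| + 1; have B0 : 0 < B by rewrite /B ltr_wpDl.
have e1 : 0 < Num.min 1 (e / 2 / B) by rewrite lt_min ltr01/= !divr_gt0.
have [r r0 Hr] := Hf _ e1.
have e2 : 0 < e / 2 / C by rewrite !divr_gt0.
have [q q0 Hq] := Hp _ e2.
exists (Num.min r (q / C)) => [|s]; first by rewrite lt_min r0 divr_gt0.
rewrite lt_min => /andP[sr sq].
have := Hr s sr; set D := f (x + s *: v) - f x => HD.
have HD1 : `|D - s * a| <= `|s|.
  by rewrite (le_trans HD)// -[leRHS]mul1r ler_wpM2r// ge_min lexx.
have HD2 : `|D - s * a| <= e / 2 / B * `|s|.
  by rewrite (le_trans HD)// ler_wpM2r// ge_min lexx orbT.
have DC : `|D| <= C * `|s|.
  rewrite (_ : D = (D - s * a) + s * a); last by ring.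
  by rewrite (le_trans (ler_normD _ _))// /C mulrDl mul1r addrC lerD// normrM mulrC.
have Dq : `|D| < q by rewrite (le_lt_trans DC)// mulrC -ltr_pdivlMr.
have := Hq D Dq; rewrite [D *: 1]mulr1 (_ : f x + D = f (x + s *: v)); last by rewrite /D; ring.
move=> Hphi.
rewrite (_ : _ - _ - _ = (phi (f (x + s *: v)) - phi (f x) - D * b) + b * (D - s * a)); last by ring.
rewrite (le_trans (ler_normD _ _))// [leRHS](_ : _ = e / 2 * `|s| + e / 2 * `|s|); last by field.
apply: lerD.
  rewrite (le_trans Hphi)// (le_trans (ler_wpM2l _ DC)) ?(ltW e2)// le_eqVlt; apply/orP; left.
  by apply/eqP; field; rewrite gt_eqF.
rewrite normrM (le_trans (y := B * `|D - s * a|))//; first by rewrite ler_wpM2r// /B lerDl.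
rewrite (le_trans (ler_wpM2l _ HD2)) ?(ltW B0)// le_eqVlt; apply/orP; left.
by apply/eqP; field; rewrite gt_eqF.
Qed.

Lemma MVT_seg f df (a b : R) : a < b -> (forall s, a <= s <= b -> dird f s 1 (df s)) ->
  exists2 c, a < c < b & f b - f a = df c * (b - a).
Proof.
move=> ab H.
have H' s : a <= s <= b -> is_derive s 1 f (df s) by move=> /H/dirdP.
have [||c] := @MVT R f df a b ab.
- by move=> x; rewrite in_itv/= => /andP[? ?]; apply: H'; rewrite !ltW.
- apply: derivable_within_continuous => x; rewrite in_itv/= => xab.
  by case: (H' x xab).
- by rewrite in_itv/= => cab E; exists c.
Qed.

Lemma dird_max f x d r : 0 < r -> (forall s, `|s| < r -> f (x + s) <= f x) ->
  dird f x 1 d -> d = 0.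
Proof.
move=> r0 M H; apply/eqP; rewrite -normr_le0; apply/ler_addgt0Pr => e e0; rewrite add0r.
have [q q0 Hq] := H e e0.
pose s := (Num.min r q) / 2 * (if 0 <= d then 1 else -1).
have m0 : 0 < Num.min r q by rewrite lt_min r0.
have sE : `|s| = Num.min r q / 2.
  by rewrite normrM [`|_ / 2|]gtr0_norm ?divr_gt0//; case: ifP; rewrite ?normrN normr1 mulr1.
have sm : `|s| < Num.min r q by rewrite sE; lra.
move: (sm); rewrite lt_min => /andP[sr sq].
have := Hq s sq; rewrite [s *: 1]mulr1 => Hs; have := M s sr => Ms.
have sd : s * d = `|s| * `|d|.
  rewrite sE /s; case: ifP => d0; first by rewrite mulr1 ger0_norm.
  by rewrite -mulrA mulN1r ltr0_norm// ltNge d0.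
have s0 : 0 < `|s| by rewrite sE divr_gt0.
move: Hs; rewrite ler_norml => /andP[Hs _].
rewrite -(ler_pM2l s0); rewrite sd in Hs; lra.
Qed.

(** Only earlier times are available: a maximum over [[0, T]] may sit at [t = T], so the conclusion
    is a sign rather than [d = 0]. *)
Lemma dird_max_left f x d r : 0 < r -> (forall s, 0 <= s < r -> f (x - s) <= f x) ->
  dird f x 1 d -> 0 <= d.
Proof.
move=> r0 M H; apply/ler_addgt0Pr => e e0.
have [q q0 Hq] := H e e0.
pose s := (Num.min r q) / 2.
have m0 : 0 < Num.min r q by rewrite lt_min r0.
have s0 : 0 < s by rewrite divr_gt0.
have sm : s < Num.min r q by rewrite /s; lra.
move: (sm); rewrite lt_min => /andP[sr sq].
have := Hq (- s); rewrite normrN gtr0_norm// => /(_ sq).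
rewrite [(- s) *: 1]mulr1 => Hs; have := M s; rewrite sr ltW// => /(_ isT) Ms.
move: Hs; rewrite ler_norml => /andP[Hs _].
rewrite -(ler_pM2l s0); lra.
Qed.

(** If [d > 0], then [df], which vanishes at the maximum [x], is positive just to its right, and the
    mean value theorem makes [f] grow there. *)
Lemma dird_max2 f df x d r : 0 < r -> (forall s, `|s| < r -> f (x + s) <= f x) ->
  (forall s, `|s| < r -> dird f (x + s) 1 (df (x + s))) ->
  dird df x 1 d -> d <= 0.
Proof.
move=> r0 M H H2; rewrite leNgt; apply/negP => d0.
have dfx : df x = 0.
  have := H 0; rewrite normr0 addr0 => /(_ r0) Hx.
  exact: (dird_max r0 M Hx).
have d2 : 0 < d / 2 by rewrite divr_gt0.
have [q q0 Hq] := H2 _ d2.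
pose s := (Num.min r q) / 2.
have m0 : 0 < Num.min r q by rewrite lt_min r0.
have s0 : 0 < s by rewrite divr_gt0.
have sm : s < Num.min r q by rewrite /s; lra.
move: (sm); rewrite lt_min => /andP[sr sq].
have xs : x < x + s by rewrite ltrDl.
have [|c /andP[xc cs] E] := @MVT_seg f df x (x + s) xs.
  move=> t /andP[xt ts]; rewrite (_ : t = x + (t - x)); last by ring.
  by apply: H; rewrite ger0_norm; lra.
have := M s; rewrite gtr0_norm// => /(_ sr) Ms.
have := Hq (c - x); rewrite gtr0_norm; last by lra.
have cq : c - x < q by lra.
move=> /(_ cq); rewrite [(c - x) *: 1]mulr1 (_ : x + (c - x) = c); last by ring.
rewrite dfx subr0 ler_norml => /andP[Hc _].
have cx0 : 0 < c - x by lra.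
have dc : 0 < df c.
  have : 0 < d / 2 * (c - x) by rewrite mulr_gt0.
  lra.
have : 0 < df c * (x + s - x) by rewrite mulr_gt0//; lra.
rewrite -E; lra.
Qed.

End OneVariable.

Section EpsDelta.
Context {R : realType}.

Lemma within_contP {V : normedModType R} (A : set V) (f : V -> R) :
  {within A, continuous f} <->
  forall x, A x -> forall e, 0 < e -> exists2 r, 0 < r &
    forall y, A y -> `|x - y| < r -> `|f x - f y| < e.
Proof.
split=> [cf x Ax e e0|H].
  have /cvgrPdist_lt/(_ e e0) := (subspace_continuousP A f).1 cf x Ax.
  rewrite near_withinE => /nbhs_ballP[r r0 Hr]; exists r => [|y Ay xy]; first exact: r0.
  by apply: Hr => //; rewrite -ball_normE.
apply/subspace_continuousP => x Ax; apply/cvgrPdist_lt => e e0.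
have [r r0 Hr] := H x Ax e e0; rewrite near_withinE; apply/nbhs_ballP.
by exists r => [|y]; [exact: r0|rewrite -ball_normE => xy Ay; exact: (Hr y Ay xy)].
Qed.

Lemma near_normP {V : normedModType R} (x : V) (P : V -> Prop) :
  (\forall y \near x, P y) <-> exists2 r : R, 0 < r & forall y, `|x - y| < r -> P y.
Proof.
split=> [/nbhs_ballP[r r0 Hr]|[r r0 Hr]].
  by exists r => [|y xy]; [exact: r0|apply: Hr; rewrite -ball_normE].
by apply/nbhs_ballP; exists r => [|y]; [exact: r0|rewrite -ball_normE => xy; exact: Hr].
Qed.

Lemma contP {V : normedModType R} (x : V) (f : V -> R) :
  {for x, continuous f} <-> forall e, 0 < e -> exists2 r, 0 < r &
    forall y, `|x - y| < r -> `|f x - f y| < e.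
Proof.
split=> [cf e e0|H].
  by have /cvgrPdist_lt/(_ e e0)/near_normP := cf.
by apply/cvgrPdist_lt => e e0; apply/near_normP; exact: H.
Qed.

Lemma open_normP {V : normedModType R} (A : set V) x : open A -> A x ->
  exists2 r : R, 0 < r & forall y, `|x - y| < r -> A y.
Proof. by rewrite openE => oA Ax; apply/near_normP; exact: oA. Qed.

End EpsDelta.

Section Jets.
Context {R : realType} {n : nat}.
Local Notation V := 'rV[R]_n.
Local Notation ee i := (delta_mx 0 i : V).
Implicit Types (f : V -> R) (w : R -> V -> R).

(* Values at (t, x) of w_t, of the first partials g and of the pure second
   partials H: all that the maximum principle tests. *)
Definition jet w t x wt (g H : 'I_n -> R) :=
  dird (w^~ x) t 1 wt /\
  forall i, exists d : V -> R,
    [/\ exists2 r, 0 < r & forall s : R, `|s| < r ->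
          dird (w t) (x + s *: ee i) (ee i) (d (x + s *: ee i)),
        d x = g i & dird d x (ee i) (H i)].

Lemma jetB w1 w2 t x a1 a2 g1 g2 H1 H2 : jet w1 t x a1 g1 H1 -> jet w2 t x a2 g2 H2 ->
  jet (fun t x => w1 t x - w2 t x) t x (a1 - a2) (fun i => g1 i - g2 i) (fun i => H1 i - H2 i).
Proof.
move=> [T1 S1] [T2 S2]; split; first exact: dirdB.
move=> i; have [d1 [[r1 r10 D1] E1 F1]] := S1 i; have [d2 [[r2 r20 D2] E2 F2]] := S2 i.
exists (fun y => d1 y - d2 y); split; [|by rewrite E1 E2|exact: dirdB].
exists (Num.min r1 r2) => [|s]; first by rewrite lt_min r10.
by rewrite lt_min => /andP[s1 s2]; apply: dirdB; [exact: D1|exact: D2].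
Qed.

(** The extra term [phi2 * g i ^+ 2] in the second derivatives is what later absorbs the
    nonlinearity, when [phi] is exponential. *)
Lemma jet_comp (phi phi1 : R -> R) phi2 w t x a g H :
  (forall s, dird phi s 1 (phi1 s)) -> dird phi1 (w t x) 1 phi2 ->
  jet w t x a g H ->
  jet (fun t x => phi (w t x)) t x (phi1 (w t x) * a) (fun i => phi1 (w t x) * g i)
    (fun i => phi1 (w t x) * H i + phi2 * g i ^+ 2).
Proof.
move=> P1 P2 [T1 S1]; split; first exact: (dird_chain T1).
move=> i; have [d1 [[r1 r10 D1] E1 F1]] := S1 i.
exists (fun y => phi1 (w t y) * d1 y); split.
- by exists r1 => // s s1; apply: (dird_chain (D1 s s1)).
- by rewrite E1.
have := D1 0; rewrite normr0 scale0r addr0 => /(_ r10) D0.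
have := dirdM (dird_chain D0 P2) F1; rewrite E1.
by congr dird; ring.
Qed.

Lemma jet_max w t x a g H r : 0 < r ->
  (forall s, 0 <= s < r -> w (t - s) x <= w t x) ->
  (forall i s, `|s| < r -> w t (x + s *: ee i) <= w t x) ->
  jet w t x a g H -> [/\ 0 <= a, forall i, g i = 0 & forall i, H i <= 0].
Proof.
move=> r0 Mt Mx [T1 S1]; split; first by apply: (dird_max_left r0 _ T1) => s; exact: Mt.
  move=> i; have [d [[r1 r10 D1] <- _]] := S1 i.
  have := D1 0; rewrite normr0 => /(_ r10) D0.
  have := dird_slice D0; rewrite [X in dird _ _ _ (d X)](_ : _ = x); last by rewrite scale0r addr0.
  apply: (@dird_max _ _ _ _ r) => // s sr.
  by rewrite add0r scale0r addr0 Mx.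
move=> i; have [d [[r1 r10 D1] _ D2]] := S1 i.
apply: (@dird_max2 _ (fun s => w t (x + s *: ee i)) (fun s => d (x + s *: ee i)) 0 _ (Num.min r r1)).
- by rewrite lt_min r0.
- by move=> s; rewrite lt_min => /andP[sr _]; rewrite add0r scale0r addr0 Mx.
- by move=> s; rewrite lt_min => /andP[_ sr]; rewrite add0r; apply: dird_slice; exact: D1.
- by apply: dird_slice; rewrite scale0r addr0.
Qed.

(** Tilting in time serves twice: [k > 0] makes the maximum principle strict, and [k = - m] produces
    the term [m * (t1 - t)] of the doubling argument. *)
Lemma jet_opp_time w t x a g H k : jet w t x a g H ->
  jet (fun t x => w t x - k * t) t x (a - k) g H.
Proof.
move=> J; have -> : g = (fun i => g i - 0) by apply/funext => i; rewrite subr0.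
have -> : H = (fun i => H i - 0) by apply/funext => i; rewrite subr0.
apply: jetB => //; split.
  have := @dirdZ R R id t 1 1 k; rewrite mulr1; apply.
  by apply/dirdP; exact: is_derive_id.
move=> i; exists (fun=> 0); split=> //; [exists 1 => // s _|]; exact: dird_cst.
Qed.

End Jets.

Section ParabolicMax.
Context {R : realType} {n : nat}.
Local Notation V := 'rV[R]_n.
Implicit Types (Omega : set V) (w u : R -> V -> R).

Lemma closure_split Omega x : open Omega -> closure Omega x -> Omega x \/ bdry Omega x.
Proof.
move=> oO cx; have [|nO] := pselect (Omega x); first by left.
by right; split=> // /interior_subset.
Qed.

Lemma bdry_out Omega x : open Omega -> bdry Omega x -> ~ Omega x.
Proof. by move=> oO [_ H] Ox; apply: H; move: oO; rewrite openE; apply. Qed.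

Lemma compact_closure Omega : bounded_set Omega -> compact (closure Omega).
Proof.
move=> [M [Mr HM]]; apply: bounded_closed_compact; last exact: closed_closure.
exists M; split=> // m Mm x cx.
have: closed [set y : V | `|y| <= m].
  apply: (@closed_comp _ _ (fun y : V => `|y|) [set r | r <= m]).
    by move=> y _; exact: norm_continuous.
  exact: closed_le.
move/closure_id => E; have : [set y : V | `|y| <= m] x; last by [].
by rewrite E; apply: (closureS _ cx) => y Oy; exact: HM.
Qed.

(** The differential inequality is asked for only where [w > 0] and the gradient vanishes. This
    suits a gradient nonlinearity: for a difference of two solutions, equal gradients give equal
    values of [F]. *)
Theorem max_principle Omega (T : R) w : open Omega -> bounded_set Omega -> 0 < T ->
  {within [set z : R * V | 0 <= z.1 <= T /\ closure Omega z.2],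
     continuous (fun z : R * V => w z.1 z.2)} ->
  (forall x, closure Omega x -> w 0 x <= 0) ->
  (forall t x, 0 < t <= T -> bdry Omega x -> w t x <= 0) ->
  (forall t x, 0 < t <= T -> Omega x -> 0 < w t x ->
    exists a g H, jet w t x a g H /\ ((forall i, g i = 0) -> a <= \sum_i H i)) ->
  forall t x, 0 <= t <= T -> closure Omega x -> w t x <= 0.
Proof.
move=> oO bO T0 cw w0 wb wJ t0 x0 t0T cx0; rewrite leNgt; apply/negP => wpos.
(* The tilt spends at most half of the positive value. At the maximum of [w - e * t] one gets
   [e <= a] together with [a <= \sum_i H i <= 0]. *)
pose e := w t0 x0 / (2 * T); have e0 : 0 < e by rewrite divr_gt0// mulr_gt0.
pose A := [set z : R * V | 0 <= z.1 <= T /\ closure Omega z.2].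
have cA : compact A.
  rewrite (_ : A = `[0, T]%classic `*` closure Omega); last first.
    by apply/seteqP; split=> -[a b] /= []; rewrite in_itv.
  by apply: compact_setX; [exact: segment_compact|exact: compact_closure].
have cW : {within A, continuous (fun z : R * V => w z.1 z.2 - e * z.1)}.
  apply/within_contP => z Az d d0.
  have d2 : 0 < d / 2 by rewrite divr_gt0.
  have [r r0 Hr] := (within_contP _ _).1 cw z Az _ d2.
  exists (Num.min r (d / 2 / e)) => [|y Ay]; first by rewrite lt_min r0 divr_gt0.
  rewrite lt_min => /andP[yr yd].
  have := Hr y Ay yr => H1.
  have H2 : `|z.1 - y.1| <= `|z - y| by rewrite [leRHS]prod_normE le_max lexx.
  have H3 : `|e * (z.1 - y.1)| < d / 2.
    rewrite normrM (gtr0_norm e0) mulrC -ltr_pdivlMr//; exact: (le_lt_trans H2 yd).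
  rewrite (_ : _ - _ - _ = (w z.1 z.2 - w y.1 y.2) - e * (z.1 - y.1)); last by ring.
  by rewrite (le_lt_trans (ler_normB _ _))//; lra.
have [|[t x] /set_mem[/= tT cx] M] := compact_EVT_max _ cA cW.
- by exists (t0, x0).
have := M (t0, x0); rewrite inE => /(_ (conj t0T cx0)) /= M0.
have W0 : 0 < w t0 x0 - e * t0.
  have : e * t0 <= e * T by rewrite ler_pM2l//; case/andP: t0T.
  have -> : e * T = w t0 x0 / 2 by rewrite /e; field; rewrite gt_eqF.
  lra.
have wtx : 0 < w t x.
  have : 0 <= e * t by rewrite mulr_ge0 ?(ltW e0)//; case/andP: tT.
  lra.
have tp : 0 < t.
  rewrite lt_neqAle; case/andP: tT => -> _; rewrite andbT; apply/eqP => tE.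
  by have := w0 x cx; rewrite tE; lra.
have tT' : 0 < t <= T by rewrite tp; case/andP: tT.
have [Ox|bx] := closure_split oO cx; last by have := wb t x tT' bx; lra.
have [a [g [H [J HJ]]]] := wJ t x tT' Ox wtx.
have [r r0 Hr] := open_normP oO Ox.
have [|||a0 g0 H0] := @jet_max _ _ _ t x _ _ _ (Num.min t r) _ _ _ (jet_opp_time e J).
- by rewrite lt_min tp.
- move=> s; rewrite lt_min => /andP[s0 /andP[st sr]].
  by apply: (M (t - s, x)); rewrite inE; split=> //=; move/andP: tT => [? ?]; apply/andP; split; lra.
- move=> i s; rewrite lt_min => /andP[st sr].
  apply: (M (t, x + s *: delta_mx 0 i)); rewrite inE; split=> //=.
  apply: subset_closure; apply: Hr; rewrite opprD addrA subrr sub0r normrN normrZ.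
  rewrite (le_lt_trans _ sr)// -[leRHS]mulr1 ler_wpM2l//.
  by rewrite [leLHS]mx_normrE; apply: bigmax_le => // -[k l] _; rewrite !mxE; case: (_ && _); rewrite ?normr1 ?normr0.
have : a <= 0 by rewrite (le_trans (HJ g0))//; apply: sumr_le0 => i _; exact: H0.
lra.
Qed.

End ParabolicMax.

Section JetsOfSolutions.
Context {R : realType} {n : nat}.
Local Notation V := 'rV[R]_n.
Local Notation ee i := (delta_mx 0 i : V).
Implicit Types (Omega : set V) (f : V -> R) (w u : R -> V -> R).

Lemma norm_delta_le1 (i : 'I_n) : `|ee i| <= 1.
Proof.
rewrite [leLHS]mx_normrE; apply: bigmax_le => // -[k l] _.
by rewrite !mxE; case: (_ && _); rewrite ?normr1 ?normr0.
Qed.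

Lemma norm_scale_delta (i : 'I_n) s : `|s *: ee i| <= `|s|.
Proof. by rewrite normrZ -[leRHS]mulr1 ler_wpM2l// norm_delta_le1. Qed.

Lemma coord_le_norm (v : V) i : `|v 0 i| <= `|v|.
Proof.
have -> : `|v| = mx_norm v by [].
rewrite mx_normrE; apply/bigmax_geP; right; by exists (0, i).
Qed.

Lemma norm_le_coord (v : V) (c : R) : 0 <= c -> (forall i, `|v 0 i| <= c) -> `|v| <= c.
Proof.
move=> c0 H; have -> : `|v| = mx_norm v by [].
by rewrite mx_normrE; apply: bigmax_le => // -[k l] _; rewrite (ord1 k); exact: H.
Qed.

Lemma C12_jet Omega u t x : open Omega -> C12 Omega u -> 0 < t -> Omega x ->
  jet u t x (derive1 (u^~ x) t) (fun i => partial i (u t) x)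
    (fun i => partial i (partial i (u t)) x).
Proof.
move=> oO [H _ _ _ _] t0 Ox.
have [dt _ dp] := H t x (conj t0 Ox).
split; first by rewrite derive1E; exact: dird_derive.
move=> i; exists (partial i (u t)); split=> //; last exact: diff_dird.
have [r r0 Hr] := open_normP oO Ox; exists r => // s sr.
have Os : Omega (x + s *: ee i).
  apply: Hr; rewrite opprD addrA subrr sub0r normrN.
  exact: le_lt_trans (norm_scale_delta i s) sr.
have [_ d1 _] := H t _ (conj t0 Os); exact: diff_dird.
Qed.

Lemma jet_shift w t x y a g H : jet w t (x + y) a g H ->
  jet (fun t x => w t (x + y)) t x a g H.
Proof.
move=> [T1 S1]; split=> // i.
have sh (f : V -> R) z d : dird f (z + y) (ee i) d -> dird (fun x => f (x + y)) z (ee i) d.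
  move=> Hf e e0; have [r r0 Hr] := Hf e e0; exists r => // s sr.
  by rewrite [z + _ + y]addrAC Hr.
have [d [[r r0 D] E F]] := S1 i; exists (fun x => d (x + y)); split => //; last exact: sh.
exists r => // s sr; have := D s sr; rewrite [x + y + _]addrAC; exact: sh.
Qed.

Lemma jetZ w t x a g H c : jet w t x a g H ->
  jet (fun t x => c * w t x) t x (c * a) (fun i => c * g i) (fun i => c * H i).
Proof.
move=> [T1 S1]; split; first exact: dirdZ.
move=> i; have [d [[r r0 D] E F]] := S1 i.
exists (fun y => c * d y); split; [|by rewrite E|exact: dirdZ].
by exists r => // s sr; apply: dirdZ; exact: D.
Qed.

Lemma dird_slice_opp f (x v : V) d s : dird f (x - s *: v) v d ->
  dird (fun s : R => f (x - s *: v)) s 1 (- d).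
Proof.
move=> H e e0; have [r r0 Hr] := H e e0; exists r => // t tr.
rewrite [t *: 1]mulr1.
have := Hr (- t); rewrite normrN => /(_ tr).
rewrite (_ : x - (s + t) *: v = x - s *: v + (- t) *: v); last first.
  by rewrite scalerDl scaleNr opprD addrA.
by rewrite mulrN mulNr.
Qed.

Lemma dird_quad (K D r : R) : dird (fun s : R => K * (s * (2 * D - s))) r 1 (K * (2 * D - 2 * r)).
Proof.
apply: dirdZ.
have I : dird (fun s : R => s) r 1 1 by apply/dirdP; exact: is_derive_id.
have := dirdM I (dirdB (dird_cst (2 * D) r (1 : R)) I).
by congr dird; ring.
Qed.

End JetsOfSolutions.

(** * Gradient bounds by doubling of variables *)

Section Doubling.
Context {R : realType} {n : nat}.
Local Notation V := 'rV[R]_n.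
Local Notation ee i := (delta_mx 0 i : V).

(* At an interior maximum of c (u(y + s e_i) - u(y - s e_i)) - B(t, s) both
   gradients agree, so the nonlinear term cancels. *)
Theorem doubling (Omega : set V) (F : V -> R) u0 (u : R -> V -> R)
    (i : 'I_n) (t0 t1 K D m c : R) :
  open Omega -> bounded_set Omega -> classical_solution Omega F u0 u ->
  0 <= t0 -> t0 < t1 -> 0 <= m -> m < 2 * K -> c = 1 \/ c = -1 ->
  (forall x, closure Omega x -> `|x| < D) ->
  (forall t x, t0 <= t <= t1 -> closure Omega x -> 0 <= u t x) ->
  (forall t x z s, t0 < t <= t1 -> closure Omega x -> bdry Omega z -> 0 <= s ->
     x = z + s *: ee i \/ x = z - s *: ee i -> u t x <= K * D / 2 * s) ->
  (forall y s, 0 <= s -> closure Omega (y + s *: ee i) -> closure Omega (y - s *: ee i) ->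
     c * (u t0 (y + s *: ee i) - u t0 (y - s *: ee i))
       <= K * (s * (2 * D - s)) + m * (t1 - t0)) ->
  forall y s, 0 <= s -> closure Omega (y + s *: ee i) -> closure Omega (y - s *: ee i) ->
     c * (u t1 (y + s *: ee i) - u t1 (y - s *: ee i)) <= K * (s * (2 * D - s)).
Proof.
move=> oO bO [cu C12u eqn ub _] t00 t01 m0 mK c1 hD hpos hb h0.
have cn : `|c| = 1 by case: c1 => ->; rewrite ?normrN normr1.
have K0 : 0 < K by lra.
have hs y s : 0 <= s -> closure Omega (y + s *: ee i) -> closure Omega (y - s *: ee i) -> s < D.
  move=> s0 /hD H1 /hD H2.
  have : `|2 * s| < 2 * D.
    have := coord_le_norm (y + s *: ee i) i; have := coord_le_norm (y - s *: ee i) i.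
    rewrite !mxE !eqxx !mulr1 => A1 A2.
    rewrite (_ : 2 * s = (y 0 i + s) - (y 0 i - s)); last by ring.
    by rewrite (le_lt_trans (ler_normB _ _))//; lra.
  by rewrite ger0_norm ?mulr_ge0//; lra.
pose P (z : R * V * R) := z.1.2 + z.2 *: ee i.
pose Q (z : R * V * R) := z.1.2 - z.2 *: ee i.
have sd (z z' : R * V * R) : [/\ `|z.1.1 - z'.1.1| <= `|z - z'|, `|z.1.2 - z'.1.2| <= `|z - z'|
    & `|z.2 - z'.2| <= `|z - z'|].
  rewrite [`|z - z'|]prod_normE [`|(z - z').1|]prod_normE/=.
  by split; rewrite !le_max lexx ?orbT.
have dP z z' : `|P z - P z'| <= 2 * `|z - z'|.
  rewrite (_ : _ - _ = (z.1.2 - z'.1.2) + (z.2 - z'.2) *: ee i); last first.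
    by rewrite /P scalerBl; apply/rowP => j; rewrite !mxE; ring.
  have [_ H1 H2] := sd z z'.
  rewrite (le_trans (ler_normD _ _))// (_ : 2 * _ = `|z - z'| + `|z - z'|); last by ring.
  by apply: lerD => //; exact: le_trans (norm_scale_delta i _) H2.
have dQ z z' : `|Q z - Q z'| <= 2 * `|z - z'|.
  rewrite (_ : _ - _ = (z.1.2 - z'.1.2) - (z.2 - z'.2) *: ee i); last first.
    by rewrite /Q scalerBl; apply/rowP => j; rewrite !mxE; ring.
  have [_ H1 H2] := sd z z'.
  rewrite (le_trans (ler_normB _ _))// (_ : 2 * _ = `|z - z'| + `|z - z'|); last by ring.
  by apply: lerD => //; exact: le_trans (norm_scale_delta i _) H2.
have contlip (G : R * V * R -> V) : (forall z z', `|G z - G z'| <= 2 * `|z - z'|) -> continuous G.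
  move=> H z; apply/cvgrPdist_lt => e e0; apply: ((@near_normP R _ z (fun t => `|G z - G t| < e)).2); exists (e / 2); first by rewrite divr_gt0.
  by move=> y zy; rewrite (le_lt_trans (H _ _))//; lra.
pose A : set (R * V * R) := (`[t0, t1]%classic `*` [set y : V | `|y| <= 2 * D] `*` `[0, D]%classic)
   `&` (P @^-1` closure Omega `&` Q @^-1` closure Omega).
have half x r : closure Omega (x + r *: ee i) -> closure Omega (x - r *: ee i) -> `|x| <= 2 * D.
  move=> /hD X1 /hD X2.
  have -> : x = 2^-1 *: ((x + r *: ee i) + (x - r *: ee i)).
    by apply/rowP => j; rewrite !mxE; field.
  rewrite normrZ ger0_norm ?invr_ge0//.
  have X3 := ler_normD (x + r *: ee i) (x - r *: ee i).
  have X4 := normr_ge0 (x + r *: ee i).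
  clear -X1 X2 X3 X4; rewrite mulrC ler_pdivrMr//; lra.
have Ain t x r : t0 <= t <= t1 -> 0 <= r -> closure Omega (x + r *: ee i) ->
    closure Omega (x - r *: ee i) -> A ((t, x), r).
  move=> H1 H2 H3 H4; refine (conj (conj (conj _ _) _) (conj H3 H4)).
  - by rewrite /= in_itv.
  - exact: half H3 H4.
  - by rewrite /= in_itv/= H2 ltW// (hs _ _ H2 H3 H4).
have cA : compact A.
  apply: compact_closedI.
    apply: compact_setX; last exact: segment_compact.
    apply: compact_setX; first exact: segment_compact.
    apply: bounded_closed_compact.
      exists (2 * D); split; first exact: num_real.
      by move=> r Dr y /= yD; rewrite (le_trans yD)// ltW.
    apply: (@closed_comp _ _ (fun y : V => `|y|) [set r | r <= 2 * D]).
      by move=> y _; exact: norm_continuous.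
    exact: closed_le.
  apply: closedI; apply: closed_comp; do ?[exact: closed_closure] => z _; exact: contlip.
(* [K * (s * (2 * D - s))] has second derivative [- 2 * K] in [s]. The term [m * (t1 - t)] tolerates
   a jump of size [m * (t1 - t0)] at [t0] and is gone at [t1]; by [m < 2 * K] the concavity pays for
   its time derivative. *)
pose W (z : R * V * R) := c * (u z.1.1 (P z) - u z.1.1 (Q z))
   - (K * (z.2 * (2 * D - z.2)) + m * (t1 - z.1.1)).
have cW : {within A, continuous W}.
  have cc (G : R * V * R -> V) : (forall z z', `|G z - G z'| <= 2 * `|z - z'|) ->
      (A `<=` G @^-1` closure Omega) -> {within A, continuous (fun z => u z.1.1 (G z))}.
    move=> HG AG; apply/within_contP => z Az e e0.
    have Bz y : A y -> 0 <= y.1.1 by move=> [[[+ _] _] _]; rewrite /= in_itv/= => /andP[? _]; lra.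
    have [r r0 Hr] := (within_contP _ _).1 cu (z.1.1, G z) (conj (Bz _ Az) (AG _ Az)) e e0.
    exists (r / 2); first by rewrite divr_gt0.
    move=> y Ay zy; apply: (Hr (y.1.1, G y)); first by split; [exact: Bz|exact: AG].
    rewrite [`|_|]prod_normE gt_max /= (le_lt_trans (HG _ _)) ?andbT; last by lra.
    by have [H _ _] := sd z y; rewrite (le_lt_trans H)//; lra.
  have c1' := cc P dP (fun z Az => Az.2.1); have c2' := cc Q dQ (fun z Az => Az.2.2).
  have cq : {within A, continuous (fun z : R * V * R => K * (z.2 * (2 * D - z.2)) + m * (t1 - z.1.1))}.
    apply: continuous_subspaceT => z.
    have s2 : {for z, continuous (fun z : R * V * R => z.2)} by exact: cvg_snd.
    have s1 : {for z, continuous (fun z : R * V * R => z.1.1)}.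
      by apply: (@cvg_comp _ _ _ fst fst); [exact: cvg_fst|exact: cvg_fst].
    apply: cvgD; apply: cvgM; try exact: cvg_cst.
      by apply: cvgM => //; apply: cvgB => //; exact: cvg_cst.
    by apply: cvgB => //; exact: cvg_cst.
  have c3 : {within A, continuous (fun z => u z.1.1 (P z) - u z.1.1 (Q z))}.
    by move=> z; apply: cvgB; [exact: c1'|exact: c2'].
  move=> z; apply: cvgB; last exact: cq.
  by apply: cvgM; [exact: cvg_cst|exact: c3].
move=> y s s0 Cp Cm; rewrite -subr_ge0 leNgt; apply/negP => neg.
have sD := hs y s s0 Cp Cm.
have Ays : A ((t1, y), s) by apply: Ain => //; rewrite lexx ltW.
have [|[[t x] r] /set_mem Az M] := compact_EVT_max _ cA cW.
  by exists ((t1, y), s).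
have := M ((t1, y), s); rewrite inE => /(_ Ays); rewrite {1}/W/= /P/Q/= subrr mulr0 addr0 => M0.
have Wp : 0 < W ((t, x), r) by clear -M0 neg; lra.
case: (Az) => [[[/= tI _] rI] [Ap Am]]; rewrite /P/Q/= in Ap Am.
move: tI rI; rewrite !in_itv/= => /andP[tt0 tt1] /andP[r0 _].
have rD := hs _ _ r0 Ap Am.
have Br0 : 0 <= K * (r * (2 * D - r)) by rewrite !mulr_ge0 ?(ltW K0)//; clear -r0 rD; lra.
have mt0 : 0 <= m * (t1 - t) by rewrite mulr_ge0// subr_ge0.
have Wpos : K * (r * (2 * D - r)) + m * (t1 - t) < c * (u t (x + r *: ee i) - u t (x - r *: ee i)).
  by move: Wp; rewrite /W/P/Q/=; clear; lra.
have tpos : t0 < t.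
  rewrite lt_neqAle tt0 andbT; apply/eqP => tE; have := h0 x r r0 Ap Am.
  by rewrite tE; clear -Wpos; lra.
have tt : t0 <= t <= t1 by rewrite tt0 tt1.
have tt' : t0 < t <= t1 by rewrite tpos tt1.
have tp : 0 < t by exact: le_lt_trans tpos.
have hup := hpos t _ tt Ap; have hum := hpos t _ tt Am.
have cle (a b : R) : 0 <= a -> 0 <= b -> c * (a - b) <= Num.max a b.
  clear -c1; move=> a0 b0; rewrite le_max; case: c1 => ->.
    by apply/orP; left; lra.
  by apply/orP; right; lra.
(* If one of the points is on the boundary, [u] vanishes there and the other point is at distance at
   most [2 * r] from it; since [r < D], the boundary hypothesis stays below the barrier. *)
have KD : K * D / 2 * (2 * r) <= K * (r * (2 * D - r)).
  rewrite (_ : _ * (2 * r) = K * (r * D)); last by field.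
  by rewrite ler_pM2l// ler_wpM2l//; clear -rD; lra.
have rp : 0 < r.
  rewrite lt_neqAle r0 andbT; apply/eqP => rE; move: Wpos; rewrite -rE !scale0r !addr0 !subr0 subrr mulr0.
  by clear -mt0; lra.
have Op : Omega (x + r *: ee i).
  have [//|bp] := closure_split oO Ap; exfalso.
  have := hb t (x - r *: ee i) (x + r *: ee i) (2 * r) tt' Am bp; rewrite mulr_ge0// => /(_ isT).
  have -> : x - r *: ee i = x + r *: ee i - (2 * r) *: ee i.
    by apply/rowP => j; rewrite !mxE; ring.
  move=> /(_ (or_intror erefl)) Hb.
  have := cle _ _ hup hum; rewrite (ub _ _ tp bp).
  have -> : x - r *: ee i = x + r *: ee i - (2 * r) *: ee i.
    by apply/rowP => j; rewrite !mxE; ring.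
  have := ub _ _ tp bp => E; move: Wpos; rewrite E.
  have -> : x - r *: ee i = x + r *: ee i - (2 * r) *: ee i.
    by apply/rowP => j; rewrite !mxE; ring.
  move=> Hw Hc; have : Num.max 0 (u t (x + r *: ee i - (2 * r) *: ee i)) <= K * (r * (2 * D - r)).
    by clear -Hb KD Br0; rewrite ge_max Br0/=; lra.
  by clear -Hw Hc mt0; lra.
have Om : Omega (x - r *: ee i).
  have [//|bp] := closure_split oO Am; exfalso.
  have := hb t (x + r *: ee i) (x - r *: ee i) (2 * r) tt' Ap bp; rewrite mulr_ge0// => /(_ isT).
  have -> : x + r *: ee i = x - r *: ee i + (2 * r) *: ee i.
    by apply/rowP => j; rewrite !mxE; ring.
  move=> /(_ (or_introl erefl)) Hb.
  have := cle _ _ hup hum; rewrite (ub _ _ tp bp).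
  have -> : x + r *: ee i = x - r *: ee i + (2 * r) *: ee i.
    by apply/rowP => j; rewrite !mxE; ring.
  have := ub _ _ tp bp => E; move: Wpos; rewrite E.
  have -> : x + r *: ee i = x - r *: ee i + (2 * r) *: ee i.
    by apply/rowP => j; rewrite !mxE; ring.
  move=> Hw Hc; have : Num.max (u t (x - r *: ee i + (2 * r) *: ee i)) 0 <= K * (r * (2 * D - r)).
    by clear -Hb KD Br0; rewrite ge_max Br0 andbT; lra.
  by clear -Hw Hc mt0; lra.
have [rho1 rho10 Hr1] := open_normP oO Op; have [rho2 rho20 Hr2] := open_normP oO Om.
(* Small enough to keep both points in [Omega], the time above [t0] and the separation [r + q]
   positive. *)
pose rho := Num.min (Num.min rho1 rho2) (Num.min (t - t0) r).
have rho0 : 0 < rho by rewrite !lt_min rho10 rho20 subr_gt0 tpos.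
have mov (p : V) r' j (q : R) : `|q| < r' -> `|p - (p + q *: ee j)| < r'.
  move=> qr; rewrite opprD addrA subrr sub0r normrN.
  exact: le_lt_trans (norm_scale_delta j q) qr.
have inA t' x' r' : t0 <= t' <= t1 -> 0 <= r' -> closure Omega (x' + r' *: ee i) ->
    closure Omega (x' - r' *: ee i) -> W ((t', x'), r') <= W ((t, x), r).
  by move=> H1 H2 H3 H4; apply: M; rewrite inE; exact: Ain.
have Jp := C12_jet oO C12u tp Op; have Jm := C12_jet oO C12u tp Om.
have J := jet_opp_time (- m) (jetZ c (jetB (jet_shift Jp) (jet_shift Jm))).
have [||dt dx d2] := jet_max rho0 _ _ J.
- move=> q /andP[q0]; rewrite !lt_min => /andP[_ /andP[qt _]].
  have := inA (t - q) x r; rewrite /W/P/Q/= => /(_ _ r0 Ap Am).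
  have -> : t0 <= t - q <= t1.
    by clear -qt q0 tt1; apply/andP; split; lra.
  by move=> /(_ isT) X; clear -X; lra.
- move=> j q; rewrite !lt_min => /andP[/andP[q1 q2] _].
  have := inA t (x + q *: ee j) r tt r0; rewrite /W/P/Q/= => H.
  have -> : x + q *: ee j - r *: ee i = x - r *: ee i + q *: ee j by rewrite addrAC.
  have -> : x + q *: ee j + r *: ee i = x + r *: ee i + q *: ee j by rewrite addrAC.
  have E1 : x + q *: ee j + r *: ee i = x + r *: ee i + q *: ee j by rewrite addrAC.
  have E2 : x + q *: ee j - r *: ee i = x - r *: ee i + q *: ee j by rewrite addrAC.
  rewrite E1 E2 in H.
  have := H (subset_closure (Hr1 _ (mov _ _ _ _ q1))) (subset_closure (Hr2 _ (mov _ _ _ _ q2))).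
  by clear; lra.
have gE : grad (u t) (x + r *: ee i) = grad (u t) (x - r *: ee i).
  apply/rowP => j; rewrite !mxE; have /eqP := dx j.
  rewrite mulf_eq0 -normr_eq0 cn oner_eq0/= subr_eq0 => /eqP.
  by [].
have := eqn _ _ tp Op; have := eqn _ _ tp Om; rewrite gE => Em Ep.
have [_ Sp] := Jp; have [_ Sm] := Jm.
have [dp [[rp1 rp10 Dp] Ep1 Ep2]] := Sp i; have [dm [[rm1 rm10 Dm] Em1 Em2]] := Sm i.
(* In direction [i] the points are moved apart instead of together. This varies [s], so the
   concavity of the barrier yields [- 2 * K], where a common translation would only yield [0]. *)
have d2i : c * (partial i (partial i (u t)) (x + r *: ee i) -
       partial i (partial i (u t)) (x - r *: ee i)) - (K * -2) <= 0.
  pose f q := c * (u t ((x + r *: ee i) + q *: ee i) - u t ((x - r *: ee i) - q *: ee i))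
     - (K * ((r + q) * (2 * D - (r + q)))).
  pose df q := c * (dp ((x + r *: ee i) + q *: ee i) - - dm ((x - r *: ee i) - q *: ee i))
     - (K * (2 * D - 2 * (r + q))).
  apply: (@dird_max2 _ f df 0 _ (Num.min rho (Num.min rp1 rm1))).
  - by rewrite lt_min rho0 lt_min rp10.
  - move=> q; rewrite lt_min => /andP[+ _]; rewrite !lt_min => /andP[/andP[q1 q2] /andP[_ q3]].
    rewrite add0r /f !scale0r !addr0 subr0.
    have rq : 0 <= r + q by rewrite -lerBlDl sub0r ltW//; move: q3; rewrite ltr_norml => /andP[].
    have := inA t x (r + q) tt rq; rewrite /W/P/Q/= scalerDl opprD !addrA => H.
    have := H (subset_closure (Hr1 _ (mov _ _ _ _ q1))).
    have qn : `|- q| < rho2 by rewrite normrN.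
    have := Hr2 _ (mov (x - r *: ee i) _ i (- q) qn); rewrite scaleNr => qO.
    move=> /(_ (subset_closure qO)).
    by clear; lra.
  - move=> q; rewrite !lt_min => /andP[_ /andP[qp qm]]; rewrite add0r; apply: dirdB.
      apply: dirdZ; apply: dirdB; first by apply: dird_slice; exact: Dp.
      by apply: dird_slice_opp; have := Dm (- q); rewrite normrN => /(_ qm); rewrite scaleNr.
    have := @dird_quad R K D (r + q) => Hq.
    have := @dird_slice R R (fun s => K * (s * (2 * D - s))) r 1 _ q; rewrite [q *: 1]mulr1.
    move=> /(_ _ Hq); apply: dird_eq; exists 1 => // z _.
    by rewrite [_%:A]mulr1.
  - apply: dirdB.
      apply: dirdZ.
      have -> : partial i (partial i (u t)) (x + r *: ee i) - partial i (partial i (u t)) (x - r *: ee i)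
        = partial i (partial i (u t)) (x + r *: ee i) - - - partial i (partial i (u t)) (x - r *: ee i).
        by rewrite opprK.
      apply: dirdB; first by apply: dird_slice; rewrite scale0r addr0.
      by apply: dirdN; apply: dird_slice_opp; rewrite scale0r subr0.
    apply: dirdZ.
    have I : dird (fun s : R => s) 0 1 1 by apply/dirdP; exact: is_derive_id.
    have := dirdB (dird_cst (2 * D) (0 : R) (1 : R)) (dirdZ 2 (dirdD (dird_cst r (0 : R) (1 : R)) I)).
    by congr dird; ring.
have lapE : c * (laplacian (u t) (x + r *: ee i) - laplacian (u t) (x - r *: ee i)) <= - (2 * K).
  rewrite /laplacian -sumrB mulr_sumr (bigD1 i)//= -[leRHS]addr0; apply: lerD.
    by move: d2i; clear; rewrite mulrN opprK -lerBrDr sub0r (mulrC K).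
  by apply: sumr_le0 => j _; exact: d2.
move: dt lapE; clear -Em Ep mK.
set Lp := laplacian _ _ in Ep *; set Lm := laplacian _ _ in Em *.
set Tp := derive1 _ _ in Ep *; set Tm := derive1 _ _ in Em *.
set Fm := F _ in Em Ep; clearbody Lp Lm Tp Tm Fm => dt lapE.
(* Equal gradients cancel [F]. The time test gives [c * (Tp - Tm) >= - m], the space tests
   [c * (Lp - Lm) <= - 2 * K], which is less than [- m]. *)
have E : Tp - Tm = Lp - Lm by lra.
by rewrite E in dt; lra.
Qed.

End Doubling.

(** * The lazy random walk and discrete gradient bounds *)

Section LazyAverage.
Context {R : realType} {n : nat}.
Local Notation Z := 'rV[int]_n.
Local Notation ez i := (delta_mx 0 i : Z).
Implicit Types (g : Z -> R) (z y : Z) (i j : 'I_n).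

(* One step of the lazy random walk: laziness removes the parity oscillation
   (-1)^(k + |z|), for which no interior gradient estimate holds. *)
Definition lavg g z : R :=
  2^-1 * g z + (4 * n%:R)^-1 * \sum_i (g (z + ez i) + g (z - ez i)).

Hypothesis hn : (0 < n)%N.

Let n0 : 0 < n%:R :> R. Proof. by rewrite ltr0n. Qed.
Let c0 : 0 < (4 * n%:R)^-1 :> R. Proof. by rewrite invr_gt0 mulr_gt0. Qed.

Lemma lavgE g z : lavg g z =
  g z + (4 * n%:R)^-1 * \sum_i (g (z + ez i) + g (z - ez i) - 2 * g z).
Proof.
rewrite /lavg sumrB sumr_const card_ord -mulr_natl; field.
by rewrite gt_eqF.
Qed.

Lemma lavg_le g1 g2 z : g1 z <= g2 z ->
  (forall i, g1 (z + ez i) <= g2 (z + ez i)) ->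
  (forall i, g1 (z - ez i) <= g2 (z - ez i)) -> lavg g1 z <= lavg g2 z.
Proof.
move=> H1 H2 H3; apply: lerD; first by rewrite ler_wpM2l// invr_ge0.
by rewrite ler_wpM2l ?(ltW c0)//; apply: ler_sum => i _; exact: lerD.
Qed.

Lemma lavg_cst c z : lavg (fun=> c) z = c.
Proof. by rewrite lavgE big1 ?mulr0 ?addr0// => i _; ring. Qed.

Lemma lavgD g1 g2 z : lavg (fun x => g1 x + g2 x) z = lavg g1 z + lavg g2 z.
Proof.
rewrite /lavg mulrDr [X in _ + _ * X](_ : _ = \sum_i (g1 (z + ez i) + g1 (z - ez i))
  + \sum_i (g2 (z + ez i) + g2 (z - ez i))); first by ring.
by rewrite -big_split/=; apply: eq_bigr => i _; ring.
Qed.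

Lemma lavgZ c g z : lavg (fun x => c * g x) z = c * lavg g z.
Proof.
rewrite /lavg mulrDr; congr (_ + _); first by ring.
rewrite mulrCA; congr (_ * _); rewrite mulr_sumr.
by apply: eq_bigr => i _; ring.
Qed.

Lemma lavgB g1 g2 z : lavg (fun x => g1 x - g2 x) z = lavg g1 z - lavg g2 z.
Proof.
rewrite -mulN1r -lavgZ -lavgD; congr lavg.
by apply/funext => x; rewrite mulN1r.
Qed.

Lemma lavg_translate g z v : lavg (fun x => g (x + v)) z = lavg g (z + v).
Proof.
rewrite /lavg; congr (_ + _ * _).
by apply: eq_bigr => i _; rewrite addrAC [z - _ + _]addrAC.
Qed.

Lemma lavg_norm_le g z M : `|g z| <= M -> (forall i, `|g (z + ez i)| <= M) ->
  (forall i, `|g (z - ez i)| <= M) -> `|lavg g z| <= M.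
Proof.
move=> H1 H2 H3; have lo x : `|x| <= M -> - M <= x by rewrite ler_norml => /andP[].
rewrite ler_norml; apply/andP; split.
  by rewrite -(lavg_cst (- M) z); apply: lavg_le => [|i|i]; exact: lo.
by rewrite -(lavg_cst M z); apply: lavg_le => [|i|i]; rewrite (le_trans (ler_norm _)).
Qed.

End LazyAverage.

Section PairComparison.
Context {R : realType} {n : nat}.
Local Notation Z := 'rV[int]_n.
Local Notation ez i := (delta_mx 0 i : Z).
Hypothesis hn : (0 < n)%N.
Variables (i : 'I_n) (w : nat -> Z -> R).

(** The two points are mirror images in the hyperplane halfway between [y] and [y + ez i]. The extra
    [+ 1] makes [s = 0] the unit difference that is wanted, and the reflection sends index [-1] to
    minus index [0]. *)
Definition reflected_diff k (y : Z) (s : nat) : R :=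
  w k (y + ez i *+ s.+1) - w k (y - ez i *+ s).
Local Notation W := reflected_diff.

(** Neighbours in direction [i] are paired outward with outward and inward with inward, so that this
    direction changes [s] while the others translate [y]. At [s = 0] the inward move exchanges the
    two points, whence [- W k y 0]. *)
Lemma reflected_diff_step k y s :
  w k.+1 (y + ez i *+ s.+1) = lavg (w k) (y + ez i *+ s.+1) ->
  w k.+1 (y - ez i *+ s) = lavg (w k) (y - ez i *+ s) ->
  W k.+1 y s = 2^-1 * W k y s + (4 * n%:R)^-1 *
    (\sum_(j | j != i) (W k (y + ez j) s + W k (y - ez j) s)
     + (W k y s.+1 + if s is s'.+1 then W k y s' else - W k y 0)).
Proof.
move=> E1 E2; rewrite /W E1 E2 /lavg.
set a := y + ez i *+ s.+1; set b := y - ez i *+ s.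
rewrite [LHS](_ : _ = 2^-1 * (w k a - w k b) + (4 * n%:R)^-1 *
  (\sum_j (w k (a + ez j) + w k (a - ez j)) - \sum_j (w k (b + ez j) + w k (b - ez j)))); last by ring.
congr (_ + _ * _).
rewrite (bigD1 i)//= [\sum_j (w k (b + _) + _)](bigD1 i)//=.
rewrite [LHS](_ : _ = (\sum_(j < n | j != i) (w k (a + ez j) + w k (a - ez j)) -
    \sum_(j < n | j != i) (w k (b + ez j) + w k (b - ez j)))
  + (w k (a + ez i) + w k (a - ez i) - (w k (b + ez i) + w k (b - ez i)))); last by ring.
rewrite /a /b {a b}.
congr (_ + _).
  rewrite -sumrB; apply: eq_bigr => j _.
  rewrite (addrAC y (ez j)) (addrAC y (- ez j)) (addrAC y (ez j)) (addrAC y (- ez j)); ring.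
have -> : y + ez i *+ s.+1 + ez i = y + ez i *+ s.+2 by rewrite -addrA -mulrSr.
have -> : y - ez i *+ s - ez i = y - ez i *+ s.+1 by rewrite -addrA -opprD -mulrSr.
have -> : y + ez i *+ s.+1 - ez i = y + ez i *+ s by rewrite mulrSr addrA addrK.
case: s {E1 E2} => [|s]; first by rewrite !mulr0n !mulr1n subr0 addr0; ring.
have -> : y - ez i *+ s.+1 + ez i = y - ez i *+ s by rewrite mulrSr opprD addrA subrK.
ring.
Qed.

Definition lsq (y : Z) : R := \sum_j ((y 0 j)%:~R) ^+ 2.

Lemma lsq_ge0 y : 0 <= lsq y.
Proof. by apply: sumr_ge0 => j _; exact: sqr_ge0. Qed.

Lemma lsq_step y j : lsq (y + ez j) + lsq (y - ez j) = 2 * lsq y + 2.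
Proof.
rewrite /lsq -big_split mulr_sumr/= (bigD1 j)//= [in RHS](bigD1 j)//=.
rewrite [X in _ + X](_ : _ = \sum_(k < n | k != j) 2 * ((y 0 k)%:~R) ^+ 2).
  by rewrite !mxE !eqxx/= rmorphD rmorphB/=; ring.
by apply: eq_bigr => k kj; rewrite !mxE (negPf kj) andbF mulr0n ?subr0 ?addr0; ring.
Qed.

(** With [sigma = s + 1/2], half the distance of the pair, the middle bracket is
    [2 r sigma - sigma^2 + 1/4], the discrete counterpart of the parabola in [doubling]. The terms
    with [a] and [c] localise in space and time. *)
Definition pair_barrier (y1 : Z) (a b c r : R) (N k : nat) (y : Z) (s : nat) : R :=
  a * lsq (y - y1) + b * (2 * r * (s%:R + 2^-1) - s%:R * (s%:R + 1)) + c * (N%:R - k%:R).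

(** A maximum principle for pairs: [G] is the interior, where the recursion holds, and [P] contains
    it with its neighbours. The condition on [a], [b], [c] says that the second difference [- 2 * b]
    in [s] outweighs [2 * a] from each of the [n - 1] other directions and the time slope [c]. *)
Lemma pair_comparison (P G : Z -> nat -> Prop) y1 a b c r N :
  0 <= a -> 0 <= b -> 0 <= c -> 0 <= r -> a * (n%:R - 1) + 2 * n%:R * c <= b ->
  let B := pair_barrier y1 a b c r N in
  (forall y s, P y s -> W 0 y s <= B 0 y s) ->
  (forall k y s, (k < N)%N -> P y s -> ~ G y s -> W k.+1 y s <= B k.+1 y s) ->
  (forall k y s, (k < N)%N -> G y s ->
    w k.+1 (y + ez i *+ s.+1) = lavg (w k) (y + ez i *+ s.+1) /\
    w k.+1 (y - ez i *+ s) = lavg (w k) (y - ez i *+ s)) ->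
  (forall y s, G y s -> [/\ P y s, P y s.+1, P y s.-1 &
     forall j, j != i -> P (y + ez j) s /\ P (y - ez j) s]) ->
  forall k y s, (k <= N)%N -> P y s -> W k y s <= B k y s.
Proof.
move=> a0 b0 c0 r0 abc B H0 Hout Hrec HG; elim=> [|k IH] y s kN Pys; first exact: H0.
have [Gys|nG] := pselect (G y s); last exact: Hout.
have [E1 E2] := Hrec k y s kN Gys.
have [_ P1 Pm PJ] := HG y s Gys.
rewrite reflected_diff_step//.
have k'N := ltnW kN.
have n0 : 0 < n%:R :> R by rewrite ltr0n.
have n1 : 1 <= n%:R :> R by rewrite ler1n.
have q0 : 0 < (4 * n%:R)^-1 :> R by rewrite invr_gt0 mulr_gt0.
have kNr : k%:R <= N%:R :> R by rewrite ler_nat.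
pose A := a * lsq (y - y1); pose T := c * (N%:R - k%:R).
have A0 : 0 <= A by rewrite mulr_ge0// lsq_ge0.
have T0 : 0 <= T by rewrite mulr_ge0// subr_ge0.
pose g (t : R) := 2 * r * (t + 2^-1) - t * (t + 1).
have BE (t : nat) : B k y t = A + b * g t%:R + T by [].
have SJ : \sum_(j < n | j != i) (W k (y + ez j) s + W k (y - ez j) s) <=
    (n%:R - 1) * (2 * B k y s + 2 * a).
  rewrite (_ : (n%:R - 1) * _ = \sum_(j < n | j != i) (2 * B k y s + 2 * a)); last first.
    rewrite sumr_const -[RHS]mulr_natl; congr (_ * _).
    by rewrite (eq_card (B := predC1 i))// cardC1 card_ord -subn1 natrB.
  apply: ler_sum => j ji; have [Pp Pn] := PJ j ji.
  apply: (le_trans (lerD (IH _ _ k'N Pp) (IH _ _ k'N Pn))).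
  rewrite /B/pair_barrier [y + ez j - y1]addrAC [y - ez j - y1]addrAC le_eqVlt; apply/orP; left; apply/eqP.
  have E : lsq (y - y1 + ez j) = 2 * lsq (y - y1) + 2 - lsq (y - y1 - ez j) :> R.
    by rewrite -(lsq_step (y - y1) j) addrK.
  rewrite E; ring.
have key : 2^-1 * (A + b * g s%:R + T) + (4 * n%:R)^-1 *
   ((n%:R - 1) * (2 * (A + b * g s%:R + T) + 2 * a) + ((A + b * g (s%:R + 1) + T) + (A + b * g (s%:R - 1) + T)))
   <= B k.+1 y s.
  rewrite /B/pair_barrier -/A -/(g s%:R) (natrD _ 1 k) -subr_ge0.
  rewrite [leRHS](_ : _ = 2 * (4 * n%:R)^-1 * (b - (a * (n%:R - 1) + 2 * n%:R * c))); last first.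
    by rewrite /T/g; field; rewrite gt_eqF.
  by rewrite mulr_ge0 ?mulr_ge0 ?(ltW q0)// subr_ge0.
apply: le_trans key.
have IH1 := IH _ _ k'N P1; rewrite BE -natr1 in IH1.
have IHs := IH _ _ k'N Pys; rewrite BE in IHs SJ.
case: s Pys Gys E1 E2 P1 Pm PJ SJ IH1 IHs => [|s] Pys Gys E1 E2 P1 Pm PJ SJ IH1 IHs.
  rewrite sub0r.
  have g0 : g 0 = r by rewrite /g; field.
  have g1 : g (- 1) = - r by rewrite /g; field.
  rewrite g0 in IHs SJ *; rewrite g1.
  have br : 0 <= b * r by rewrite mulr_ge0.
  set S := \sum_(j < n | _) _ in SJ *.
  set W0 := W k y 0 in IHs *; set W1 := W k y 1 in IH1 *.
  set q := (4 * n%:R)^-1 in q0 *.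
  (* At [s = 0] the recursion contains [- W k y 0], which an upper bound does not control. Laziness
     leaves the total coefficient [2^-1 - q] of [W k y 0], and this is non-negative. *)
  have q4 : q <= 2^-1 by rewrite /q lef_pV2 ?posrE ?mulr_gt0//; lra.
  have X1 : q * (S + W1) <= q * ((n%:R - 1) * (2 * (A + b * r + T) + 2 * a) + (A + b * g (0%:R + 1) + T)).
    by rewrite ler_pM2l//; apply: lerD.
  have X2 : (2^-1 - q) * W0 <= (2^-1 - q) * (A + b * r + T) by rewrite ler_wpM2l// subr_ge0.
  have X3 : 0 <= q * (A + T) by rewrite mulr_ge0 ?(ltW q0)// addr_ge0.
  rewrite [leLHS](_ : _ = q * (S + W1) + (2^-1 - q) * W0); last by ring.
  apply: le_trans (lerD X1 X2) _.
  by rewrite -subr_ge0 [leRHS](_ : _ = 2 * (q * (A + T))); [rewrite mulr_ge0|ring].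
have IHm := IH _ _ k'N Pm; rewrite BE in IHm.
apply: lerD; first by rewrite ler_wpM2l// invr_ge0.
rewrite ler_pM2l//; apply: lerD => //; apply: lerD => //.
by rewrite (_ : s.+1%:R - 1 = s%:R)// -natr1 addrK.
Qed.

End PairComparison.

Section LatticeGradient.
Context {R : realType} {n : nat}.
Local Notation Z := 'rV[int]_n.
Local Notation ez i := (delta_mx 0 i : Z).
Hypothesis hn : (0 < n)%N.

Definition lnear (y1 z : Z) (r : R) := forall j, `|(z 0 j - y1 0 j)%:~R : R| <= r.

Let norm_bool_mulrn (b : bool) (s : nat) : `|((b%:R : int) *+ s)%:~R : R| <= s%:R.
Proof.
rewrite rmorphMn/=; case: b => /=; first by rewrite mulr1z normr_nat.
by rewrite mulr0z mul0rn normr0.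
Qed.

Lemma lnear_shift y1 z r j (s : nat) : lnear y1 z r -> lnear y1 (z + ez j *+ s) (r + s%:R).
Proof.
move=> H k; rewrite mxE mulmxnE !mxE addrAC rmorphD/= (le_trans (ler_normD _ _))// lerD//; exact: norm_bool_mulrn.
Qed.

Lemma lnear_shiftN y1 z r j (s : nat) : lnear y1 z r -> lnear y1 (z - ez j *+ s) (r + s%:R).
Proof.
move=> H k; rewrite !mxE mulmxnE !mxE addrAC rmorphB/= (le_trans (ler_normB _ _))// lerD//; exact: norm_bool_mulrn.
Qed.

(* Interior gradient bound by comparison of reflected differences (Brandt). *)
Lemma lattice_gradient_up i (w : nat -> Z -> R) y1 M r N :
  0 < r -> (0 < N)%N -> 0 <= M ->
  (forall k z, (k <= N)%N -> lnear y1 z (2 * r + 3) -> `|w k z| <= M) ->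
  (forall k z, (k < N)%N -> lnear y1 z (2 * r + 3) -> w k.+1 z = lavg (w k) z) ->
  w N (y1 + ez i) - w N y1 <= 2 * M * n%:R * (r^-2 + 2 / N%:R) * (r + 1).
Proof.
move=> r0 N0 M0 Hb Hr.
(* [a * r ^+ 2 = 2 * M] covers pairs that leave in space, [c * N%:R = 2 * M] covers the initial
   time, and [b >= a] lets the bracket cover pairs with [s > r]. *)
pose a := 2 * M / r ^+ 2; pose c := 2 * M / N%:R; pose b := a * n%:R + 2 * n%:R * c.
have N0' : 0 < N%:R :> R by rewrite ltr0n.
have n0 : 0 <= n%:R :> R by rewrite ler0n.
have a0 : 0 <= a by apply: divr_ge0; [exact: mulr_ge0|exact: sqr_ge0].
have c0 : 0 <= c by rewrite divr_ge0 ?mulr_ge0// ltW.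
have b0 : 0 <= b by rewrite addr_ge0 ?(mulr_ge0 a0)// !mulr_ge0.
(* The points of a pair in [P] lie within [(r + 1) + (r + 2)] of [y1]; hence the radius [2 * r + 3]
   in the hypotheses. *)
pose P (y : Z) (s : nat) := lnear y1 y (r + 1) /\ s%:R <= r + 1.
pose G (y : Z) (s : nat) := lnear y1 y r /\ s%:R <= r.
have PW k y s : (k <= N)%N -> P y s -> reflected_diff i w k y s <= 2 * M.
  move=> kN [P1 P2].
  have near3 z q : lnear y1 z q -> q <= 2 * r + 3 -> lnear y1 z (2 * r + 3).
    by move=> Hz qr j; exact: le_trans (Hz j) qr.
  have X1 : `|w k (y + ez i *+ s.+1)| <= M.
    by apply: Hb => //; apply: near3 (lnear_shift i s.+1 P1) _; rewrite -natr1; lra.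
  have X2 : `|w k (y - ez i *+ s)| <= M.
    by apply: Hb => //; apply: near3 (lnear_shiftN i s P1) _; lra.
  rewrite /reflected_diff; have := ler_normB (w k (y + ez i *+ s.+1)) (w k (y - ez i *+ s)).
  by have := ler_norm (w k (y + ez i *+ s.+1) - w k (y - ez i *+ s)); lra.
have gpos y s : P y s -> 0 <= 2 * (r + 1) * (s%:R + 2^-1) - s%:R * (s%:R + 1) :> R.
  move=> [_ sr]; have s0 : 0 <= s%:R :> R by rewrite ler0n.
  rewrite [leRHS](_ : _ = s%:R * (2 * (r + 1) - s%:R - 1) + (r + 1)); last by field.
  by rewrite addr_ge0// ?mulr_ge0//; lra.
have := @pair_comparison R n hn i w P G y1 a b c (r + 1) N a0 b0 c0.
move=> /(_ _ _ _ _ _ _ N y1 0%N (leqnn N)) H.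
have := H; rewrite /reflected_diff mulr1n mulr0n subr0 => {}H.
apply: le_trans (H _ _ _ _ _ _ _) _.
- by rewrite addr_ge0 ?ltW.
- by rewrite /b lerD2r ler_wpM2l// gerBl.
- move=> y s Pys; rewrite (le_trans (PW 0%N y s (leq0n N) Pys))// /pair_barrier subr0.
  have -> : c * N%:R = 2 * M by rewrite /c divfK// gt_eqF.
  rewrite lerDr; apply: addr_ge0; first by rewrite mulr_ge0 ?lsq_ge0.
  by apply: mulr_ge0 => //; exact: (gpos y s Pys).
- move=> k y s kN Pys nG; rewrite (le_trans (PW k.+1 y s kN Pys))// /pair_barrier.
  have T0 : 0 <= c * (N%:R - k.+1%:R) by rewrite mulr_ge0// subr_ge0 ler_nat.
  have A0 : 0 <= a * lsq (y - y1) by rewrite mulr_ge0 ?lsq_ge0.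
  have B0 : 0 <= b * (2 * (r + 1) * (s%:R + 2^-1) - s%:R * (s%:R + 1)) by apply: mulr_ge0 => //; exact: (gpos y s Pys).
  have aM : a * r ^+ 2 = 2 * M by rewrite /a divfK// gt_eqF ?exprn_gt0.
  have [sr|rs] := leP s%:R r.
    have [j Hj] : exists j, r < `|(y 0 j - y1 0 j)%:~R : R|.
      apply: contrapT => /forallNP K; apply: nG; split=> // j.
      by rewrite leNgt; apply/negP; exact: K.
    have : a * r ^+ 2 <= a * lsq (y - y1).
      rewrite ler_wpM2l// /lsq (bigD1 j)//= !mxE.
      rewrite -[leLHS]addr0; apply: lerD; last by apply: sumr_ge0 => l _; exact: sqr_ge0.
      by rewrite -[leRHS]real_normK ?num_real// ler_pXn2r ?nnegrE ?(ltW r0) ?(ltW Hj).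
    by rewrite aM; lra.
  have s1 : s%:R <= r + 1 by case: Pys.
  have : a * r ^+ 2 <= b * (2 * (r + 1) * (s%:R + 2^-1) - s%:R * (s%:R + 1)).
    apply: ler_pM => //; first by rewrite sqr_ge0.
      rewrite /b -[leLHS]addr0 lerD ?mulr_ge0// -[leLHS]mulr1 ler_wpM2l// ler1n//.
    rewrite [leRHS](_ : _ = s%:R * (2 * (r + 1) - s%:R - 1) + (r + 1)); last by field.
    rewrite expr2 -[leLHS]addr0 lerD//; last by lra.
    by clear -rs s1 r0 hn; apply: ler_pM; lra.
  by rewrite aM; lra.
- move=> k y s kN [G1 G2].
  have near3 z q : lnear y1 z q -> q <= 2 * r + 3 -> lnear y1 z (2 * r + 3).
    by move=> Hz qr j; exact: le_trans (Hz j) qr.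
  split; apply: Hr => //.
    by apply: near3 (lnear_shift i s.+1 G1) _; rewrite -natr1; lra.
  by apply: near3 (lnear_shiftN i s G1) _; lra.
- move=> y s [G1 G2].
  have lw q q' : q <= q' -> lnear y1 y q -> lnear y1 y q' by move=> qq K j; exact: le_trans (K j) qq.
  have G1' : lnear y1 y (r + 1) by apply: lw G1; rewrite lerDl.
  split.
  + by split=> //; lra.
  + by split=> //; rewrite -natr1; lra.
  + by split=> //; rewrite (le_trans _ (_ : s%:R <= _)) ?ler_nat ?leq_pred//; lra.
  + move=> j _; split; split; try (clear -G2 r0 hn; lra).
      by have := lnear_shift j 1 G1; rewrite mulr1n.
    by have := lnear_shiftN j 1 G1; rewrite mulr1n.
- split; last by rewrite addr_ge0// ltW.
  by move=> j; rewrite subrr normr0 addr_ge0// ltW.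
rewrite /pair_barrier !subrr mulr0 addr0.
have -> : lsq (0 : Z) = 0 :> R by rewrite /lsq big1// => j _; rewrite mxE expr0n.
rewrite mulr0 add0r /b /a /c le_eqVlt; apply/orP; left; apply/eqP.
by field; rewrite !gt_eqF.
Qed.

Lemma lattice_gradient i (w : nat -> Z -> R) y1 M r N :
  0 < r -> (0 < N)%N -> 0 <= M ->
  (forall k z, (k <= N)%N -> lnear y1 z (2 * r + 3) -> `|w k z| <= M) ->
  (forall k z, (k < N)%N -> lnear y1 z (2 * r + 3) -> w k.+1 z = lavg (w k) z) ->
  `|w N (y1 + ez i) - w N y1| <= 2 * M * n%:R * (r^-2 + 2 / N%:R) * (r + 1).
Proof.
move=> r0 N0 M0 Hb Hr; rewrite ler_norml; apply/andP; split; last exact: lattice_gradient_up.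
rewrite lerNl opprB.
rewrite [leLHS](_ : _ = - w N (y1 + ez i) - - w N y1); last by rewrite opprK addrC.
apply: (@lattice_gradient_up i (fun k z => - w k z)) => //.
  by move=> k z kN zn; rewrite normrN; exact: Hb.
move=> k z kN zn; rewrite Hr// -mulN1r -lavgZ; congr lavg.
by apply/funext => x; rewrite mulN1r.
Qed.

End LatticeGradient.

(** * Barriers at the boundary *)

Section Euclid.
Context {R : realType} {n : nat}.
Local Notation V := 'rV[R]_n.
Local Notation ee i := (delta_mx 0 i : V).
Implicit Types (v : V) (Omega : set V).

Definition sqn v : R := \sum_i v 0 i ^+ 2.

Lemma sqn_ge0 v : 0 <= sqn v.
Proof. by apply: sumr_ge0 => i _; exact: sqr_ge0. Qed.

Lemma coord_le_sqn v i : v 0 i ^+ 2 <= sqn v.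
Proof.
rewrite /sqn (bigD1 i)//= -[leLHS]addr0; apply: lerD => //.
by apply: sumr_ge0 => j _; exact: sqr_ge0.
Qed.

Lemma sqnZ c v : sqn (c *: v) = c ^+ 2 * sqn v.
Proof. by rewrite /sqn mulr_sumr; apply: eq_bigr => i _; rewrite mxE exprMn. Qed.

Lemma norm_le_sqn v c : 0 <= c -> sqn v <= c ^+ 2 -> `|v| <= c.
Proof.
move=> c0 H; apply: norm_le_coord => // i.
by rewrite -(ler_pXn2r (ltn0Sn 1)) ?nnegrE// real_normK ?num_real// (le_trans (coord_le_sqn v i)).
Qed.

Lemma sqn_le_norm v c : `|v| <= c -> sqn v <= n%:R * c ^+ 2.
Proof.
move=> H; rewrite (_ : _ * _ = \sum_(i < n) c ^+ 2); last first.
  by rewrite sumr_const card_ord mulr_natl.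
apply: ler_sum => i _; rewrite -[leLHS]real_normK ?num_real//.
have := le_trans (coord_le_norm v i) H => Hi.
by rewrite ler_pXn2r ?nnegrE// (le_trans _ Hi).
Qed.

Lemma sqn_delta v (s : R) i : sqn (v + s *: ee i) = sqn v + 2 * s * v 0 i + s ^+ 2.
Proof.
rewrite /sqn (bigD1 i)//= [in RHS](bigD1 i)//= !mxE !eqxx/=.
rewrite [X in _ + X](_ : _ = \sum_(j < n | j != i) v 0 j ^+ 2); first by ring.
by apply: eq_bigr => j ji; rewrite !mxE (negPf ji) andbF mulr0 addr0.
Qed.

Lemma sqn_delta_ge v (h r : R) i : 0 <= h -> h <= r -> r ^+ 2 <= sqn v ->
  (r - h) ^+ 2 <= sqn (v + h *: ee i) /\ (r - h) ^+ 2 <= sqn (v - h *: ee i).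
Proof.
move=> h0 hr rv; pose q := Num.sqrt (sqn v).
have q0 : 0 <= q by exact: sqrtr_ge0.
have qE : q ^+ 2 = sqn v by rewrite sqr_sqrtr// sqn_ge0.
have rq : r <= q by rewrite -(ler_pXn2r (ltn0Sn 1)) ?nnegrE ?qE//; lra.
have vq : `|v 0 i| <= q.
  by rewrite -(ler_pXn2r (ltn0Sn 1)) ?nnegrE// real_normK ?num_real// qE coord_le_sqn.
have rq2 : (r - h) ^+ 2 <= (q - h) ^+ 2 by rewrite ler_pXn2r ?nnegrE//; lra.
have hv : `|h * v 0 i| <= h * q by rewrite normrM ger0_norm// ler_wpM2l.
have := hv; rewrite ler_norml => /andP[v1 v2].
have qh : (q - h) ^+ 2 = sqn v - 2 * (h * q) + h ^+ 2 by rewrite -qE; ring.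
rewrite -scaleNr !sqn_delta sqrrN; split; apply: (le_trans rq2); rewrite qh.
  by rewrite lerD2r lerD2l -mulrA; lra.
by rewrite lerD2r lerD2l mulrN mulNr -mulrA; lra.
Qed.

Lemma sqn_diff_le v1 v2 c : `|v1 + v2| <= c -> sqn v1 - sqn v2 <= n%:R * (`|v1 - v2| * c).
Proof.
move=> H; rewrite (_ : n%:R * _ = \sum_(i < n) (`|v1 - v2| * c)); last first.
  by rewrite sumr_const card_ord mulr_natl.
rewrite /sqn -sumrB; apply: ler_sum => i _; rewrite subr_sqr.
apply: (le_trans (ler_norm _)); rewrite normrM; apply: ler_pM => //.
  by have := coord_le_norm (v1 - v2) i; rewrite !mxE.
by have := le_trans (coord_le_norm (v1 + v2) i) H; rewrite !mxE.
Qed.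

Definition exterior_ball Omega r := forall w, bdry Omega w ->
  exists y, sqn (w - y) = r ^+ 2 /\ forall x, Omega x -> r ^+ 2 <= sqn (x - y).

(** First exit along the segment. That all earlier points lie in [Omega] later permits the mean
    value theorem almost up to the boundary. *)
Lemma exit_point Omega x z : open Omega -> Omega x -> ~ Omega z ->
  exists2 c : R, 0 <= c <= 1 & bdry Omega (x + c *: (z - x)) /\
    forall c', 0 <= c' < c -> Omega (x + c' *: (z - x)).
Proof.
move=> oO Ox nOz.
pose S := [set c : R | 0 <= c <= 1 /\ forall c', 0 <= c' <= c -> Omega (x + c' *: (z - x))].
have S0 : S 0.
  split; first by rewrite lexx ler01.
  by move=> c' /le_anti <-; rewrite scale0r addr0.
have hS : has_sup S by split; [exists 0|exists 1 => c [/andP[]]].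
pose c := sup S.
have c0 : 0 <= c by apply: ub_le_sup => //; exact: hS.2.
have c1 : c <= 1 by apply: ge_sup; [exists 0|move=> s [/andP[]]].
have below c' : 0 <= c' < c -> Omega (x + c' *: (z - x)).
  move=> /andP[c'0 c'c]; have cc : 0 < c - c' by rewrite subr_gt0.
  have [s [_ Ss] cs] := sup_adherent cc hS.
  by apply: Ss; rewrite c'0 ltW//; move: cs; rewrite -/c opprB addrC subrK.
pose p c := x + c *: (z - x).
have pd a b : `|p a - p b| <= `|a - b| * (`|z - x| + 1).
  rewrite /p opprD addrACA subrr add0r -scalerBl normrZ ler_wpM2l// lerDl//.
have N1 : 0 < `|z - x| + 1 by rewrite ltr_wpDl.
have nOc : ~ Omega (p c).
  move=> Oc; have [r r0 Hr] := open_normP oO Oc.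
  have c1' : c < 1.
    rewrite lt_neqAle c1 andbT; apply/eqP => cE; apply: nOz; move: Oc.
    by rewrite /p cE scale1r addrC subrK.
  pose d := Num.min (r / (`|z - x| + 1) / 2) (1 - c).
  have d0 : 0 < d by rewrite lt_min !divr_gt0// subr_gt0.
  have : S (c + d).
    split; first by apply/andP; split; [rewrite addr_ge0// ltW|rewrite -lerBrDl ge_min lexx orbT].
    move=> c' /andP[c'0 c'd]; have [c'c|cc'] := ltP c' c; first by apply: below; rewrite c'0.
    apply: Hr; apply: le_lt_trans (pd _ _) _; rewrite -ltr_pdivlMr//.
    rewrite distrC ger0_norm ?subr_ge0//.
    have : d <= r / (`|z - x| + 1) / 2 by rewrite ge_min lexx.
    have : 0 < r / (`|z - x| + 1) by rewrite divr_gt0.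
    lra.
  move=> /(ub_le_sup hS.2); rewrite -/c; lra.
exists c; [by rewrite c0|split => //]; split; last by move=> /interior_subset.
have [cE|cn0] := eqVneq c 0.
  by exfalso; apply: nOc; rewrite /p cE scale0r addr0.
move=> B /near_normP[r r0 Hr].
have cp : 0 < c by rewrite lt_neqAle eq_sym cn0.
pose d := Num.min (r / (`|z - x| + 1) / 2) c.
have d0 : 0 < d by rewrite lt_min !divr_gt0.
exists (p (c - d)); split.
  by apply: below; rewrite subr_ge0 ge_min lexx orbT/= gtrBl.
apply: Hr; apply: le_lt_trans (pd _ _) _; rewrite -ltr_pdivlMr// opprB addrC subrK gtr0_norm//.
have : d <= r / (`|z - x| + 1) / 2 by rewrite ge_min lexx.
have : 0 < r / (`|z - x| + 1) by rewrite divr_gt0.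
lra.
Qed.

Lemma exit_bdry Omega x z : open Omega -> Omega x -> ~ Omega z ->
  exists2 w, bdry Omega w & `|x - w| <= `|x - z|.
Proof.
move=> oO Ox nz; have [c /andP[c0 c1] [bw _]] := exit_point oO Ox nz.
exists (x + c *: (z - x)) => //.
by rewrite opprD addrA subrr sub0r normrN normrZ ger0_norm// distrC ler_piMl.
Qed.

(** With [b = a / 2] the right side is [2 + (e^b - e^(-b))^2], and [e^b - e^(-b) >= b] for
    [b >= 0]. *)
Lemma expR_even_ge (a : R) : 2 + a ^+ 2 / 4 <= expR a + expR (- a).
Proof.
have half (b : R) : 0 <= b -> b <= expR b - expR (- b).
  move=> b0; have := expR_ge1Dx b; have : expR (- b) <= 1 by rewrite -expR0 ler_expR oppr_le0.
  lra.
have -> : expR a + expR (- a) = 2 + (expR (a / 2) - expR (- (a / 2))) ^+ 2.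
  rewrite [X in expR X](_ : a = a / 2 + a / 2); last by field.
  rewrite [X in _ + expR X](_ : - a = - (a / 2) + - (a / 2)); last by field.
  have E : expR (a / 2) * expR (- (a / 2)) = 1 by rewrite -expRD subrr expR0.
  rewrite !expRD sqrrB E; ring.
rewrite lerD2l.
have -> : a ^+ 2 / 4 = `|a / 2| ^+ 2 by rewrite real_normK ?num_real//; field.
have -> : (expR (a / 2) - expR (- (a / 2))) ^+ 2 = (expR `|a / 2| - expR (- `|a / 2|)) ^+ 2.
  have [a0|a0] := leP 0 (a / 2); first by rewrite ger0_norm.
  by rewrite ltr0_norm// opprK -[RHS]sqrrN opprB.
by rewrite ler_pXn2r ?nnegrE ?half//; have := half _ (normr_ge0 (a / 2)); have := normr_ge0 (a / 2); lra.
Qed.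

End Euclid.

Section Barrier.
Context {R : realType} {n : nat}.
Local Notation V := 'rV[R]_n.
Local Notation Z := 'rV[int]_n.
Local Notation ee i := (delta_mx 0 i : V).
Local Notation ez i := (delta_mx 0 i : Z).
Hypothesis hn : (0 < n)%N.
Implicit Types (Omega : set V).

Definition pt (h : R) (z : Z) : V := \row_i (h * (z 0 i)%:~R).

Lemma ptD h z z' : pt h (z + z') = pt h z + pt h z'.
Proof. by apply/rowP => j; rewrite !mxE rmorphD/= mulrDr. Qed.

Lemma ptN h z : pt h (- z) = - pt h z.
Proof. by apply/rowP => j; rewrite !mxE rmorphN/= mulrN. Qed.

Lemma pt_ez h i : pt h (ez i) = h *: ee i.
Proof. by apply/rowP => j; rewrite !mxE; case: (_ && _); rewrite ?mulr1z ?mulr0z. Qed.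

(** Lattice version of the classical barrier: [e^(- al |x - y|^2)] is strictly subharmonic where
    [al |x - y|^2] is large compared with [n]. For [t = al h^2 <= 1/2] the choice of [al] leaves the
    factor [(1 - t) (1 + 4 t) >= 1 + t]. *)
Lemma exp_barrier (al h r : R) (y : V) z : 0 < r -> al = 8 * n%:R / r ^+ 2 ->
  al * h ^+ 2 <= 2^-1 -> r ^+ 2 <= sqn (pt h z - y) ->
  (1 + al * h ^+ 2 / 2) * expR (- (al * sqn (pt h z - y))) <=
    lavg (fun z => expR (- (al * sqn (pt h z - y)))) z.
Proof.
move=> r0 alE hsm rz; pose E z := expR (- (al * sqn (pt h z - y))).
rewrite -/E -/(E z).
have n0 : 0 < n%:R :> R by rewrite ltr0n.
have al0 : 0 < al by rewrite alE divr_gt0 ?mulr_gt0 ?exprn_gt0.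
set v := pt h z - y in rz; have E0 : 0 < E z by exact: expR_gt0.
have step i : E (z + ez i) + E (z - ez i) =
    E z * expR (- (al * h ^+ 2)) * (expR (2 * al * h * v 0 i) + expR (- (2 * al * h * v 0 i))).
  rewrite /E !ptD ptN pt_ez (addrAC _ (h *: _)) (addrAC _ (- (h *: _))) -/v.
  rewrite -[v - h *: _]/(v + - (h *: _)) -[in v + - _]scaleNr !sqn_delta.
  by rewrite [RHS]mulrDr -!expRD [RHS]addrC; congr (expR _ + expR _); ring.
have sq0 : 0 <= al * h ^+ 2 by rewrite mulr_ge0 ?(ltW al0) ?sqr_ge0.
have S : E z * (1 - al * h ^+ 2) * (2 * n%:R * (1 + 4 * (al * h ^+ 2))) <=
    \sum_i (E (z + ez i) + E (z - ez i)).
  rewrite (eq_bigr _ (fun i _ => step i)) -mulr_sumr.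
  apply: ler_pM.
  - by rewrite mulr_ge0 ?(ltW E0)//; lra.
  - by rewrite !mulr_ge0 ?(ltW n0)//; lra.
  - by rewrite ler_pM2l// (le_trans _ (expR_ge1Dx _)).
  - apply: (@le_trans _ _ (\sum_i (2 + (2 * al * h * v 0 i) ^+ 2 / 4))); last first.
      by apply: ler_sum => i _; exact: expR_even_ge.
    rewrite big_split/= sumr_const card_ord -[2 *+ n]mulr_natr.
    rewrite (eq_bigr (fun i => al ^+ 2 * h ^+ 2 * v 0 i ^+ 2)); last by move=> i _; field.
    rewrite -mulr_sumr -/(sqn v).
    have : al ^+ 2 * h ^+ 2 * r ^+ 2 <= al ^+ 2 * h ^+ 2 * sqn v.
      by rewrite ler_wpM2l// mulr_ge0 ?sqr_ge0.
    have -> : al ^+ 2 * h ^+ 2 * r ^+ 2 = 8 * n%:R * (al * h ^+ 2).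
      by rewrite alE; field; rewrite gt_eqF.
    lra.
have q0 : 0 < (4 * n%:R)^-1 :> R by rewrite invr_gt0 mulr_gt0.
rewrite /lavg; apply: le_trans (_ : 2^-1 * E z + (4 * n%:R)^-1 *
   (E z * (1 - al * h ^+ 2) * (2 * n%:R * (1 + 4 * (al * h ^+ 2)))) <= _); last first.
  by rewrite lerD2l ler_pM2l.
have -> : (4 * n%:R)^-1 * (E z * (1 - al * h ^+ 2) * (2 * n%:R * (1 + 4 * (al * h ^+ 2)))) =
   2^-1 * (E z * ((1 - al * h ^+ 2) * (1 + 4 * (al * h ^+ 2)))).
  by field; rewrite gt_eqF.
move: (al * h ^+ 2) hsm sq0 => t t1 t0.
have : 1 + t <= (1 - t) * (1 + 4 * t).
  have : 0 <= t * (2^-1 - t) by rewrite mulr_ge0//; lra.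
  lra.
rewrite -(ler_pM2l E0); lra.
Qed.

(** The function is [1 - K e^(- al |x - y|^2)] with [y] the centre of the exterior ball at [w]. Its
    lower bound by the distance to a point of the complement lets it dominate Lipschitz data that
    vanish outside; its upper bound carries the estimate to the boundary point [w]. *)
Lemma boundary_barrier Omega r : open Omega -> bounded_set Omega -> 0 < r ->
  exterior_ball Omega r ->
  exists c0 C h0, [/\ 0 < c0, 0 < C, 0 < h0 &
   forall h, 0 < h <= h0 -> forall w, bdry Omega w -> exists Phi : Z -> R,
   forall z, Omega (pt h z) ->
   [/\ lavg Phi z <= Phi z - c0 * h ^+ 2,
       forall i, 0 <= Phi (z + ez i) /\ 0 <= Phi (z - ez i),
       0 <= Phi z,
       Phi z <= C * (`|pt h z - w| + h) &
       exists2 w', ~ Omega w' & `|pt h z - w'| <= C * Phi z]].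
Proof.
move=> oO bO r0 ext.
have [D D0 HD] : exists2 D : R, 0 < D & forall x, closure Omega x -> `|x| <= D.
  have [M [Mr HM]] := compact_bounded (compact_closure bO).
  exists (`|M| + 1); first by rewrite ltr_wpDl.
  by move=> x cx; apply: (HM (`|M| + 1)) => //; rewrite (le_lt_trans (ler_norm M))// ltrDl.
have n0 : 0 < n%:R :> R by rewrite ltr0n.
pose al := 8 * n%:R / r ^+ 2; pose D2 := 2 * D + r; pose S := n%:R * D2 ^+ 2.
have al0 : 0 < al by rewrite divr_gt0 ?mulr_gt0 ?exprn_gt0.
pose C1 := al * (n%:R * (2 * D2) + 2 * r).
pose C2 := (expR (- (al * S)) * (al * r))^-1.
have e0 := expR_gt0 (- (al * S)).
have D20 : 0 < D2 by rewrite /D2; lra.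
have C10 : 0 < C1 by rewrite mulr_gt0// addr_gt0 ?mulr_gt0.
have C20 : 0 < C2 by rewrite invr_gt0; apply: mulr_gt0 => //; exact: mulr_gt0.
exists (al * expR (- (al * S)) / 2), (C1 + C2), (Num.min r (Num.min 1 (2 * al)^-1)).
split; first by apply: divr_gt0 => //; exact: mulr_gt0.
- exact: addr_gt0.
- by rewrite !lt_min r0 ltr01 invr_gt0 mulr_gt0.
move=> h /andP[h0]; rewrite !le_min => /andP[hr /andP[h1 hal]] w bw.
have [y [wy Oy]] := ext w bw.
have hsm : al * h ^+ 2 <= 2^-1.
  have : h ^+ 2 <= h by rewrite expr2 ler_piMr// ltW.
  rewrite -(ler_pM2l al0) => H; rewrite (le_trans H)// mulrC -ler_pdivlMr//.
  by rewrite (le_trans hal)// invfM.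
pose E z := expR (- (al * sqn (pt h z - y))).
(* Normalised to vanish on the sphere of radius [r - h]: neighbours of points of [Omega] may enter
   the exterior ball, though no deeper than [h], and the barrier has to be non-negative there. *)
pose K := expR (al * (r - h) ^+ 2).
have K0 : 0 < K by exact: expR_gt0.
exists (fun z => 1 - K * E z) => z Oz.
have PhiE z' : 1 - K * E z' = 1 - expR (- (al * (sqn (pt h z' - y) - (r - h) ^+ 2))).
  by rewrite /K /E -expRD; congr (1 - expR _); ring.
have wyr : `|w - y| <= r by apply: norm_le_sqn; [exact: ltW|rewrite wy].
have xy2 : `|pt h z - y| <= D2.
  have -> : pt h z - y = (pt h z - w) + (w - y) by rewrite addrA subrK.
  rewrite (le_trans (ler_normD _ _))// /D2 lerD// (le_trans (ler_normB _ _))//.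
  by have := HD _ (subset_closure Oz); have := HD _ bw.1; lra.
have szS : sqn (pt h z - y) <= S by exact: sqn_le_norm.
have KE : expR (- (al * S)) <= K * E z.
  rewrite /K /E -expRD ler_expR -[leLHS]add0r; apply: lerD.
    by rewrite mulr_ge0 ?(ltW al0) ?sqr_ge0.
  by rewrite lerN2 ler_pM2l.
have pos z' : (r - h) ^+ 2 <= sqn (pt h z' - y) -> 0 <= 1 - K * E z'.
  move=> H; rewrite PhiE subr_ge0 -expR0 ler_expR oppr_le0 mulr_ge0 ?(ltW al0)// subr_ge0//.
have rz := Oy _ Oz.
have hr2 : (r - h) ^+ 2 <= r ^+ 2 by rewrite ler_pXn2r ?nnegrE//; lra.
split.
- rewrite lavgB// lavg_cst// lavgZ -addrA lerD2l -opprD lerN2.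
  have H := exp_barrier r0 erefl hsm rz; rewrite -/al -/E -/(E z) in H.
  apply: le_trans (_ : K * ((1 + al * h ^+ 2 / 2) * E z) <= _); last by rewrite ler_pM2l.
  have : al * h ^+ 2 / 2 * expR (- (al * S)) <= al * h ^+ 2 / 2 * (K * E z).
    by rewrite ler_wpM2l// divr_ge0// mulr_ge0 ?(ltW al0)// sqr_ge0.
  lra.
- move=> i; have [H1 H2] := sqn_delta_ge i (ltW h0) hr rz.
  split; apply: pos; rewrite ptD ?ptN pt_ez addrAC//.
- by apply: pos; rewrite (le_trans hr2).
- rewrite PhiE.
  set t := al * _; have : 1 - expR (- t) <= t by have := expR_ge1Dx (- t); lra.
  move=> /le_trans; apply; rewrite /t mulrDl.
  have := @sqn_diff_le R n (pt h z - y) (w - y) (2 * D2).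
  have -> : pt h z - y - (w - y) = pt h z - w by rewrite opprB addrA subrK.
  have -> : `|pt h z - y + (w - y)| <= 2 * D2.
    by rewrite (le_trans (ler_normD _ _))//; rewrite /D2 in xy2 *; lra.
  move=> /(_ isT); rewrite wy => H.
  apply: (@le_trans _ _ (C1 * (`|pt h z - w| + h))); last first.
    by rewrite lerDl mulr_ge0 ?(ltW C20)// addr_ge0// ltW.
  rewrite /C1 -mulrA ler_pM2l//.
  have N0 := normr_ge0 (pt h z - w).
  have X1 : 0 <= n%:R * (2 * D2) * h by rewrite !mulr_ge0 ?ltW.
  have X2 : 0 <= 2 * r * `|pt h z - w| by rewrite !mulr_ge0// ltW.
  have X3 : 0 <= h ^+ 2 by exact: sqr_ge0.
  have -> : (r - h) ^+ 2 = r ^+ 2 - 2 * r * h + h ^+ 2 by ring.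
  lra.
pose rho := Num.sqrt (sqn (pt h z - y)).
have rho2 : rho ^+ 2 = sqn (pt h z - y) by rewrite sqr_sqrtr// sqn_ge0.
have rrho : r <= rho by rewrite -(ler_pXn2r (ltn0Sn 1)) ?nnegrE ?sqrtr_ge0 ?rho2//; lra.
have rho0 : 0 < rho by lra.
(* The radial projection onto the exterior sphere. It is not in [Omega], for by openness [Omega]
   would then contain points strictly inside the ball. *)
exists (y + (r / rho) *: (pt h z - y)).
  move=> Ow; have [d d0 Hd] := open_normP oO Ow.
  pose q := pt h z - y.
  pose s := Num.min (2^-1) (d / (`|q| + 1) / 2).
  have q1 : 0 < `|q| + 1 by rewrite ltr_wpDl.
  have s0 : 0 < s by rewrite lt_min invr_gt0 ltr0n !divr_gt0.
  have sh : s <= 2^-1 by rewrite ge_min lexx.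
  have t1 : r / rho <= 1 by rewrite ler_pdivrMr// mul1r.
  have t0 : 0 < r / rho by rewrite divr_gt0.
  have : Omega (y + (r / rho * (1 - s)) *: q).
    apply: Hd; rewrite opprD addrACA subrr add0r -scalerBl normrZ.
    rewrite (_ : r / rho - _ = r / rho * s); last by ring.
    rewrite (ger0_norm (mulr_ge0 (ltW t0) (ltW s0))).
    have : s * `|q| < d.
      rewrite (@le_lt_trans _ _ (s * (`|q| + 1)))// ?ler_wpM2l ?(ltW s0) ?lerDl// -ltr_pdivlMr//.
      have : s <= d / (`|q| + 1) / 2 by rewrite ge_min lexx orbT.
      have : 0 < d / (`|q| + 1) by rewrite divr_gt0.
      lra.
    by apply: le_lt_trans; rewrite ler_wpM2r// ler_piMl// ltW.
  move=> /Oy; rewrite addrAC subrr add0r sqnZ -rho2 -exprMn.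
  rewrite (_ : _ * rho = r * (1 - s)); last by field; rewrite gt_eqF.
  rewrite ler_pXn2r ?nnegrE ?mulr_ge0 ?(ltW r0)//; last by lra.
  by move=> H; have := mulr_gt0 r0 s0; lra.
have -> : pt h z - (y + (r / rho) *: (pt h z - y)) = (1 - r / rho) *: (pt h z - y).
  by rewrite scalerBl scale1r opprD addrA.
have t1 : r / rho <= 1 by rewrite ler_pdivrMr// mul1r.
rewrite normrZ ger0_norm ?subr_ge0//.
have N : `|pt h z - y| <= rho by apply: norm_le_sqn; [exact: ltW|rewrite rho2].
have N2 : (1 - r / rho) * `|pt h z - y| <= rho - r.
  apply: (@le_trans _ _ ((1 - r / rho) * rho)); first by rewrite ler_wpM2l// subr_ge0.
  by rewrite mulrBl mul1r divfK// gt_eqF.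
apply: (le_trans N2).
(* From [t e^(-t) <= 1 - e^(-t)] and [rho^2 - (r - h)^2 >= r (rho - r)]. *)
have PL : expR (- (al * S)) * (al * r) * (rho - r) <= 1 - K * E z.
  pose t := al * (sqn (pt h z - y) - (r - h) ^+ 2); rewrite PhiE -/t.
  have tE : expR (- t) = K * E z by rewrite /t /K /E -expRD; congr expR; ring.
  have : t * expR (- t) <= 1 - expR (- t).
    have : (1 + t) * expR (- t) <= expR t * expR (- t) by rewrite ler_pM2r ?expR_gt0// expR_ge1Dx.
    by rewrite -expRD subrr expR0; lra.
  apply: le_trans; rewrite tE.
  have tl : al * r * (rho - r) <= t.
    rewrite /t -mulrA ler_pM2l// -rho2.
    have : (r - h) ^+ 2 <= r ^+ 2 by [].
    have : 0 <= rho * (rho - r) by rewrite mulr_ge0 ?(ltW rho0)// subr_ge0.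
    lra.
  have tp : 0 <= al * r * (rho - r) by rewrite mulr_ge0 ?subr_ge0// ltW// mulr_gt0.
  rewrite [leLHS](_ : _ = (al * r * (rho - r)) * expR (- (al * S))); last by ring.
  by apply: ler_pM => //; exact: ltW.
rewrite mulrDl -[leLHS]add0r; apply: lerD.
  by rewrite mulr_ge0 ?(ltW C10)// pos// (le_trans hr2).
by rewrite [leRHS]mulrC /C2 ler_pdivlMr ?(mulr_gt0 e0 (mulr_gt0 al0 r0))// [leLHS]mulrC.
Qed.

End Barrier.

(** * The walk killed outside [Omega]: comparison, boundary and interior estimates *)

Section KilledWalk.
Context {R : realType} {n : nat}.
Local Notation V := 'rV[R]_n.
Local Notation Z := 'rV[int]_n.
Local Notation ee i := (delta_mx 0 i : V).
Local Notation ez i := (delta_mx 0 i : Z).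
Hypothesis hn : (0 < n)%N.
Implicit Types (Omega : set V) (g : Z -> R).

Definition kstep Omega (h : R) g z : R :=
  if `[< Omega (pt h z) >] then lavg g z else 0.

Definition kwalk Omega h g k : Z -> R := iter k (kstep Omega h) g.

Definition offzero Omega h g := forall z, ~ Omega (pt h z) -> g z = 0.

Lemma kwalk_out Omega h g k : offzero Omega h g -> offzero Omega h (kwalk Omega h g k).
Proof.
by move=> H; case: k => [//|k] z nO; rewrite /= /kstep; case: ifP => // /asboolP.
Qed.

Lemma kwalk_in Omega h g k z : Omega (pt h z) ->
  kwalk Omega h g k.+1 z = lavg (kwalk Omega h g k) z.
Proof. by move=> Oz; rewrite /= /kstep; case: ifP => // /asboolP. Qed.

Lemma kwalkD Omega h g k m : kwalk Omega h g (m + k) = kwalk Omega h (kwalk Omega h g k) m.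
Proof. by rewrite /kwalk iterD. Qed.

Lemma kwalk_ge0 Omega h g k : (forall z, 0 <= g z) -> forall z, 0 <= kwalk Omega h g k z.
Proof.
move=> H; elim: k => [//|k IH] z; rewrite /= /kstep; case: ifP => // _.
by rewrite -[leLHS](lavg_cst hn 0 z); apply: lavg_le.
Qed.

Lemma kwalk_le_cst Omega h g k m : 0 <= m -> (forall z, g z <= m) ->
  forall z, kwalk Omega h g k z <= m.
Proof.
move=> m0 H; elim: k => [//|k IH] z; rewrite /= /kstep; case: ifP => // _.
by rewrite -[leRHS](lavg_cst hn m z); apply: lavg_le.
Qed.

Lemma kwalk_comparison Omega h g (B : nat -> Z -> R) : offzero Omega h g ->
  (forall k z, Omega (pt h z) -> lavg (B k) z <= B k.+1 z) ->
  (forall k z, Omega (pt h z) -> forall i, 0 <= B k (z + ez i) /\ 0 <= B k (z - ez i)) ->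
  (forall z, Omega (pt h z) -> g z <= B 0%N z) ->
  forall k z, Omega (pt h z) -> kwalk Omega h g k z <= B k z.
Proof.
move=> off HB Hn H0; elim=> [|k IH] z Oz; first exact: H0.
rewrite kwalk_in//; apply: le_trans (HB k z Oz).
have ok z' : 0 <= B k z' -> kwalk Omega h g k z' <= B k z'.
  move=> B0; have [Oz'|nO] := pselect (Omega (pt h z')); first exact: IH.
  by rewrite (kwalk_out _ off nO).
by apply: (lavg_le hn) => [|i|i]; [exact: (IH z Oz)|apply: ok; exact: (Hn k z Oz i).1
  |apply: ok; exact: (Hn k z Oz i).2].
Qed.

Lemma lavg_sqn h (c : Z) z :
  lavg (fun z => sqn (pt h (z - c)) : R) z = sqn (pt h (z - c)) + h ^+ 2 / 2.
Proof.
have n0 : 0 < n%:R :> R by rewrite ltr0n.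
rewrite lavgE//; congr (_ + _).
rewrite (eq_bigr (fun _ => 2 * h ^+ 2)); last first.
  move=> i _; rewrite [z + _ - c]addrAC [z - _ - c]addrAC !(ptD _ (z - c)) ptN pt_ez -scaleNr !sqn_delta; ring.
by rewrite sumr_const card_ord -[_ *+ n]mulr_natr; field; rewrite gt_eqF.
Qed.

Lemma extend_out Omega h (U : Z -> R) C : open Omega -> 0 <= C ->
  offzero Omega h U ->
  (forall z w, Omega (pt h z) -> bdry Omega w -> U z <= C * (`|pt h z - w| + h)) ->
  0 <= h -> forall z w, ~ Omega w -> U z <= C * (`|pt h z - w| + h).
Proof.
move=> oO C0 off H h0 z w nw; have [Oz|nO] := pselect (Omega (pt h z)); last first.
  by rewrite off// mulr_ge0 ?addr_ge0.
have [w' bw' ww'] := exit_bdry oO Oz nw.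
by apply: (le_trans (H z w' Oz bw')); rewrite ler_wpM2l// lerD2r.
Qed.

(** [4 n <= k h^2] means that at least one unit of time has passed. The supersolution
    [m (K Phi + max(0, 1 - k q))] starts above [m] and has lost its time part by then, leaving only
    [Phi]. *)
Lemma boundary_smoothing Omega r : open Omega -> bounded_set Omega -> 0 < r ->
  exterior_ball Omega r ->
  exists C h0, [/\ 0 < C, 0 < h0 & forall h, 0 < h <= h0 ->
    forall g m, 0 <= m -> (forall z, 0 <= g z <= m) -> offzero Omega h g ->
    forall k, 4 * n%:R <= k%:R * h ^+ 2 ->
    forall z w, ~ Omega w -> kwalk Omega h g k z <= C * m * (`|pt h z - w| + h)].
Proof.
move=> oO bO r0 ext; have n0 : 0 < n%:R :> R by rewrite ltr0n.
have [c0 [C [h0 [c00 C0 h00 HB]]]] := boundary_barrier hn oO bO r0 ext.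
(* Chosen so that the decrease [K * (c0 * h ^+ 2)] of the barrier equals the loss [q] of the time
   part per step. *)
pose K := (4 * n%:R * c0)^-1.
have K0 : 0 < K by rewrite invr_gt0 !mulr_gt0.
exists (K * C), h0; split => //; first exact: mulr_gt0.
move=> h hh g m m0 gm off k hk; have /andP[hp _] := hh.
apply: extend_out => //.
- by rewrite !mulr_ge0// ltW.
- exact: kwalk_out.
- move=> z w Oz bw; have [Phi HPhi] := HB h hh w bw.
  pose q := h ^+ 2 / (4 * n%:R).
  pose B (j : nat) z := m * (K * Phi z + Num.max 0 (1 - j%:R * q)).
  have q0 : 0 <= q by rewrite divr_ge0 ?sqr_ge0// mulr_ge0// ltW.
  have mx0 j : 0 <= Num.max 0 (1 - j%:R * q) by rewrite le_max lexx.
  apply: (@le_trans _ _ (B k z)); last first.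
    rewrite /B; have -> : Num.max 0 (1 - k%:R * q) = 0.
      apply/max_idPl; rewrite subr_le0 /q mulrA ler_pdivlMr ?mulr_gt0//.
      by rewrite mul1r.
    have [_ _ _ HP _] := HPhi z Oz.
    rewrite addr0 [leRHS](_ : _ = m * (K * (C * (`|pt h z - w| + h)))); last by ring.
    by rewrite ler_wpM2l// ler_pM2l.
  apply: kwalk_comparison => //.
  + move=> j y Oy; have [HP _ _ _ _] := HPhi y Oy.
    rewrite /B lavgZ ler_wpM2l// lavgD lavgZ lavg_cst//.
    apply: (@le_trans _ _ (K * (Phi y - c0 * h ^+ 2) + Num.max 0 (1 - j%:R * q))).
      by rewrite lerD2r ler_pM2l.
    rewrite mulrBr -addrA lerD2l addrC lerBlDr ge_max; apply/andP; split.
      by apply: addr_ge0 => //; rewrite mulr_ge0 ?(ltW K0)// mulr_ge0 ?sqr_ge0// ltW.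
    have -> : K * (c0 * h ^+ 2) = q by rewrite /K /q; field; rewrite !gt_eqF.
    rewrite -lerBlDr le_max; apply/orP; right; rewrite -natr1; lra.
  + move=> j y Oy i; have [_ HP _ _ _] := HPhi y Oy; have [P1 P2] := HP i.
    by rewrite /B; split; rewrite mulr_ge0// addr_ge0// mulr_ge0// ltW.
  + move=> y Oy; have [_ _ HP _ _] := HPhi y Oy; rewrite /B mul0r subr0.
    rewrite -[leLHS]mulr1; apply: (@le_trans _ _ (m * 1)).
      by rewrite !mulr1; case/andP: (gm y).
    rewrite ler_wpM2l//; apply: (@le_trans _ _ (Num.max 0 1)); first by rewrite le_max lexx orbT.
    by rewrite lerDr mulr_ge0// ltW.
- exact: ltW.
Qed.

(** [f] is at most [L] times the distance to the complement, hence at most [L * C * Phi], a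
    supersolution that does not depend on time. *)
Lemma boundary_lipschitz Omega r (f : V -> R) L : open Omega -> bounded_set Omega -> 0 < r ->
  exterior_ball Omega r -> (forall x, 0 <= f x) -> (forall x, ~ Omega x -> f x = 0) ->
  0 <= L -> (forall x y, `|f x - f y| <= L * `|x - y|) ->
  exists C h0, [/\ 0 < C, 0 < h0 & forall h, 0 < h <= h0 ->
    forall k z w, ~ Omega w ->
      kwalk Omega h (fun z => f (pt h z)) k z <= C * (`|pt h z - w| + h)].
Proof.
move=> oO bO r0 ext f0 fO L0 fL.
have [c0 [C [h0 [c00 C0 h00 HB]]]] := boundary_barrier hn oO bO r0 ext.
exists (L * C * C + 1), h0; split => //.
  by rewrite ltr_wpDl// !mulr_ge0// ltW.
move=> h hh k; have /andP[hp _] := hh.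
have off : offzero Omega h (fun z => f (pt h z)) by move=> z; exact: fO.
apply: extend_out => //.
- by rewrite addr_ge0// !mulr_ge0// ltW.
- exact: kwalk_out.
- move=> z w Oz bw; have [Phi HPhi] := HB h hh w bw.
  pose B (j : nat) z := L * C * Phi z.
  have LC0 : 0 <= L * C by rewrite mulr_ge0// ltW.
  have := @kwalk_comparison Omega h _ B off _ _ _ k z Oz; rewrite {4}/B => H.
  apply: (le_trans (H _ _ _)).
  + move=> j y Oy; have [HP _ _ _ _] := HPhi y Oy.
    rewrite /B lavgZ ler_wpM2l// (le_trans HP)// gerBl mulr_ge0 ?sqr_ge0//; exact: ltW.
  + move=> j y Oy i; have [_ HP _ _ _] := HPhi y Oy; have [P1 P2] := HP i.
    by rewrite /B; split; rewrite mulr_ge0.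
  + move=> y Oy; have [_ _ _ _ [w' nw' Hw']] := HPhi y Oy; rewrite /B.
    have := fL (pt h y) w'; rewrite (fO w')// subr0 ger0_norm// => H1.
    by rewrite (le_trans H1)// -mulrA ler_wpM2l.
  have [_ _ _ HP _] := HPhi z Oz.
  apply: (@le_trans _ _ (L * C * (C * (`|pt h z - w| + h)))); first by rewrite ler_wpM2l.
  by rewrite [leRHS]mulrDl mulrA lerDl mul1r addr_ge0// ltW.
- exact: ltW.
Qed.

(** Where both points are inside, the walk and its translate obey the same recursion; where one is
    outside, its value is zero and the other is bounded by hypothesis. *)
Lemma kwalk_translation Omega h g v M : (forall z, 0 <= g z) -> offzero Omega h g ->
  (forall z, `|g (z + v) - g z| <= M) ->
  (forall k z, ~ Omega (pt h (z + v)) -> kwalk Omega h g k z <= M) ->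
  (forall k z, ~ Omega (pt h z) -> kwalk Omega h g k (z + v) <= M) ->
  forall k z, `|kwalk Omega h g k (z + v) - kwalk Omega h g k z| <= M.
Proof.
move=> g0 off H0 H1 H2; elim=> [|k IH] z; first exact: H0.
have [Oz|nO] := pselect (Omega (pt h z)); last first.
  rewrite (kwalk_out _ off nO) subr0 ger0_norm; last exact: kwalk_ge0.
  exact: H2.
have [Ozv|nO] := pselect (Omega (pt h (z + v))); last first.
  rewrite (kwalk_out _ off nO) sub0r normrN ger0_norm; last exact: kwalk_ge0.
  exact: H1.
rewrite !kwalk_in// -lavg_translate -lavgB//.
by apply: lavg_norm_le => //.
Qed.

Lemma kwalk_lipschitz Omega r (f : V -> R) L : open Omega -> bounded_set Omega -> 0 < r ->
  exterior_ball Omega r -> (forall x, 0 <= f x) -> (forall x, ~ Omega x -> f x = 0) ->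
  0 <= L -> (forall x y, `|f x - f y| <= L * `|x - y|) ->
  exists C h0, [/\ 0 < C, 0 < h0 & forall h, 0 < h <= h0 ->
    (forall k z w, ~ Omega w ->
      kwalk Omega h (fun z => f (pt h z)) k z <= C * (`|pt h z - w| + h)) /\
    forall k z v, `|kwalk Omega h (fun z => f (pt h z)) k (z + v) -
       kwalk Omega h (fun z => f (pt h z)) k z| <= C * (`|pt h v| + h)].
Proof.
move=> oO bO r0 ext f0 fO L0 fL.
have [C [h0 [C0 h00 HC]]] := boundary_lipschitz oO bO r0 ext f0 fO L0 fL.
exists (C + L), h0; split=> //; first exact: ltr_pwDl.
move=> h hh; have /andP[hp _] := hh; have HCh := HC h hh.
have CL (t : R) : 0 <= t -> C * t <= (C + L) * t.
  by move=> t0; rewrite ler_wpM2r// lerDl.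
have HH : forall k z w, ~ Omega w ->
      kwalk Omega h (fun z => f (pt h z)) k z <= (C + L) * (`|pt h z - w| + h).
  move=> k z w nw; rewrite (le_trans (HCh k z w nw))// CL// addr_ge0//; exact: ltW.
split=> // k z v; apply: kwalk_translation => //.
- by move=> y; exact: fO.
- move=> y; rewrite (le_trans (fL _ _))// ptD addrAC subrr add0r.
  apply: (@le_trans _ _ ((C + L) * `|pt h v|)); first by rewrite ler_wpM2r// lerDr ltW.
  by rewrite ler_wpM2l ?lerDl ?(ltW hp)// addr_ge0// ltW.
- move=> j y nO; rewrite (le_trans (HH j y _ nO))// ptD opprD addrA subrr sub0r normrN//.
- move=> j y nO; rewrite (le_trans (HH j _ _ nO))// ptD addrAC subrr add0r//.
Qed.

(** The quadratic [Q] solves the recursion exactly, since one step adds [h^2 / 2] to the squared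
    distance, and it lies above the initial oscillation by [t <= d + t^2 / d]. The free [d] yields a
    modulus of order [1/2] in time. *)
Lemma kwalk_time Omega h g C : 0 <= h -> 0 <= C -> (forall z, 0 <= g z) -> offzero Omega h g ->
  (forall z v, `|g (z + v) - g z| <= C * (`|pt h v| + h)) ->
  forall d m z, 0 < d ->
    `|kwalk Omega h g m z - g z| <= C * (h + d + m%:R * h ^+ 2 / 2 / d).
Proof.
move=> h0 C0 g0 off gL d m z0 d0.
pose Q (k : nat) z := C * (h + d) + C / d * (sqn (pt h (z - z0)) + k%:R * h ^+ 2 / 2).
have Q0 k z : 0 <= Q k z.
  apply: addr_ge0; first by rewrite mulr_ge0 ?addr_ge0// ltW.
  rewrite mulr_ge0 ?divr_ge0//; first exact: ltW.
  by rewrite addr_ge0 ?sqn_ge0// divr_ge0// mulr_ge0 ?sqr_ge0.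
have lavgQ k z : lavg (Q k) z = Q k.+1 z.
  have E : lavg (fun z => sqn (pt h (z - z0)) + k%:R * h ^+ 2 / 2) z =
      sqn (pt h (z - z0)) + h ^+ 2 / 2 + k%:R * h ^+ 2 / 2.
    by rewrite lavgD lavg_cst//; congr (_ + _); exact: lavg_sqn.
  by rewrite /Q lavgD lavg_cst// lavgZ E -natr1; ring.
have gQ z : `|g z - g z0| <= Q 0%N z.
  have := gL z0 (z - z0); rewrite (addrC z0) subrK => H; apply: (le_trans H).
  rewrite /Q -mulrA -mulrDr ler_wpM2l// mul0r mul0r addr0.
  set t := `|_|; have t0 : 0 <= t by exact: normr_ge0.
  have : t ^+ 2 <= sqn (pt h (z - z0)).
    have N0 : 0 <= Num.sqrt (sqn (pt h (z - z0))) by exact: sqrtr_ge0.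
    rewrite -[leRHS]sqr_sqrtr ?sqn_ge0// ler_pXn2r ?nnegrE//.
    by apply: norm_le_sqn => //; rewrite sqr_sqrtr ?sqn_ge0.
  move=> Ht; have : d^-1 * t ^+ 2 <= d^-1 * sqn (pt h (z - z0)) by rewrite ler_wpM2l// invr_ge0 ltW.
  have : 0 <= d^-1 * ((t - d) ^+ 2 + t * d).
    by rewrite mulr_ge0 ?invr_ge0 ?(ltW d0)// addr_ge0 ?sqr_ge0// mulr_ge0// ltW.
  rewrite [X in 0 <= X -> _](_ : _ = d^-1 * t ^+ 2 - t + d); last by field; rewrite gt_eqF.
  lra.
have QE : Q m z0 = C * (h + d + m%:R * h ^+ 2 / 2 / d).
  rewrite /Q subrr (_ : pt h 0 = 0); last by apply/rowP => j; rewrite !mxE mulr0.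
  rewrite (_ : sqn 0 = 0); last by rewrite /sqn big1// => j _; rewrite mxE expr0n.
  by field; rewrite gt_eqF.
rewrite -QE ler_norml; apply/andP; split; last first.
  have [Oz|nO] := pselect (Omega (pt h z0)); last first.
    by rewrite (kwalk_out _ off nO) (off _ nO) subrr.
  rewrite lerBlDr.
  apply: (@kwalk_comparison Omega h g (fun k z => Q k z + g z0)) => //.
  - by move=> k z _; rewrite lavgD lavg_cst// lavgQ.
  - by move=> k z _ i; split; apply: addr_ge0.
  - by move=> z _; rewrite -lerBlDr (le_trans (ler_norm _) (gQ z)).
have lo k z : g z0 - Q k z <= kwalk Omega h g k z.
  elim: k z => [|k IH] z.
    by rewrite lerBlDr -lerBlDl (le_trans (ler_norm _))// distrC.
  have [Oz|nO] := pselect (Omega (pt h z)); last first.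
    rewrite (kwalk_out _ off nO) subr_le0.
    have := gQ z; rewrite (off _ nO) sub0r normrN ger0_norm// => /le_trans; apply.
    rewrite /Q lerD2l ler_wpM2l ?divr_ge0 ?(ltW d0)// lerD2l mul0r mul0r.
    by rewrite divr_ge0// mulr_ge0 ?sqr_ge0.
  rewrite kwalk_in// -lavgQ -{1}(lavg_cst hn (g z0) z) -lavgB//.
  by apply: lavg_le.
by have := lo m z0; lra.
Qed.

(** The pair comparison with [a = 0]: a pair leaves the interior only by putting a point outside
    [Omega], where the boundary bound controls the other point. No localisation is involved, and the
    estimate holds up to the boundary. *)
Lemma interior_smoothing Omega h D C m g N : open Omega -> 0 < D ->
  (forall x, Omega x -> `|x| <= D) -> 0 < h -> 0 <= C -> 0 <= m ->
  (forall z, 0 <= g z <= m) -> offzero Omega h g ->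
  (forall k z w, ~ Omega w -> kwalk Omega h g k z <= C * m * (`|pt h z - w| + h)) ->
  4 * n%:R <= N%:R * h ^+ 2 ->
  forall i z, `|kwalk Omega h g N (z + ez i) - kwalk Omega h g N z| <=
    (2 * C / D + 2^-1) * m * h * (D + h).
Proof.
move=> oO D0 HD h0 C0 m0 gm off Hb hN i z.
have n0 : 0 < n%:R :> R by rewrite ltr0n.
have h20 : 0 < h ^+ 2 by rewrite exprn_gt0.
have N0 : 0 < N%:R :> R.
  by rewrite -(pmulr_lgt0 _ h20) (lt_le_trans _ hN)// mulr_gt0.
(* [D / h] bounds [s] for pairs inside [Omega], with one more step for their neighbours. In [b] the
   part [2 * C / D] covers pairs with a point outside, and [2^-1] pays for [c] by [4 n <= N h^2]. *)
pose r := D / h + 1; pose b := (2 * C / D + 2^-1) * m * h ^+ 2; pose c := m / N%:R.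
have Dh0 : 0 < D / h by rewrite divr_gt0.
have r0 : 0 <= r by rewrite addr_ge0// ltW.
have k0 : 0 <= 2 * C / D + 2^-1 by rewrite addr_ge0 ?divr_ge0 ?mulr_ge0// ltW.
have b0 : 0 <= b by apply: mulr_ge0; [exact: mulr_ge0|exact: ltW].
have c0 : 0 <= c by rewrite divr_ge0// ltW.
have cb : 2 * n%:R * c <= b.
  have : 2 * n%:R * c <= 2^-1 * m * h ^+ 2.
    rewrite /c mulrA ler_pdivrMr// [leRHS](_ : _ = m / 2 * (N%:R * h ^+ 2)); last by ring.
    by rewrite [leLHS](_ : _ = m / 2 * (4 * n%:R)); [rewrite ler_wpM2l// divr_ge0|field].
  move=> /le_trans; apply; rewrite /b mulrDl mulrDl -[leLHS]add0r lerD//.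
  by rewrite !mulr_ge0 ?(ltW h20)// ?invr_ge0 ltW.
have rE : b * r = (2 * C / D + 2^-1) * m * h * (D + h) by rewrite /b /r; field; rewrite !gt_eqF.
have gw k z' := kwalk_ge0 Omega h k (fun z => (andP (gm z)).1) z'.
have mw k z' := @kwalk_le_cst Omega h g k m m0 (fun z => (andP (gm z)).2) z'.
pose G (y : Z) (s : nat) := Omega (pt h (y + ez i *+ s.+1)) /\ Omega (pt h (y - ez i *+ s)).
pose P (y : Z) (s : nat) := s%:R <= r.
have dist (y : Z) (s : nat) : pt h (y + ez i *+ s.+1) - pt h (y - ez i *+ s) = (h * (s%:R + s%:R + 1)) *: ee i.
  apply/rowP => j; rewrite !mxE !mulmxnE !mxE.
  case: (_ && _); rewrite rmorphD rmorphB !rmorphMn/= ?mulr1z ?mulr0z -[_ *+ s.+1]mulr_natr -[_ *+ s]mulr_natr -natr1; ring.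
have Gs y s : G y s -> s%:R <= D / h.
  move=> [/HD H1 /HD H2]; have := coord_le_norm (pt h (y + ez i *+ s.+1) - pt h (y - ez i *+ s)) i.
  rewrite {1}dist !mxE !eqxx mulr1 => H.
  have H3 := le_trans (ler_norm _) (le_trans H (ler_normB _ _)).
  rewrite ler_pdivlMr// mulrC.
  have : 0 <= h * s%:R by rewrite mulr_ge0// ltW.
  lra.
have main (e : R) : e = 1 \/ e = -1 ->
    e * (kwalk Omega h g N (z + ez i) - kwalk Omega h g N z) <= b * r.
  move=> e1.
  have ele (a : R) : 0 <= a -> e * a <= a /\ e * - a <= a by move=> a0; clear -e1 a0 hn; case: e1 => ->; split; lra.
  pose w k z := e * kwalk Omega h g k z.
  have gpos s : s%:R <= r -> s%:R * (r - 1) + r <= 2 * r * (s%:R + 2^-1) - s%:R * (s%:R + 1).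
    move=> sr; rewrite [leRHS](_ : _ = s%:R * (2 * r - s%:R - 1) + r); last by field.
    by rewrite lerD2r ler_wpM2l//; lra.
  have r1 : 0 <= r - 1 by rewrite /r addrK ltW.
  have gp (s : nat) : s%:R <= r -> 0 <= 2 * r * (s%:R + 2^-1) - s%:R * (s%:R + 1).
    by move=> sr; rewrite (le_trans _ (gpos _ sr))// addr_ge0// mulr_ge0.
  suff : reflected_diff i w N z 0 <= pair_barrier z 0 b c r N N z 0.
    rewrite /reflected_diff /pair_barrier mulr1n mulr0n subr0 !subrr mulr0 addr0 mul0r add0r /w -mulrBr.
    by move=> /le_trans; apply; rewrite le_eqVlt; apply/orP; left; apply/eqP; field.
  apply: (@pair_comparison R n hn i w P G z 0 b c r N) => //.
  - by rewrite mul0r add0r.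
  - move=> y s Ps; rewrite /reflected_diff /pair_barrier mul0r add0r subr0 /c divfK ?gt_eqF//.
    rewrite /w -mulrBr -[leLHS]add0r; apply: lerD; first exact: (mulr_ge0 b0 (gp s Ps)).
    have X1 := gw 0%N (y + ez i *+ s.+1); have X2 := gw 0%N (y - ez i *+ s).
    have X3 := mw 0%N (y + ez i *+ s.+1); have X4 := mw 0%N (y - ez i *+ s).
    by clear -e1 X1 X2 X3 X4 hn; case: e1 => ->; lra.
  - move=> k y s kN Ps nG; rewrite /reflected_diff /pair_barrier mul0r add0r /w -mulrBr.
    have T0 : 0 <= c * (N%:R - k.+1%:R) by rewrite mulr_ge0// subr_ge0 ler_nat.
    rewrite -[leLHS]addr0; apply: lerD => //.
    have bnd : e * (kwalk Omega h g k.+1 (y + ez i *+ s.+1) - kwalk Omega h g k.+1 (y - ez i *+ s))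
        <= C * m * (h * (s%:R + s%:R + 1) + h).
      have nd : `|(h * (s%:R + s%:R + 1)) *: ee i| <= h * (s%:R + s%:R + 1).
        by rewrite (le_trans (norm_scale_delta _ _))// ger0_norm// mulr_ge0 ?(ltW h0)// addr_ge0// addr_ge0.
      have Cm : 0 <= C * m by rewrite mulr_ge0.
      have [Op|nOp] := pselect (Omega (pt h (y + ez i *+ s.+1))).
        have nOm : ~ Omega (pt h (y - ez i *+ s)) by move=> Om; apply: nG.
        rewrite (kwalk_out _ off nOm) subr0 (le_trans (ele _ (gw _ _)).1)//.
        by rewrite (le_trans (Hb _ _ _ nOm))// ler_wpM2l// lerD2r dist.
      rewrite (kwalk_out _ off nOp) sub0r (le_trans (ele _ (gw _ _)).2)//.
      by rewrite (le_trans (Hb _ _ _ nOp))// ler_wpM2l// lerD2r distrC dist.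
    apply: (le_trans bnd).
    apply: (@le_trans _ _ (b * (s%:R * (r - 1) + r))); last by rewrite ler_wpM2l// gpos.
    have : C * m * (h * (s%:R + s%:R + 1) + h) <= 2 * C / D * m * h ^+ 2 * (s%:R * (r - 1) + r).
      rewrite [leRHS](_ : _ = C * m * h * (2 * (s%:R + 1)) + 2 * C / D * m * h ^+ 2); last first.
        by rewrite /r; field; rewrite !gt_eqF.
      have : 0 <= 2 * C / D * m * h ^+ 2.
        by apply: mulr_ge0 (ltW h20); apply: mulr_ge0 m0; rewrite divr_ge0 ?mulr_ge0// ltW.
      lra.
    move=> /le_trans; apply; rewrite ler_wpM2r//; first by rewrite addr_ge0// mulr_ge0.
    by rewrite /b ler_wpM2r ?(ltW h20)// ler_wpM2r// lerDl.
  - by move=> k y s kN [G1 G2]; rewrite /w lavgZ lavgZ !kwalk_in.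
  - move=> y s Gys; have sD := Gs y s Gys; split.
    + by rewrite /P /r (le_trans sD)// lerDl.
    + by rewrite /P /r -natr1 lerD2r.
    + by rewrite /P /r (@le_trans _ _ s%:R)// ?ler_nat ?leq_pred// (le_trans sD)// lerDl.
    + by move=> j _; rewrite /P /r (le_trans sD)// lerDl.
rewrite -rE ler_norml; apply/andP; split.
  by have := main (-1) (or_intror erefl); lra.
by have := main 1 (or_introl erefl); lra.
Qed.

End KilledWalk.

(** * Limits of lattice functions *)

Section PartialsDifferentiable.
Context {R : realType} {n : nat}.
Local Notation V := 'rV[R]_n.
Local Notation ee i := (delta_mx 0 i : V).
Implicit Types (f : V -> R) (x v : V).

Lemma norm_lt_coord v (c : R) : 0 < c -> (forall i, `|v 0 i| < c) -> `|v| < c.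
Proof.
move=> c0 H; have -> : `|v| = mx_norm v by [].
by rewrite mx_normrE; apply: bigmax_lt => // -[k l] _; rewrite (ord1 k); exact: H.
Qed.

Definition hybrid v (m : nat) : V := \row_j (if (j < m)%N then v 0 j else 0).

Lemma hybrid_norm v m s (i : 'I_n) : `|s| <= `|v| -> i = m :> nat ->
  `|hybrid v m + s *: ee i| <= `|v|.
Proof.
move=> sv im; apply: norm_le_coord => // j; rewrite !mxE eqxx/=.
have [->|ji] := eqVneq j i; first by rewrite im ltnn add0r mulr1.
by rewrite mulr0 addr0; case: ifP => _; rewrite ?normr0 // coord_le_norm.
Qed.

Lemma hybridS v (i : 'I_n) : hybrid v i.+1 = hybrid v i + v 0 i *: ee i.
Proof.
apply/rowP => j; rewrite !mxE eqxx/= ltnS leq_eqVlt -val_eqE/=.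
have [ji|ji] := eqVneq (j : nat) i.
  by rewrite /= ji ltnn add0r mulr1; congr (v 0 _); exact: val_inj.
by rewrite mulr0 addr0.
Qed.

Lemma hybrid_telescope (F : V -> R) v :
  F v - F 0 = \sum_(i < n) (F (hybrid v i.+1) - F (hybrid v i)).
Proof.
have -> : \sum_(i < n) (F (hybrid v i.+1) - F (hybrid v i)) = F (hybrid v n) - F (hybrid v 0).
  rewrite -(big_mkord xpredT (fun i => F (hybrid v i.+1) - F (hybrid v i))).
  by rewrite telescope_sumr.
have -> : hybrid v n = v by apply/rowP => j; rewrite mxE ltn_ord.
by have -> : hybrid v 0 = 0 by apply/rowP => j; rewrite !mxE.
Qed.

Lemma differentiable_null f x :
  (forall e, 0 < e -> exists2 r, 0 < r & forall v, `|v| < r -> `|f (x + v) - f x| <= e * `|v|) ->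
  differentiable f x.
Proof.
move=> H; pose df : {linear V -> R} := \0.
have c0 : continuous df by move=> z; exact: cst_continuous.
have small (e : R) : 0 < e -> \forall v \near (0 : V), `|f (v + x) - (f x + 0)| <= e * `|v|.
  move=> e0; have [r r0 Hr] := H e e0.
  apply: (near_normP _ _).2; exists r => // v; rewrite sub0r normrN => vr.
  by rewrite (addrC v x) addr0; exact: Hr.
have E : 'd f x = df :> (V -> R).
  by apply: diff_unique => //; apply/eqaddoP => e e0; exact: small.
by apply/diff_locallyP; rewrite E; split => //; apply/eqaddoP => e e0; exact: small.
Qed.

(** Subtracting the candidate differential [L] reduces the claim to a null derivative. The increment
    is then split along the coordinate staircase [hybrid], and the mean value theorem turns each
    piece into a value of [g i] minus [g i x]. *)
Lemma partials_differentiable f (g : 'I_n -> V -> R) x r : 0 < r ->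
  (forall y i, `|x - y| < r -> dird f y (ee i) (g i y)) ->
  (forall i e, 0 < e -> exists2 r, 0 < r & forall y, `|x - y| < r -> `|g i x - g i y| < e) ->
  differentiable f x.
Proof.
move=> r0 Hd Hg.
pose L (y : V) := \sum_i g i x * y 0 i.
have dL : differentiable L x.
  rewrite (_ : L = \sum_i (fun y : V => g i x * y 0 i)); last first.
    by apply/funext => y; rewrite fct_sumE.
  apply: differentiable_sum => i; apply: differentiableZ; exact: differentiable_coord.
suff : differentiable (fun y => f y - L y) x.
  move=> d; have := differentiableD d dL.
  by rewrite (_ : (fun y => f y - L y) + L = f)//; apply/funext => y; exact: (subrK (L y) (f y)).
apply: differentiable_null => e e0.
pose k : R := e / n.+1%:R; have k0 : 0 < k by rewrite divr_gt0.
have [q q0 Hq] : exists2 q, 0 < q & forall i y, `|x - y| < q -> `|g i x - g i y| < k.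
  have /boolp.choice[q Hq] : forall i, exists q : R, 0 < q /\ forall y, `|x - y| < q -> `|g i x - g i y| < k.
    by move=> i; have [q ? ?] := Hg i k k0; exists q.
  exists (\big[Num.min/1]_i q i); first by apply: lt_bigmin => // i _; case: (Hq i).
  move=> i y xy; have [_ H] := Hq i; apply: H; apply: (lt_le_trans xy).
  exact: bigmin_le_cond.
exists (Num.min r q) => [|v]; first by rewrite lt_min r0.
rewrite lt_min => /andP[vr vq].
have -> : f (x + v) - L (x + v) - (f x - L x) = \sum_(i < n)
   (f (x + hybrid v i.+1) - f (x + hybrid v i) - g i x * v 0 i).
  rewrite sumrB -(hybrid_telescope (fun z => f (x + z))) addr0.
  have -> : L (x + v) = L x + \sum_(i < n) g i x * v 0 i.
    by rewrite /L -big_split/=; apply: eq_bigr => i _; rewrite mxE mulrDr.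
  ring.
apply: (le_trans (ler_norm_sum _ _ _)).
apply: (@le_trans _ _ (\sum_(i < n) k * `|v|)); last first.
  rewrite sumr_const card_ord -mulr_natl mulrA ler_wpM2r// /k mulrCA ler_piMr ?(ltW e0)//.
  by rewrite ler_pdivrMr// mul1r ler_nat.
apply: ler_sum => i _; rewrite hybridS addrA.
set y := x + hybrid v i; set a := v 0 i.
have av : `|a| <= `|v| by exact: coord_le_norm.
have near s : `|s| <= `|a| -> `|x - (y + s *: ee i)| <= `|v|.
  move=> sa; rewrite /y opprD opprD addrA addrA subrr sub0r -opprD normrN.
  by apply: hybrid_norm => //; exact: le_trans sa av.
have [a0|a0] := eqVneq a 0.
  by rewrite a0 scale0r addr0 subrr mulr0 subrr normr0 mulr_ge0// ltW.
have D s : `|s| <= `|a| -> dird (fun s : R => f (y + s *: ee i)) s 1 (g i (y + s *: ee i)).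
  by move=> sa; apply: dird_slice; apply: Hd; exact: le_lt_trans (near s sa) vr.
have [c ca ->] : exists2 c, `|c| <= `|a| & f (y + a *: ee i) - f y = g i (y + c *: ee i) * a.
  have [ap|an] := ltP 0 a.
    have [|c /andP[c0 ca] E] := @MVT_seg R (fun s => f (y + s *: ee i)) (fun s => g i (y + s *: ee i)) _ _ ap.
      by move=> s /andP[s0 sa]; apply: D; rewrite !ger0_norm// ltW.
    exists c; first by rewrite !gtr0_norm// ltW.
    by move: E; rewrite scale0r addr0 subr0.
  have an' : a < 0 by rewrite lt_neqAle a0.
  have [|c /andP[ac c0] E] := @MVT_seg R (fun s => f (y + s *: ee i)) (fun s => g i (y + s *: ee i)) _ _ an'.
    by move=> s /andP[sa s0]; apply: D; rewrite (ler0_norm s0) ltr0_norm// lerN2.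
  exists c; first by rewrite !ltr0_norm// lerN2 ltW.
  by move: E; rewrite scale0r addr0 sub0r => E; rewrite -opprB E mulrN opprK.
rewrite -mulrBl normrM; apply: ler_pM => //.
by rewrite distrC ltW//; apply: Hq; exact: le_lt_trans (near c ca) vq.
Qed.

End PartialsDifferentiable.

Section UltraLimits.
Context {R : realType} {I : Type}.
Implicit Types (F : set_system I) (a : I -> R).

(** The one consequence of the ultrafilter property that is used. It makes the samples at all points
    and times, and those of all difference quotients, converge together, so that no diagonal
    subsequence has to be extracted. *)
Definition bounded_cvg F := forall a, (exists M : R, \forall i \near F, `|a i| <= M) ->
  cvg (a @ F).

Lemma ultra_bounded_cvg F : UltraFilter F -> bounded_cvg F.
Proof.
move=> FU a [M HM].
have PF : ProperFilter F by exact: ultra_proper.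
have := @segment_compact R (- M) M.
rewrite compact_ultra => /(_ (a @ F)).
have UF : UltraFilter (a @ F).
  have PaF : ProperFilter (a @ F) by exact: fmap_proper_filter.
  split=> // G GP aG; apply/seteqP; split=> A; last exact: aG.
  move=> GA; have [|] := in_ultra_setVsetC (a @^-1` A) FU => //.
  rewrite preimage_setC => /aG GnA.
  have G0 : G set0 by rewrite -(setICr A); exact: filterI.
  by exfalso; exact: (@filter_not_empty _ G GP G0).
have FM : (a @ F) `[- M, M]%classic.
  by apply: filterS HM => i /=; rewrite in_itv/= -ler_norml.
move=> /(_ UF FM)[l [_ Fl]].
by apply/cvg_ex; exists l.
Qed.

End UltraLimits.


Section LatticePaths.
Context {R : realType} {n : nat}.
Local Notation V := 'rV[R]_n.
Local Notation Z := 'rV[int]_n.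
Local Notation ee i := (delta_mx 0 i : V).
Local Notation ez i := (delta_mx 0 i : Z).
Implicit Types (x : V) (z : Z).

Lemma nat_taylor (f : nat -> R) d B m : (forall j, (j < m)%N -> `|f j.+1 - f j - d| <= B) ->
  `|f m - f 0%N - m%:R * d| <= m%:R * B.
Proof.
elim: m => [_|m IH H]; first by rewrite subrr !mul0r subrr normr0.
rewrite (_ : _ - _ = (f m.+1 - f m - d) + (f m - f 0%N - m%:R * d)); last first.
  by rewrite -natr1; ring.
rewrite (le_trans (ler_normD _ _))// -natr1 mulrDl mul1r addrC lerD ?H//.
by apply: IH => j jm; apply: H; exact: ltnW.
Qed.

Lemma pt_step (h : R) z i (j : nat) : pt h (z + ez i *+ j) = pt h z + (h * j%:R) *: ee i.
Proof.
rewrite ptD; congr (_ + _); apply/rowP => k; rewrite !mxE mulmxnE !mxE.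
by case: (_ && _); rewrite rmorphMn/= ?mulr1z ?mulr0z ?mul0rn ?mulr0// mulr1.
Qed.

Lemma pt_coord_le (h : R) z z' i : 0 <= h ->
  h * `|(z' 0 i - z 0 i)%:~R| <= `|pt h z' - pt h z|.
Proof.
move=> h0; have := coord_le_norm (pt h z' - pt h z) i.
by rewrite !mxE -mulrBr normrM (ger0_norm h0) rmorphB.
Qed.

(** Balls of the sup norm are boxes, so a lattice segment in a coordinate direction stays inside
    once its ends do. *)
Lemma near_path (h : R) x rho z i (j m : nat) : 0 < h -> (j <= m)%N ->
  `|pt h z - x| < rho -> `|pt h (z + ez i *+ m) - x| < rho ->
  `|pt h (z + ez i *+ j) - x| < rho.
Proof.
move=> h0 jm H1 H2; have rho0 : 0 < rho by exact: le_lt_trans H1.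
apply: norm_lt_coord => // k.
have L1 := le_lt_trans (coord_le_norm _ k) H1; have L2 := le_lt_trans (coord_le_norm _ k) H2.
move: L1 L2; rewrite !pt_step !mxE eqxx/=; set a := h * _.
case: (k == i); rewrite ?mulr0 ?addr0// !mulr1 !ltr_norml => /andP[a1 a2] /andP[b1 b2].
have hj : 0 <= h * j%:R by rewrite mulr_ge0// ltW.
have hm : h * j%:R <= h * m%:R by rewrite ler_pM2l// ler_nat.
by apply/andP; split; lra.
Qed.

Definition lhybrid z z' (m : nat) : Z := \row_j (if (j < m)%N then z' 0 j else z 0 j).

Lemma lhybrid0 z z' : lhybrid z z' 0 = z.
Proof. by apply/rowP => j; rewrite mxE. Qed.

Lemma lhybridn z z' : lhybrid z z' n = z'.
Proof. by apply/rowP => j; rewrite mxE ltn_ord. Qed.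

Lemma lhybridS z z' (i : 'I_n) k : z' 0 i - z 0 i = k%:Z ->
  lhybrid z z' i.+1 = lhybrid z z' i + ez i *+ k.
Proof.
move=> E; apply/rowP => j; rewrite !mxE mulmxnE !mxE eqxx/=.
have [->|ji] := eqVneq j i.
  by rewrite ltnn ltnSn (_ : true%:R *+ k = k%:Z) ?natz// -E addrC subrK.
by rewrite mul0rn addr0 ltnS [(j <= i)%N]leq_eqVlt val_eqE (negPf ji).
Qed.

Lemma lhybridSN z z' (i : 'I_n) k : z 0 i - z' 0 i = k%:Z ->
  lhybrid z z' i = lhybrid z z' i.+1 + ez i *+ k.
Proof.
move=> E; apply/rowP => j; rewrite !mxE mulmxnE !mxE eqxx/=.
have [->|ji] := eqVneq j i.
  by rewrite ltnn ltnSn (_ : true%:R *+ k = k%:Z) ?natz// -E addrC subrK.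
by rewrite mul0rn addr0 ltnS [(j <= i)%N]leq_eqVlt val_eqE (negPf ji).
Qed.

Lemma lhybrid_near (h : R) x rho z z' m : 0 < rho ->
  `|pt h z - x| < rho -> `|pt h z' - x| < rho -> `|pt h (lhybrid z z' m) - x| < rho.
Proof.
move=> r0 H1 H2; apply: norm_lt_coord => // k; rewrite !mxE.
have := le_lt_trans (coord_le_norm _ k) H1; have := le_lt_trans (coord_le_norm _ k) H2.
by rewrite !mxE; case: ifP.
Qed.

(** The staircase from [z] to [z'] changes one coordinate at a time and stays in the box; its [n]
    legs account for the factor [n]. *)
Lemma lattice_lipschitz (W : Z -> R) (h : R) x rho C : 0 < h ->
  (forall z i, `|pt h z - x| < rho -> `|W (z + ez i) - W z| <= C * h) ->
  forall z z', `|pt h z - x| < rho -> `|pt h z' - x| < rho ->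
    `|W z' - W z| <= n%:R * C * `|pt h z' - pt h z|.
Proof.
move=> h0 HW z z' Hz Hz'; have rho0 : 0 < rho by exact: le_lt_trans Hz.
have line y i (k : nat) : `|pt h y - x| < rho -> `|pt h (y + ez i *+ k) - x| < rho ->
    `|W (y + ez i *+ k) - W y| <= C * (h * k%:R).
  move=> H1 H2.
  have := @nat_taylor (fun j => W (y + ez i *+ j)) 0 (C * h) k.
  rewrite mulr0 subr0 mulr0n addr0 => H; apply: (le_trans (H _)).
    move=> j jk; rewrite subr0 mulrSr addrA; apply: HW.
    by apply: near_path H2 => //; exact: ltnW.
  by rewrite le_eqVlt; apply/orP; left; apply/eqP; ring.
have -> : W z' - W z = \sum_(i < n) (W (lhybrid z z' i.+1) - W (lhybrid z z' i)).
  rewrite -(big_mkord xpredT (fun i => W (lhybrid z z' i.+1) - W (lhybrid z z' i))).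
  by rewrite telescope_sumr// lhybridn lhybrid0.
apply: (le_trans (ler_norm_sum _ _ _)).
rewrite (_ : n%:R * C * _ = \sum_(i < n) C * `|pt h z' - pt h z|); last first.
  by rewrite sumr_const card_ord -[RHS]mulr_natl mulrA.
apply: ler_sum => i _.
have C0 : 0 <= C.
  by have := le_trans (normr_ge0 _) (HW z i Hz); rewrite pmulr_lge0.
have Hi m := lhybrid_near m rho0 Hz Hz'.
have [p|p] : (exists k : nat, z' 0 i - z 0 i = k%:Z) \/ exists k : nat, z 0 i - z' 0 i = k%:Z.
  by case: (z' 0 i - z 0 i) (opprB (z' 0 i) (z 0 i)) => k E; [left; exists k|right; exists k.+1; rewrite -E NegzE opprK].
  have [k E] := p.
  have := line (lhybrid z z' i) i k (Hi _); rewrite -lhybridS// => /(_ (Hi _)) H.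
  apply: (le_trans H); rewrite ler_wpM2l//.
  have := pt_coord_le z z' i (ltW h0); rewrite E.
  by rewrite [k%:Z%:~R]/(k%:R) normr_nat.
have [k E] := p.
have := line (lhybrid z z' i.+1) i k (Hi _); rewrite -lhybridSN// => /(_ (Hi _)) H.
rewrite distrC; apply: (le_trans H); rewrite ler_wpM2l//.
have := pt_coord_le z' z i (ltW h0); rewrite E distrC.
by rewrite [k%:Z%:~R]/(k%:R) normr_nat distrC.
Qed.

End LatticePaths.

(** * Compactness and derivatives of limits of lattice heat flows *)

Section Caloric.
Context {R : realType} {n : nat} {I : Type} (F : set_system I) {PF : ProperFilter F}.
Variable h : I -> R.
Local Notation V := 'rV[R]_n.
Local Notation Z := 'rV[int]_n.
Local Notation ee i := (delta_mx 0 i : V).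
Local Notation ez i := (delta_mx 0 i : Z).
Hypothesis hn : (0 < n)%N.
Hypothesis hpos : forall k, 0 < h k.
Hypothesis hlim : forall e, 0 < e -> \forall k \near F, h k < e.
Hypothesis bF : bounded_cvg (R := R) F.
Implicit Types (w : I -> nat -> Z -> R) (x : V) (t : R).

Let n0 : 0 < n%:R :> R. Proof. by rewrite ltr0n. Qed.

(** By [lavgE] one step adds [h^2 / (4 n)] times the discrete Laplacian, so this is the time step
    for which the recursion approximates [u_t = Delta u]. *)
Definition tau a : R := h a ^+ 2 / (4 * n%:R).
Definition tm a (k : nat) : R := k%:R * tau a.

Lemma tau_gt0 a : 0 < tau a.
Proof. by rewrite divr_gt0 ?exprn_gt0 ?mulr_gt0. Qed.

Lemma tau_le a : h a <= 1 -> tau a <= h a.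
Proof.
move=> h1; have hp := hpos a; rewrite /tau ler_pdivrMr ?mulr_gt0// expr2 ler_pM2l//.
have : 1 <= n%:R :> R by rewrite ler1n.
lra.
Qed.

Definition cal_on w a t0 x0 (rho M : R) := forall k z, `|tm a k - t0| < rho ->
  `|pt (h a) z - x0| < rho -> `|w a k z| <= M /\ w a k.+1 z = lavg (w a k) z.

(** The radius and the bound do not depend on the mesh; all smoothness of the limit is derived from
    this one local hypothesis. *)
Definition caloric w t0 x0 := exists rho M, 0 < rho /\
  \forall a \near F, cal_on w a t0 x0 rho M.

Definition ldiff i w : I -> nat -> Z -> R := fun a k z => (w a k (z + ez i) - w a k z) / h a.

Lemma cal_onW w a t0 x0 rho M rho' M' : rho' <= rho -> M <= M' ->
  cal_on w a t0 x0 rho M -> cal_on w a t0 x0 rho' M'.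
Proof.
move=> rr MM H k z Hk Hz.
have [H1 H2] := H k z (lt_le_trans Hk rr) (lt_le_trans Hz rr).
by split=> //; exact: le_trans H1 MM.
Qed.

Lemma tmB a k k' : tm a k - tm a k' = (k%:R - k'%:R) * tau a.
Proof. by rewrite /tm mulrBl. Qed.

(** The engine of the smoothness proof: the interior gradient bound makes difference quotients
    bounded on a smaller cylinder, and they obey the same recursion, so the statement can be
    iterated. *)
Lemma caloric_ldiff i w t0 x0 : 0 < t0 -> caloric w t0 x0 -> caloric (ldiff i w) t0 x0.
Proof.
move=> t00 [rho [M0 [rho0 H]]].
pose r1 : R := Num.min rho t0 / 2; pose M : R := `|M0|.
have r10 : 0 < r1 by rewrite divr_gt0// lt_min rho0.
have r1rho : 2 * r1 <= rho by rewrite /r1 mulrC divfK// ge_min lexx.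
have r1t : 2 * r1 <= t0 by rewrite /r1 mulrC divfK// ge_min lexx orbT.
have M00 : 0 <= M by exact: normr_ge0.
have M0M : M0 <= M by exact: ler_norm.
clearbody r1 M.
pose C := 2 * M * n%:R * (64 / r1 ^+ 2 + 2 / (n%:R * r1)) * (r1 / 4).
exists (r1 / 2), C; split; first by rewrite divr_gt0.
have e1 : 0 < Num.min 1 (r1 / 24) by rewrite lt_min ltr01 divr_gt0.
apply: filterS2 H (hlim e1) => a Ha; rewrite lt_min => /andP[h1 h24] k z Hk Hz.
have hp := hpos a; have tp := tau_gt0 a; have th := tau_le (ltW h1).
have near_z i' : `|pt (h a) (z + ez i') - x0| < rho.
  rewrite ptD pt_ez addrAC (le_lt_trans (ler_normD _ _))//.
  have := norm_scale_delta i' (h a); rewrite (gtr0_norm hp); lra.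
have tk : `|tm a k - t0| < rho by lra.
have zk : `|pt (h a) z - x0| < rho by lra.
split; last first.
  rewrite /ldiff (Ha k z tk zk).2 (Ha k _ tk (near_z i)).2.
  rewrite mulrC -[X in _ = X](_ : (h a)^-1 * (lavg (fun y => w a k (y + ez i)) z - lavg (w a k) z) = _).
    by rewrite lavg_translate.
  by rewrite -lavgB -lavgZ; congr lavg; apply/funext => y; rewrite mulrC.
have r10' := ltW r10; have tp' := ltW tp; have hp' := ltW hp.
have q0 : 0 <= r1 / (2 * tau a) by rewrite divr_ge0 ?mulr_ge0.
(* The number of steps to go back: the window [N%:R * tau a] lies between [r1 / 4] and [r1 / 2],
   long enough for the gradient bound and short enough to stay near [t0]. *)
pose N := Num.truncn (r1 / (2 * tau a)).
have /andP[N1 N2] : N%:R <= r1 / (2 * tau a) < N.+1%:R := truncn_itv q0.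
clearbody N.
have t2 : 0 < 2 * tau a by exact: mulr_gt0.
have NtE : N%:R * (2 * tau a) = 2 * (N%:R * tau a) by ring.
have Nt1 : N%:R * tau a <= r1 / 2.
  have : N%:R * (2 * tau a) <= r1 by rewrite -(ler_pdivlMr _ _ t2).
  by rewrite NtE mulrC ler_pdivlMr.
have Nt2 : r1 / 4 <= N%:R * tau a.
  have : r1 < (N%:R + 1) * (2 * tau a) by rewrite -(ltr_pdivrMr _ _ t2) natr1.
  rewrite mulrDl NtE mul1r.
  by move: (N%:R * tau a) => q; lra.
have N0 : (0 < N)%N.
  rewrite lt0n; apply/eqP => E; move: Nt2; rewrite E mul0r; lra.
have Nk : (N <= k)%N.
  rewrite -(ler_nat R) -(ler_pM2r tp); move: Hk; rewrite ltr_norml /tm => /andP[]; lra.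
(* A radius of [r1 / 8] in lattice units. The [2 r + 3] of the gradient bound then amounts to
   [r1 / 4 + 3 h], still inside the cylinder. *)
have rr0 : 0 < r1 / (8 * h a) by apply: divr_gt0 => //; exact: mulr_gt0.
have tj j : (j <= N)%N -> `|tm a (k - N + j) - t0| < rho.
  move=> jN; have E : tm a (k - N + j) = tm a k - (N%:R - j%:R) * tau a.
    by rewrite /tm natrD natrB//; ring.
  have : 0 <= (N%:R - j%:R) * tau a by rewrite mulr_ge0 ?(ltW tp)// subr_ge0 ler_nat.
  have : (N%:R - j%:R) * tau a <= N%:R * tau a by rewrite ler_pM2r// gerBl.
  rewrite E; move: Hk; rewrite !ltr_norml; clear -Nt1 r1rho r10 hn hpos hlim bF n0 PF.
  by move=> /andP[]; move=> *; apply/andP; split; lra.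
have zz z' : lnear z z' (2 * (r1 / (8 * h a)) + 3) -> `|pt (h a) z' - x0| < rho.
  move=> Hn; have -> : pt (h a) z' - x0 = (pt (h a) z' - pt (h a) z) + (pt (h a) z - x0).
    by rewrite addrA subrK.
  apply: (le_lt_trans (ler_normD _ _)).
  have : `|pt (h a) z' - pt (h a) z| <= r1 / 4 + 3 * h a.
    apply: norm_le_coord => [|j]; first by rewrite addr_ge0 ?divr_ge0 ?mulr_ge0.
    rewrite !mxE -mulrBr -rmorphB normrM (gtr0_norm hp).
    have := Hn j; rewrite -(ler_pM2l hp) => /le_trans; apply.
    by rewrite le_eqVlt; apply/orP; left; apply/eqP; field; rewrite gt_eqF.
  lra.
have := @lattice_gradient R n hn i (fun j y => w a (k - N + j)%N y) z M (r1 / (8 * h a)) N rr0 N0 M00.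
rewrite subnK// => HL.
rewrite /ldiff normrM normfV (gtr0_norm hp) ler_pdivrMr//.
apply: (le_trans (HL _ _)).
- move=> j y jN yn; have [Hb _] := Ha _ _ (tj j jN) (zz y yn).
  exact: le_trans Hb M0M.
- move=> j y jN yn; rewrite addnS.
  by have [_ ->] := Ha _ _ (tj j (ltnW jN)) (zz y yn).
have X1 : (r1 / (8 * h a)) ^- 2 = 64 / r1 ^+ 2 * h a ^+ 2.
  by field; rewrite !gt_eqF.
have N0r : 0 < N%:R :> R by rewrite ltr0n.
have X2 : 2 / N%:R <= 2 / (n%:R * r1) * h a ^+ 2.
  rewrite ler_pdivrMr// [leRHS](_ : _ = 8 / r1 * (N%:R * tau a)); last first.
    by rewrite /tau; field; rewrite !gt_eqF.
  have : 8 / r1 * (r1 / 4) <= 8 / r1 * (N%:R * tau a) by rewrite ler_pM2l// divr_gt0.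
  rewrite (_ : 8 / r1 * (r1 / 4) = 2)//; by field; rewrite gt_eqF.
have X3 : r1 / (8 * h a) + 1 <= r1 / 4 / h a.
  rewrite -(ler_pM2r hp) [leLHS](_ : _ = r1 / 8 + h a); last by field; rewrite gt_eqF.
  rewrite divfK ?gt_eqF//; clear -h24 r10 hn hpos hlim bF n0 PF; lra.
apply: (@le_trans _ _ (2 * M * n%:R * ((64 / r1 ^+ 2 + 2 / (n%:R * r1)) * h a ^+ 2) * (r1 / 4 / h a))).
  apply: ler_pM => //.
  - rewrite mulr_ge0 ?mulr_ge0 ?(ltW n0)//; apply: addr_ge0; last by rewrite divr_ge0 ?ler0n.
    by rewrite invr_ge0 sqr_ge0.
  - by rewrite addr_ge0// ltW.
  - rewrite ler_wpM2l ?mulr_ge0 ?(ltW n0)// X1 [leRHS]mulrDl.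
    by rewrite lerD2l.
by rewrite /C le_eqVlt; apply/orP; left; apply/eqP; field; rewrite !gt_eqF.
Qed.

Lemma caloric_all (ws : 'I_n -> I -> nat -> Z -> R) t0 x0 :
  (forall i, caloric (ws i) t0 x0) -> exists rho M, [/\ 0 < rho, 0 <= M &
    \forall a \near F, forall i, cal_on (ws i) a t0 x0 rho M].
Proof.
move=> H.
have /boolp.choice[p Hp] : forall i, exists p : R * R, 0 < p.1 /\
    \forall a \near F, cal_on (ws i) a t0 x0 p.1 p.2.
  by move=> i; have [rho [M [r0 HH]]] := H i; exists (rho, M).
exists (\big[Num.min/1]_i (p i).1), (\big[Num.max/0]_i (p i).2); split.
- by apply: lt_bigmin => // i _; case: (Hp i).
- by apply: bigmax_ge_id.
apply: filter_forall => i; have [_ Hi] := Hp i; apply: filterS Hi => a.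
by apply: cal_onW; [exact: bigmin_le_cond|exact: le_bigmax_cond].
Qed.

(** Two forward differences taken at [z - ez i] make the centred second difference at [z]. *)
Lemma caloric_step w a k z : w a k.+1 z = lavg (w a k) z ->
  w a k.+1 z - w a k z = tau a * \sum_i ldiff i (ldiff i w) a k (z - ez i).
Proof.
move=> ->; rewrite lavgE// addrAC subrr add0r /tau mulr_sumr mulr_sumr.
apply: eq_bigr => i _; rewrite /ldiff subrK.
by have hp := hpos a; field; rewrite !gt_eqF.
Qed.

(** Bounded first differences give the Lipschitz bound in space. In time, the recursion turns
    bounded second differences into a bound of order [tau] per step. *)
Lemma caloric_local w t0 x0 : 0 < t0 -> caloric w t0 x0 ->
  exists rho C, [/\ 0 < rho, 0 <= C & \forall a \near F, forall k k' z z',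
    `|tm a k - t0| < rho -> `|tm a k' - t0| < rho ->
    `|pt (h a) z - x0| < rho -> `|pt (h a) z' - x0| < rho ->
    `|w a k z| <= C /\
    `|w a k' z' - w a k z| <= C * (`|pt (h a) z' - pt (h a) z| + `|tm a k' - tm a k|)].
Proof.
move=> t00 cw.
have [r1 [M1 [r10 M10 H1]]] := caloric_all (fun i => caloric_ldiff i t00 cw).
have [r2 [M2 [r20 M20 H2]]] := caloric_all (fun i => caloric_ldiff i t00 (caloric_ldiff i t00 cw)).
have [r3 [M3 [r30 H3]]] := cw.
pose rho := Num.min r1 (Num.min (r2 / 2) r3).
have rho0 : 0 < rho by rewrite !lt_min r10 divr_gt0.
pose C := `|M3| + n%:R * M1 + n%:R * M2.
have C1 : 0 <= n%:R * M1 by rewrite mulr_ge0.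
have C2 : 0 <= n%:R * M2 by rewrite mulr_ge0.
have C3 := normr_ge0 M3.
exists rho, C; split; [by []|by rewrite !addr_ge0|].
have r22 : 0 < r2 / 2 by rewrite divr_gt0.
have X1 : rho <= r1 by rewrite ge_min lexx.
have X2 : rho <= r2 / 2 by rewrite !ge_min lexx !orbT.
have X3 : rho <= r3 by rewrite !ge_min lexx !orbT.
near=> a.
have hp := hpos a; have tp := tau_gt0 a.
have ha : h a < r2 / 2 by near: a; exact: hlim.
have K1 : forall i, cal_on (ldiff i w) a t0 x0 r1 M1 by near: a.
have K2 : forall i, cal_on (ldiff i (ldiff i w)) a t0 x0 r2 M2 by near: a.
have K3 : cal_on w a t0 x0 r3 M3 by near: a.
have space k z z' : `|tm a k - t0| < rho -> `|pt (h a) z - x0| < rho -> `|pt (h a) z' - x0| < rho ->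
    `|w a k z' - w a k z| <= C * `|pt (h a) z' - pt (h a) z|.
  move=> Hk Hz Hz'; apply: (@le_trans _ _ (n%:R * M1 * `|pt (h a) z' - pt (h a) z|)).
    apply: (@lattice_lipschitz R n (w a k) (h a) x0 rho M1 hp) => // y i Hy.
    have [+ _] := K1 i k y (lt_le_trans Hk X1) (lt_le_trans Hy X1).
    by rewrite /ldiff normrM normfV (gtr0_norm hp) ler_pdivrMr.
  by rewrite ler_wpM2r// /C; lra.
have time k (m : nat) z : `|tm a k - t0| < rho -> `|tm a (k + m) - t0| < rho ->
    `|pt (h a) z - x0| < rho -> `|w a (k + m)%N z - w a k z| <= C * (m%:R * tau a).
  move=> Hk Hm Hz.
  have := @nat_taylor R (fun j => w a (k + j)%N z) 0 (tau a * (n%:R * M2)) m.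
  rewrite mulr0 subr0 addn0 => H; apply: (le_trans (H _)).
    move=> j jm; rewrite subr0 addnS.
    have tj : `|tm a (k + j) - t0| < rho.
      move: Hk Hm; rewrite /tm !natrD !mulrDl !ltr_norml => /andP[] u1 u2 /andP[] u3 u4.
      have : j%:R * tau a <= m%:R * tau a by rewrite ler_pM2r// ler_nat ltnW.
      have : 0 <= j%:R * tau a by rewrite mulr_ge0// ltW.
      clear -u1 u2 u3 u4 hn hpos hlim bF n0 PF.
      by move=> *; apply/andP; split; lra.
    rewrite caloric_step; last by case: (K3 _ _ (lt_le_trans tj X3) (lt_le_trans Hz X3)).
    rewrite normrM (gtr0_norm tp) ler_pM2l// (le_trans (ler_norm_sum _ _ _))//.
    rewrite (_ : n%:R * M2 = \sum_(i < n) M2); last by rewrite sumr_const card_ord -[RHS]mulr_natl.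
    apply: ler_sum => i _.
    have [] // := K2 i (k + j)%N (z - ez i); first lra.
    rewrite ptD ptN pt_ez addrAC (le_lt_trans (ler_normB _ _))//.
    by have := norm_scale_delta i (h a); rewrite (gtr0_norm hp); lra.
  have : 0 <= (C - n%:R * M2) * (m%:R * tau a).
    apply: mulr_ge0; first by rewrite /C addrK addr_ge0.
    by apply: mulr_ge0 => //; exact: ltW.
  clear -hn hpos hlim bF n0 PF; lra.
move=> k k' z z' Hk Hk' Hz Hz'; split.
  have [+ _] := K3 k z (lt_le_trans Hk X3) (lt_le_trans Hz X3).
  by move=> /le_trans; apply; rewrite /C; have := ler_norm M3; lra.
rewrite (_ : _ - _ = (w a k' z' - w a k' z) + (w a k' z - w a k z)); last by ring.
rewrite (le_trans (ler_normD _ _))// mulrDr lerD ?space//.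
have [kk|kk] := leqP k k'.
  have := time k (k' - k)%N z Hk; rewrite subnKC// => /(_ Hk' Hz) /le_trans; apply.
  by rewrite tmB natrB// normrM (gtr0_norm tp) ger0_norm// subr_ge0 ler_nat.
have kk' := ltnW kk.
have := time k' (k - k')%N z Hk'; rewrite subnKC// => /(_ Hk Hz).
rewrite distrC => /le_trans; apply.
by rewrite distrC tmB natrB// normrM (gtr0_norm tp) ger0_norm// subr_ge0 ler_nat.
Unshelve. all: by end_near.
Qed.

Definition rnd (d : R) x : Z := \row_i Num.floor (x 0 i / d).
Definition stepno a t : nat := Num.truncn (t / tau a).
Definition sample w a t x : R := w a (stepno a t) (rnd (h a) x).
Definition limfun w t x : R := lim ((fun a => sample w a t x) @ F).

Lemma rnd_near d x : 0 < d -> `|pt d (rnd d x) - x| <= d.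
Proof.
move=> d0; apply: norm_le_coord => [|i]; first exact: ltW.
rewrite !mxE; have /andP[f1 f2] := floor_itv (x 0 i / d).
rewrite rmorphD/= in f2; move: f1 f2; set fl := (Num.floor _)%:~R.
rewrite ler_pdivlMr// ltr_pdivrMr// mulrDl => f1 f2.
by rewrite ler_norml; apply/andP; split; lra.
Qed.

Lemma stepno_near a t : 0 <= t -> `|tm a (stepno a t) - t| <= tau a.
Proof.
move=> t0; have tp := tau_gt0 a.
have q0 : 0 <= t / tau a by rewrite divr_ge0// ltW.
have /andP[N1 N2] := truncn_itv q0; rewrite -/(stepno a t) in N1 N2.
move: N1 N2; rewrite ler_pdivlMr// ltr_pdivrMr// -natr1 mulrDl mul1r /tm => N1 N2.
by rewrite ler_norml; apply/andP; split; lra.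
Qed.

Lemma lim_norm_le (f : I -> R) c : cvg (f @ F) ->
  (forall e, 0 < e -> \forall a \near F, `|f a| <= c + e) -> `|lim (f @ F)| <= c.
Proof.
move=> cf H; apply/ler_addgt0Pr => e e0.
rewrite ler_norml; apply/andP; split.
  by apply: limr_ge => //; apply: filterS (H e e0) => a; rewrite ler_norml => /andP[].
by apply: limr_le => //; apply: filterS (H e e0) => a; rewrite ler_norml => /andP[].
Qed.

Lemma lim_small (c e : R) : 0 < e -> \forall a \near F, c * h a <= e.
Proof.
move=> e0; have k0 : 0 < e / (`|c| + 1) by rewrite divr_gt0// ltr_wpDl.
apply: filterS (hlim k0) => a; rewrite ltr_pdivlMr ?ltr_wpDl// mulrC => H.
have := ler_norm c; have := hpos a => h0 cn.
apply: le_trans (ltW H); rewrite ler_pM2r//; lra.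
Qed.

(** Rounding to the mesh costs [O(h)], which disappears in the limit. *)
Lemma limfun_local w t0 x0 : 0 < t0 -> caloric w t0 x0 ->
  exists rho C, [/\ 0 < rho, 0 <= C & forall t x, `|t - t0| < rho -> `|x - x0| < rho ->
    cvg ((fun a => sample w a t x) @ F) /\
    forall t' x', `|t' - t0| < rho -> `|x' - x0| < rho ->
      `|limfun w t' x' - limfun w t x| <= C * (`|x' - x| + `|t' - t|)].
Proof.
move=> t00 cw; have [r [C [r0 C0 H]]] := caloric_local t00 cw.
pose rho := Num.min (r / 2) t0.
have rho0 : 0 < rho by rewrite lt_min divr_gt0.
have rr : rho <= r / 2 by rewrite ge_min lexx.
have rt : rho <= t0 by rewrite ge_min lexx orbT.
have r2 : 0 < Num.min 1 (r / 2) by rewrite lt_min ltr01 divr_gt0.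
have tge t : `|t - t0| < rho -> 0 <= t by rewrite ltr_norml => /andP[]; lra.
have nearp : \forall a \near F, forall t x, `|t - t0| < rho -> `|x - x0| < rho ->
    `|tm a (stepno a t) - t0| < r /\ `|pt (h a) (rnd (h a) x) - x0| < r.
  apply: filterS (hlim r2) => a; rewrite lt_min => /andP[h1 h2] t x Ht Hx.
  have T := stepno_near a (tge _ Ht); have X := rnd_near x (hpos a).
  have th := tau_le (ltW h1).
  split.
    rewrite (_ : _ - t0 = (tm a (stepno a t) - t) + (t - t0)); last by ring.
    by rewrite (le_lt_trans (ler_normD _ _))//; lra.
  have -> : pt (h a) (rnd (h a) x) - x0 = (pt (h a) (rnd (h a) x) - x) + (x - x0) by rewrite addrA subrK.
  by rewrite (le_lt_trans (ler_normD _ _))//; lra.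
have cv t x : `|t - t0| < rho -> `|x - x0| < rho -> cvg ((fun a => sample w a t x) @ F).
  move=> Ht Hx; apply: bF; exists C; apply: filterS2 nearp H => a Hn Ha.
  have [A1 A2] := Hn t x Ht Hx.
  by have [] := Ha _ _ _ _ A1 A1 A2 A2.
exists rho, C; split=> // t x Ht Hx; split; first exact: cv.
move=> t' x' Ht' Hx'.
rewrite /limfun -limB; [|exact: cv|exact: cv].
apply: lim_norm_le; first by apply: is_cvgB; exact: cv.
move=> e e0; have e1 : 0 < Num.min 1 (1 : R) by rewrite lt_min ltr01.
apply: filterS3 (filterI nearp H) (lim_small (4 * C) e0) (hlim ltr01) => a [Hn Ha] hs h1.
have [A1 A2] := Hn t x Ht Hx; have [B1 B2] := Hn t' x' Ht' Hx'.
have [_ HH] := Ha _ _ _ _ A1 B1 A2 B2; apply: (le_trans HH).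
have th := tau_le (ltW h1).
have X1 := rnd_near x (hpos a); have X2 := rnd_near x' (hpos a).
have T1 := stepno_near a (tge _ Ht); have T2 := stepno_near a (tge _ Ht').
apply: (@le_trans _ _ (C * (`|x' - x| + `|t' - t| + 4 * h a))); last first.
  by rewrite mulrDr lerD2l mulrA [C * 4]mulrC.
rewrite ler_wpM2l// (_ : _ + 4 * _ = (`|x' - x| + 2 * h a) + (`|t' - t| + 2 * h a)); last by ring.
apply: lerD.
  have -> : pt (h a) (rnd (h a) x') - pt (h a) (rnd (h a) x) =
      (pt (h a) (rnd (h a) x') - x') - (pt (h a) (rnd (h a) x) - x) + (x' - x).
    by apply/rowP => j; rewrite !mxE; ring.
  apply: (le_trans (ler_normD _ _)); rewrite addrC lerD2l; apply: (le_trans (ler_normB _ _)).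
  by apply: (le_trans (lerD X2 X1)); rewrite mulrDl mul1r.
rewrite (_ : tm _ _ - tm _ _ = (tm a (stepno a t') - t') - (tm a (stepno a t) - t) + (t' - t)); last by ring.
apply: (le_trans (ler_normD _ _)); rewrite addrC lerD2l; apply: (le_trans (ler_normB _ _)).
by apply: (le_trans (lerD (le_trans T2 th) (le_trans T1 th))); rewrite mulrDl mul1r.
Qed.

Lemma taylor_line (W : Z -> R) (d0 d B : R) i (k : nat) z : 0 < d0 ->
  (forall j, (j < k)%N -> `|(W (z + ez i *+ j + ez i) - W (z + ez i *+ j)) / d0 - d| <= B) ->
  `|W (z + ez i *+ k) - W z - d0 * k%:R * d| <= d0 * k%:R * B.
Proof.
move=> d00 H.
have := @nat_taylor R (fun j => W (z + ez i *+ j)) (d0 * d) (d0 * B) k.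
rewrite mulr0n addr0 => HH.
rewrite [d0 * _]mulrC -!mulrA; apply: HH => j jk; rewrite mulrSr addrA.
have := H j jk; rewrite -(ler_pM2l d00) -{1}(gtr0_norm d00) -normrM; congr (`|_| <= _).
by field; rewrite gt_eqF.
Qed.

(** The floors of the other coordinates are unaffected, so the two lattice points differ by a
    multiple of [ez i]. The two cases are the signs of that multiple. *)
Lemma rnd_step (d s : R) x i : 0 < d ->
  (exists2 k : nat, rnd d (x + s *: ee i) = rnd d x + ez i *+ k & `|d * k%:R - s| <= d) \/
  (exists2 k : nat, rnd d x = rnd d (x + s *: ee i) + ez i *+ k & `|d * k%:R + s| <= d).
Proof.
move=> d0; pose f1 := Num.floor (x 0 i / d); pose f2 := Num.floor ((x 0 i + s) / d).
have E0 j : j != i -> rnd d (x + s *: ee i) 0 j = rnd d x 0 j.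
  by move=> ji; rewrite !mxE (negPf ji) andbF mulr0 addr0.
have E1 : rnd d (x + s *: ee i) 0 i = f2 by rewrite !mxE !eqxx mulr1.
have E2 : rnd d x 0 i = f1 by rewrite mxE.
have /andP[a1 a2] := floor_itv (x 0 i / d); rewrite -/f1 in a1 a2.
have /andP[b1 b2] := floor_itv ((x 0 i + s) / d); rewrite -/f2 in b1 b2.
rewrite rmorphD/= in a2; rewrite rmorphD/= in b2.
rewrite ler_pdivlMr// in a1; rewrite ltr_pdivrMr// in a2.
rewrite ler_pdivlMr// in b1; rewrite ltr_pdivrMr// in b2.
have key : `|d * (f2%:~R - f1%:~R) - s| <= d.
  by rewrite ler_norml; apply/andP; split; lra.
have shift (z z' : Z) (k : nat) : (forall j, j != i -> z' 0 j = z 0 j) ->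
    z' 0 i - z 0 i = k%:Z -> z' = z + ez i *+ k.
  move=> H1 H2; apply/rowP => j; rewrite !mxE mulmxnE !mxE eqxx/=.
  have [->|ji] := eqVneq j i; last by rewrite mul0rn addr0 H1.
  by rewrite (_ : true%:R *+ k = k%:Z) ?natz// -H2 addrC subrK.
have [[k Ek]|[k Ek]] : (exists k : nat, f2 - f1 = k%:Z) \/ exists k : nat, f1 - f2 = k%:Z.
  by case: (f2 - f1) (opprB f2 f1) => k E; [left; exists k|right; exists k.+1; rewrite -E NegzE opprK].
- left; exists k; first by apply: shift => //; rewrite E1 E2.
  by rewrite (_ : k%:R = f2%:~R - f1%:~R)// -rmorphB/= Ek.
- right; exists k; first by apply: shift; [move=> j ji; rewrite E0|rewrite E1 E2].
  have -> : k%:R = f1%:~R - f2%:~R :> R by rewrite -rmorphB/= Ek.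
  by rewrite (_ : _ + s = - (d * (f2%:~R - f1%:~R) - s)) ?normrN//; ring.
Qed.

Lemma near_sample t0 x0 r : 0 < t0 -> 0 < r -> \forall a \near F, forall t x,
  0 <= t -> `|t - t0| < r / 2 -> `|x - x0| < r / 2 ->
  `|tm a (stepno a t) - t0| < r /\ `|pt (h a) (rnd (h a) x) - x0| < r.
Proof.
move=> t00 r0; have r2 : 0 < Num.min 1 (r / 2) by rewrite lt_min ltr01 divr_gt0.
apply: filterS (hlim r2) => a; rewrite lt_min => /andP[h1 h2] t x tge Ht Hx.
have T := stepno_near a tge; have X := rnd_near x (hpos a).
have th := tau_le (ltW h1).
split.
  rewrite (_ : _ - t0 = (tm a (stepno a t) - t) + (t - t0)); last by ring.
  by rewrite (le_lt_trans (ler_normD _ _))//; lra.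
have -> : pt (h a) (rnd (h a) x) - x0 = (pt (h a) (rnd (h a) x) - x) + (x - x0) by rewrite addrA subrK.
by rewrite (le_lt_trans (ler_normD _ _))//; lra.
Qed.

(** On the lattice, summing unit steps whose quotients are uniformly Lipschitz gives a Taylor error
    of [C s^2] up to [O(h)]. This inequality, rather than a derivative, is passed to the limit. *)
Lemma limfun_dird i w t x : 0 < t -> caloric w t x ->
  dird (limfun w t) x (ee i) (limfun (ldiff i w) t x).
Proof.
move=> t0 cw; have cD := caloric_ldiff i t0 cw.
have [r [C [r0 C0 H]]] := caloric_local t0 cD.
have [q1 [C1 [q10 C10 HW]]] := limfun_local t0 cw.
have [q2 [C2 [q20 C20 HD]]] := limfun_local t0 cD.
have tt : `|t - t| = 0 by rewrite subrr normr0.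
have xx : `|x - x| = 0 by rewrite subrr normr0.
have t1 : `|t - t| < q1 by rewrite tt.
have t2 : `|t - t| < q2 by rewrite tt.
have x1 : `|x - x| < q1 by rewrite xx.
have x2 : `|x - x| < q2 by rewrite xx.
move=> e e0; pose del := Num.min (Num.min (r / 2) q1) (e / (C + 1)).
have Cp : 0 < C + 1 by rewrite ltr_wpDl.
exists del => [|s]; first by rewrite !lt_min divr_gt0// q10 divr_gt0.
rewrite !lt_min => /andP[/andP[sr sq] se].
have xs0 : x + s *: ee i - x = s *: ee i by rewrite addrAC subrr add0r.
have xs : `|x + s *: ee i - x| < q1 by rewrite xs0; exact: le_lt_trans (norm_scale_delta i s) sq.
have [cv1 _] := HW t _ t1 xs.
have [cv0 _] := HW t x t1 x1.
have [cvD _] := HD t x t2 x2.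
pose S a := sample w a t (x + s *: ee i) - sample w a t x - s * sample (ldiff i w) a t x.
have cS : S @ F --> limfun w t (x + s *: ee i) - limfun w t x - s * limfun (ldiff i w) t x.
  apply: cvgB; first by apply: cvgB; [exact: cv1|exact: cv0].
  by apply: cvgM; [exact: cvg_cst|exact: cvD].
rewrite -(cvg_lim _ cS)//.
apply: (@le_trans _ _ (C * s ^+ 2)); last first.
  rewrite -[s ^+ 2]real_normK ?num_real// expr2 mulrA ler_wpM2r//.
  move: se; rewrite ltr_pdivlMr// => se; have := normr_ge0 s.
  clear -se hn hpos hlim bF n0 PF; lra.
apply: lim_norm_le; first by apply/cvg_ex; eexists; exact: cS.
move=> e' e'0.
(* [(|s| + h)^2 = s^2 + (2 |s| + h) h], plus [h] from rounding [s]; both with [h <= 1]. *)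
apply: filterS3 (filterI H (near_sample x t0 r0)) (lim_small (C * (2 * `|s| + 2)) e'0) (hlim ltr01).
move=> a [Ha Hn] hs h1; have hp := hpos a; have hp' := ltW hp.
have [|||T X] := Hn t x; rewrite ?tt ?xx ?divr_gt0//; first exact: ltW.
have [||_ X'] := Hn t (x + s *: ee i) (ltW t0); rewrite ?tt ?divr_gt0//.
  by rewrite xs0; exact: le_lt_trans (norm_scale_delta i s) sr.
rewrite /S /sample; set k := stepno a t in T *.
set z := rnd (h a) x in X *; set z' := rnd (h a) (x + s *: ee i) in X' *.
have [DC _] := Ha k k z z T T X X.
have LD y : `|pt (h a) y - x| < r ->
    `|ldiff i w a k y - ldiff i w a k z| <= C * `|pt (h a) y - pt (h a) z|.
  by move=> Hy; have [_] := Ha k k z y T T X Hy; rewrite subrr normr0 addr0.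
have fin (m B : R) : `|m - s| <= h a -> `|m| <= `|s| + h a ->
    `|w a k z' - w a k z - m * ldiff i w a k z| <= `|m| * (C * `|m|) ->
    `|w a k z' - w a k z - s * ldiff i w a k z| <= C * s ^+ 2 + e'.
  move=> m1 m2 m3.
  rewrite (_ : _ - _ - _ = (w a k z' - w a k z - m * ldiff i w a k z) + (m - s) * ldiff i w a k z); last by ring.
  apply: (le_trans (ler_normD _ _)).
  have : `|(m - s) * ldiff i w a k z| <= h a * C by rewrite normrM; apply: ler_pM.
  have : `|m| * (C * `|m|) <= C * (`|s| + h a) ^+ 2.
    rewrite mulrCA -expr2 ler_wpM2l// ler_pXn2r ?nnegrE// addr_ge0//.
  have -> : C * (`|s| + h a) ^+ 2 = C * s ^+ 2 + C * (2 * `|s| + h a) * h a.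
    by rewrite -[s ^+ 2]real_normK ?num_real//; ring.
  have : C * h a * h a <= C * h a by rewrite ler_piMr ?mulr_ge0// ltW.
  clear -m3 hs hn hpos hlim bF n0 PF; lra.
have [[m Em ms]|[m Em ms]] := rnd_step s x i hp.
- apply: (@fin (h a * m%:R) 0) => //.
    by rewrite -lerBlDl; apply: le_trans ms; exact: lerB_dist.
  have hm0 : 0 <= h a * m%:R by rewrite mulr_ge0.
  rewrite -/z -/z' in Em; rewrite (ger0_norm hm0) Em; apply: taylor_line => // j jm.
  have Xj : `|pt (h a) (z + ez i *+ j) - x| < r.
    by apply: (near_path hp (ltnW jm) X); rewrite -Em.
  apply: (le_trans (LD _ Xj)); rewrite ler_wpM2l// pt_step addrAC subrr add0r.
  rewrite (le_trans (norm_scale_delta _ _))// ger0_norm ?mulr_ge0// ler_pM2l// ler_nat.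
  exact: ltnW.
- apply: (@fin (- (h a * m%:R)) 0) => //.
  + by rewrite -normrN opprD !opprK.
  + rewrite -[X in `|X|](subrK s) (le_trans (ler_normD _ _))// addrC lerD2l.
    by rewrite -normrN opprD !opprK.
  have hm0 : 0 <= h a * m%:R by rewrite mulr_ge0.
  rewrite -/z -/z' in Em; rewrite normrN (ger0_norm hm0) mulNr opprK -normrN.
  rewrite [X in `|X|](_ : _ = w a k z - w a k z' - h a * m%:R * ldiff i w a k z); last by ring.
  rewrite [X in w a k X - _]Em; apply: taylor_line => // j jm.
  have Xj : `|pt (h a) (z' + ez i *+ j) - x| < r.
    by apply: (near_path hp (ltnW jm) X'); rewrite -Em.
  apply: (le_trans (LD _ Xj)); rewrite ler_wpM2l// Em !pt_step opprD addrACA subrr add0r -scalerBl.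
  rewrite (le_trans (norm_scale_delta _ _))// -mulrBr normrM (gtr0_norm hp) ler_pM2l//.
  rewrite distrC ger0_norm ?subr_ge0 ?ler_nat 1?ltnW// gerBl//.
Qed.

Lemma cvg_ord_sum (f : 'I_n -> I -> R) (l : 'I_n -> R) : (forall i, f i @ F --> l i) ->
  (fun a => \sum_i f i a) @ F --> \sum_i l i.
Proof.
move=> H; elim: (index_enum _) => [|i s IH].
  by under eq_fun do rewrite big_nil; rewrite big_nil; exact: cvg_cst.
by under eq_fun do rewrite big_cons; rewrite big_cons; apply: cvgD.
Qed.

(** The same argument in time: by [caloric_step] the increment per step is [tau] times a sum of
    second differences, which converge to the pure second partials. *)
Lemma limfun_dird_time w t x : 0 < t -> caloric w t x ->
  dird (fun t => limfun w t x) t 1 (\sum_i limfun (ldiff i (ldiff i w)) t x).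
Proof.
move=> t0 cw; have cD i := caloric_ldiff i t0 (caloric_ldiff i t0 cw).
have /boolp.choice[p Hp] : forall i, exists p : R * R, [/\ 0 < p.1, 0 <= p.2 &
   \forall a \near F, forall k k' z z',
    `|tm a k - t| < p.1 -> `|tm a k' - t| < p.1 ->
    `|pt (h a) z - x| < p.1 -> `|pt (h a) z' - x| < p.1 ->
    `|ldiff i (ldiff i w) a k z| <= p.2 /\
    `|ldiff i (ldiff i w) a k' z' - ldiff i (ldiff i w) a k z| <=
       p.2 * (`|pt (h a) z' - pt (h a) z| + `|tm a k' - tm a k|)].
  by move=> i; have [r [C [r0 C0 H]]] := caloric_local t0 (cD i); exists (r, C).
have [r3 [M3 [r30 H3]]] := cw.
pose r := Num.min r3 (\big[Num.min/1]_i (p i).1); pose C := \big[Num.max/0]_i (p i).2.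
have r0 : 0 < r by rewrite lt_min r30; apply: lt_bigmin => // i _; case: (Hp i).
have C0 : 0 <= C by exact: bigmax_ge_id.
have rr3 : r <= r3 by rewrite ge_min lexx.
have rp i : r <= (p i).1 by rewrite ge_min; apply/orP; right; exact: bigmin_le_cond.
have pC i : (p i).2 <= C by exact: le_bigmax_cond.
have H : \forall a \near F, forall i, forall k k' z z',
    `|tm a k - t| < r -> `|tm a k' - t| < r ->
    `|pt (h a) z - x| < r -> `|pt (h a) z' - x| < r ->
    `|ldiff i (ldiff i w) a k z| <= C /\
    `|ldiff i (ldiff i w) a k' z' - ldiff i (ldiff i w) a k z| <=
       C * (`|pt (h a) z' - pt (h a) z| + `|tm a k' - tm a k|).
  apply: filter_forall => i; have [_ _ Hi] := Hp i; apply: filterS Hi => a Hi k k' z z' h1 h2 h3 h4.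
  have [] := Hi k k' z z' (lt_le_trans h1 (rp i)) (lt_le_trans h2 (rp i))
     (lt_le_trans h3 (rp i)) (lt_le_trans h4 (rp i)) => K1 K2.
  split; first exact: le_trans K1 (pC i).
  by apply: (le_trans K2); rewrite ler_wpM2r ?addr_ge0.
have [q1 [C1 [q10 C10 HW]]] := limfun_local t0 cw.
have tt : `|t - t| = 0 by rewrite subrr normr0.
have xx : `|x - x| = 0 by rewrite subrr normr0.
move=> e e0; pose K := n%:R * C; have K0 : 0 <= K by rewrite mulr_ge0// ltW.
pose del := Num.min (Num.min (r / 2 / 2) (Num.min q1 t)) (e / (K + 1)).
have Kp : 0 < K + 1 by rewrite ltr_wpDl.
have r22 : 0 < r / 2 by rewrite divr_gt0.
exists del => [|s]; first by rewrite !lt_min !divr_gt0// q10 t0.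
rewrite !lt_min => /andP[/andP[sr /andP[sq st]] se].
rewrite [s *: 1]mulr1.
have ts0 : t + s - t = s by ring.
have ts1 : `|t + s - t| < q1 by rewrite ts0.
have ts2 : 0 <= t + s.
  by move: st; rewrite ltr_norml => /andP[st _]; clear -st hn hpos hlim bF n0 PF; lra.
have t1 : `|t - t| < q1 by rewrite tt.
have x1 : `|x - x| < q1 by rewrite xx.
have [cv1 _] := HW _ x ts1 x1.
have [cv0 _] := HW t x t1 x1.
pose S a := sample w a (t + s) x - sample w a t x - s * \sum_i sample (ldiff i (ldiff i w)) a t x.
have cS : S @ F --> limfun w (t + s) x - limfun w t x - s * \sum_i limfun (ldiff i (ldiff i w)) t x.
  apply: cvgB; first by apply: cvgB; [exact: cv1|exact: cv0].
  apply: cvgM; first exact: cvg_cst.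
  apply: cvg_ord_sum => i.
  have [q2 [C2 [q20 C20 HD]]] := limfun_local t0 (cD i).
  have tq2 : `|t - t| < q2 by rewrite tt.
  have xq2 : `|x - x| < q2 by rewrite xx.
  by have [] := HD t x tq2 xq2.
rewrite -(cvg_lim _ cS)//.
apply: (@le_trans _ _ (K * s ^+ 2)); last first.
  rewrite -[s ^+ 2]real_normK ?num_real// expr2 mulrA ler_wpM2r//.
  move: se; rewrite ltr_pdivlMr// => se; have := normr_ge0 s.
  clear -se hn hpos hlim bF n0 PF; lra.
apply: lim_norm_le; first by apply/cvg_ex; eexists; exact: cS.
move=> e' e'0.
have r2 : 0 < Num.min 1 (r / 2) by rewrite lt_min ltr01.
(* Rounding the time costs [2 h] and the shift to [z - ez i] another [h]: [(|s| + 2 h) (|s| + 3 h) =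
   s^2 + (5 |s| + 6 h) h], plus [2 h] from replacing the lattice time by [s]. *)
apply: filterS3 (filterI (filterI H H3) (near_sample x t0 r22))
   (lim_small (K * (5 * `|s| + 8)) e'0) (hlim r2).
move=> a [[Ha Hw] Hn] hs; rewrite lt_min => /andP[h1 h2].
have hp := hpos a; have hp' := ltW hp.
have tp := tau_gt0 a; have tp' := ltW tp; have th := tau_le (ltW h1).
have [|||T X] := Hn t x; rewrite ?tt ?xx ?divr_gt0//; first exact: ltW.
have [|||T' _] := Hn (t + s) x; rewrite ?ts0 ?xx ?divr_gt0//.
have N1 := stepno_near a (ltW t0); have N2 := stepno_near a ts2.
rewrite /S /sample; set k := stepno a t in T N1 *; set k' := stepno a (t + s) in T' N2 *.
set z := rnd (h a) x in X *; pose DD j y i := ldiff i (ldiff i w) a j y.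
have zi i : `|pt (h a) (z - ez i) - x| < r.
  rewrite ptD ptN pt_ez addrAC (le_lt_trans (ler_normB _ _))//.
  have Y := norm_scale_delta i (h a); rewrite (gtr0_norm hp) in Y.
  by clear -X Y h2 hn hpos hlim bF n0 PF; lra.
have rr : r / 2 < r by rewrite ltr_pdivrMr// ltr_pMr// ltr1n.
have Xr := lt_trans X rr.
have DC i : `|DD k z i| <= C.
  by have [] := Ha i k k z z (lt_trans T rr) (lt_trans T rr) Xr Xr.
have sumC (f : 'I_n -> R) (B : R) : (forall i, `|f i| <= B) -> `|\sum_i f i| <= n%:R * B.
  move=> Hf; rewrite (le_trans (ler_norm_sum _ _ _))// (_ : n%:R * B = \sum_(i < n) B).
    by apply: ler_sum => i _; exact: Hf.
  by rewrite sumr_const card_ord -[RHS]mulr_natl.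
have run k0 (m : nat) : `|tm a k0 - t| < r / 2 -> `|tm a (k0 + m) - t| < r / 2 ->
    k = k0 \/ k = (k0 + m)%N ->
    `|w a (k0 + m)%N z - w a k0 z - m%:R * (tau a * \sum_i DD k z i)| <=
      m%:R * (tau a * (K * (h a + m%:R * tau a))).
  move=> P1 P2 Hk; have := @nat_taylor R (fun j => w a (k0 + j)%N z) (tau a * \sum_i DD k z i)
    (tau a * (K * (h a + m%:R * tau a))) m; rewrite addn0; apply=> j jm; rewrite addnS.
  have j0 : 0 <= j%:R * tau a by rewrite mulr_ge0.
  have jm' : j%:R * tau a <= m%:R * tau a by rewrite ler_pM2r// ler_nat ltnW.
  have E1 : tm a (k0 + j) = tm a k0 + j%:R * tau a by rewrite /tm natrD mulrDl.
  have E2 : tm a (k0 + m) = tm a k0 + m%:R * tau a by rewrite /tm natrD mulrDl.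
  have tj : `|tm a (k0 + j) - t| < r / 2.
    move: P1 P2; rewrite E1 E2 !ltr_norml => /andP[u1 u2] /andP[u3 u4].
    by clear -j0 jm' u1 u2 u3 u4 hn hpos hlim bF n0 PF; apply/andP; split; lra.
  have tjr := lt_trans tj rr.
  rewrite caloric_step; last by case: (Hw _ _ (lt_le_trans tjr rr3) (lt_le_trans Xr rr3)).
  rewrite -mulrBr normrM (gtr0_norm tp) ler_pM2l// -sumrB /K -mulrA; apply: sumC => i.
  have [_ HH] := Ha i k _ z _ (lt_trans T rr) tjr Xr (zi i).
  apply: (le_trans HH); rewrite ler_wpM2l//; apply: lerD.
    rewrite ptD ptN pt_ez addrAC subrr add0r normrN (le_trans (norm_scale_delta _ _))//.
    by rewrite gtr0_norm.
  case: Hk => ->; first by rewrite E1 addrAC subrr add0r ger0_norm.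
  rewrite E1 E2 opprD addrACA subrr add0r ler_norml.
  by clear -j0 jm' hn hpos hlim bF n0 PF; apply/andP; split; lra.
have SC := sumC _ _ DC; rewrite -/K in SC.
have fin (m : R) : `|m - s| <= 2 * h a ->
    `|w a k' z - w a k z - m * \sum_i DD k z i| <= `|m| * (K * (h a + `|m|)) ->
    `|w a k' z - w a k z - s * \sum_i DD k z i| <= K * s ^+ 2 + e'.
  move=> m1 m3; have s0 := normr_ge0 s; have m0 := normr_ge0 m.
  have m2 : `|m| <= `|s| + 2 * h a.
    by rewrite -{1}(subrK s m) (le_trans (ler_normD _ _))// addrC lerD2l.
  rewrite (_ : _ - _ - _ = (w a k' z - w a k z - m * \sum_i DD k z i) + (m - s) * \sum_i DD k z i); last by ring.
  apply: (le_trans (ler_normD _ _)).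
  have X1 : `|(m - s) * \sum_i DD k z i| <= 2 * h a * K by rewrite normrM; apply: ler_pM.
  have X2 : `|m| * (K * (h a + `|m|)) <= (`|s| + 2 * h a) * (K * (`|s| + 3 * h a)).
    apply: ler_pM => //; first by rewrite mulr_ge0// addr_ge0.
    by rewrite ler_wpM2l//; clear -m2 hn hpos hlim bF n0 PF; lra.
  have X3 : (`|s| + 2 * h a) * (K * (`|s| + 3 * h a)) = K * s ^+ 2 + K * (5 * `|s| + 6 * h a) * h a.
    by rewrite -[s ^+ 2]real_normK ?num_real//; ring.
  have X4 : K * h a * h a <= K * h a by rewrite ler_piMr ?mulr_ge0// ltW.
  clear -X1 X2 X3 X4 m3 hs hn hpos hlim bF n0 PF; lra.
have kk : tm a k' - tm a k = (tm a k' - (t + s)) - (tm a k - t) + s by ring.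
have [le|lt] := leqP k k'.
  have := run k (k' - k)%N T; rewrite subnKC// => /(_ T' (or_introl erefl)) HR.
  apply: (fin ((k' - k)%N%:R * tau a)).
    rewrite natrB// -tmB kk addrK (le_trans (ler_normB _ _))//; clear -N1 N2 th hn hpos hlim bF n0 PF; lra.
  rewrite !(mulrA _ (tau a)) in HR.
  by rewrite [`|_%:R * tau a|]ger0_norm// mulr_ge0.
have le' := ltnW lt.
have := run k' (k - k')%N T'; rewrite subnKC// => /(_ T (or_intror erefl)) HR.
apply: (fin (- ((k - k')%N%:R * tau a))).
  rewrite natrB// -tmB opprB kk addrK (le_trans (ler_normB _ _))//; clear -N1 N2 th hn hpos hlim bF n0 PF; lra.
rewrite !(mulrA _ (tau a)) in HR.
rewrite normrN [`|_%:R * tau a|]ger0_norm; last by rewrite mulr_ge0.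
rewrite mulNr opprK -[X in X <= _]normrN.
rewrite [X in `|X|](_ : _ = w a k z - w a k' z - (k - k')%N%:R * tau a * \sum_i DD k z i); last by ring.
exact: HR.
Qed.

End Caloric.

Section CaloricSmooth.
Context {R : realType} {n : nat} {I : Type} (F : set_system I) {PF : ProperFilter F}.
Variable h : I -> R.
Local Notation V := 'rV[R]_n.
Local Notation Z := 'rV[int]_n.
Local Notation ee i := (delta_mx 0 i : V).
Hypothesis hn : (0 < n)%N.
Hypothesis hpos : forall k, 0 < h k.
Hypothesis hlim : forall e, 0 < e -> \forall k \near F, h k < e.
Hypothesis bF : bounded_cvg (R := R) F.
Implicit Types (w : I -> nat -> Z -> R) (x : V) (t : R) (Omega : set V).

Definition caloric_in Omega w := forall t x, 0 < t -> Omega x -> caloric F h w t x.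

Lemma caloric_in_ldiff Omega i w : caloric_in Omega w -> caloric_in Omega (ldiff h i w).
Proof. by move=> H t x t0 Ox; apply: caloric_ldiff => //; exact: H. Qed.

Lemma limfun_within Omega w (v : R -> V -> R) : caloric_in Omega w ->
  (forall t x, 0 < t -> Omega x -> v t x = limfun F h w t x) ->
  {within cylinder Omega, continuous (fun z : R * V => v z.1 z.2)}.
Proof.
move=> H E; apply/within_contP => -[t x] [/= t0 Ox] e e0.
have [rho [C [rho0 C0 HL]]] := limfun_local hn hpos hlim bF t0 (H t x t0 Ox).
have tt : `|t - t| < rho by rewrite subrr normr0.
have xx : `|x - x| < rho by rewrite subrr normr0.
have [_ {}HL] := HL t x tt xx.
have Cp : 0 < 2 * C + 1 by rewrite ltr_wpDl// mulr_ge0.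
exists (Num.min rho (e / (2 * C + 1))) => [|[t' x'] [/= t'0 Ox']].
  by rewrite lt_min rho0 divr_gt0.
rewrite [`|_|]prod_normE/= lt_min !gt_max => /andP[/andP[H1 H2] /andP[H3 H4]].
have d1 : `|t' - t| < rho by rewrite distrC.
have d2 : `|x' - x| < rho by rewrite distrC.
rewrite !E// distrC; apply: (le_lt_trans (HL t' x' d1 d2)).
rewrite [`|x' - x|]distrC [`|t' - t|]distrC.
rewrite ltr_pdivlMr// in H3; rewrite ltr_pdivlMr// in H4.
have := normr_ge0 (x - x'); have := normr_ge0 (t - t'); lra.
Qed.

Lemma limfun_partial Omega i w (v : V -> R) t x : open Omega -> caloric_in Omega w -> 0 < t ->
  Omega x -> (forall y, Omega y -> v y = limfun F h w t y) ->
  dird v x (ee i) (limfun F h (ldiff h i w) t x).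
Proof.
move=> oO H t0 Ox E; have [r r0 Hr] := open_normP oO Ox.
apply: (dird_eq _ (limfun_dird hn hpos hlim bF i t0 (H t x t0 Ox))).
exists r => // s sr; rewrite E//; apply: Hr.
by rewrite opprD addrA subrr sub0r normrN; exact: le_lt_trans (norm_scale_delta i s) sr.
Qed.

Lemma limfun_differentiable Omega w (v : V -> R) t x : open Omega -> caloric_in Omega w -> 0 < t ->
  Omega x -> (forall y, Omega y -> v y = limfun F h w t y) -> differentiable v x.
Proof.
move=> oO H t0 Ox E; have [r r0 Hr] := open_normP oO Ox.
apply: (@partials_differentiable R n v (fun i => limfun F h (ldiff h i w) t) x r r0).
  by move=> y i xy; apply: (limfun_partial i oO H t0) => //; exact: Hr.
move=> i e e0; have cD := caloric_in_ldiff i H.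
have cont := limfun_within cD (fun t x _ _ => erefl).
have [q q0 Hq] := (within_contP _ _).1 cont (t, x) (conj t0 Ox) e e0.
exists (Num.min r q) => [|y]; first by rewrite lt_min r0.
rewrite lt_min => /andP[yr yq]; apply: (Hq (t, y)); first by split=> //=; exact: Hr.
by rewrite [`|_|]prod_normE/= subrr normr0 gt_max q0.
Qed.

Lemma partial_limfun Omega i w (v : V -> R) t x : open Omega -> caloric_in Omega w -> 0 < t ->
  Omega x -> (forall y, Omega y -> v y = limfun F h w t y) ->
  partial i v x = limfun F h (ldiff h i w) t x.
Proof. by move=> oO H t0 Ox E; have [_ <-] := dird_is (limfun_partial i oO H t0 Ox E). Qed.

Lemma derive1_limfun Omega w t x : caloric_in Omega w -> 0 < t -> Omega x ->
  derivable (fun t => limfun F h w t x) t 1 /\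
  derive1 (fun t => limfun F h w t x) t = \sum_i limfun F h (ldiff h i (ldiff h i w)) t x.
Proof.
move=> H t0 Ox.
have [d E] := dird_is (limfun_dird_time hn hpos hlim bF t0 (H t x t0 Ox)).
by split=> //; rewrite derive1E.
Qed.

Lemma limfun_Ck2 Omega w t : open Omega -> caloric_in Omega w -> 0 < t ->
  Ck 2 Omega (limfun F h w t).
Proof.
move=> oO H t0; have HD i := caloric_in_ldiff i H.
split=> [x Ox|i]; first exact: (limfun_differentiable oO H t0).
have pE y : Omega y -> partial i (limfun F h w t) y = limfun F h (ldiff h i w) t y.
  by move=> Oy; exact: (partial_limfun i oO H t0).
split=> [x Ox|j x Ox]; first exact: (limfun_differentiable oO (HD i) t0 Ox pE).
apply/contP => e e0; have [r r0 Hr] := open_normP oO Ox.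
have cont := limfun_within (caloric_in_ldiff j (HD i)) (fun t x _ _ => erefl).
have [q q0 Hq] := (within_contP _ _).1 cont (t, x) (conj t0 Ox) e e0.
exists (Num.min r q) => [|y]; first by rewrite lt_min r0.
rewrite lt_min => /andP[yr yq]; have Oy := Hr y yr.
rewrite (partial_limfun j oO (HD i) t0 Ox pE) (partial_limfun j oO (HD i) t0 Oy pE).
apply: (Hq (t, y)) => //.
by rewrite [`|_|]prod_normE/= subrr normr0 gt_max q0.
Qed.

(** Derivatives of the limit are limits of difference quotients, which are caloric again and hence
    have continuous limits. The heat equation holds because [u_t] and the Laplacian are the same sum
    of such limits. *)
Lemma limfun_C12 Omega w : open Omega -> caloric_in Omega w ->
  C12 Omega (limfun F h w) /\
  forall t x, 0 < t -> Omega x ->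
    derive1 ((limfun F h w)^~ x) t - laplacian (limfun F h w t) x = 0.
Proof.
move=> oO H; have HD i := caloric_in_ldiff i H; have HDD i j := caloric_in_ldiff j (HD i).
have pE i t y : 0 < t -> Omega y -> partial i (limfun F h w t) y = limfun F h (ldiff h i w) t y.
  by move=> t0 Oy; exact: (partial_limfun i oO H t0).
have ppE i j t y : 0 < t -> Omega y ->
    partial j (partial i (limfun F h w t)) y = limfun F h (ldiff h j (ldiff h i w)) t y.
  by move=> t0 Oy; apply: (partial_limfun j oO (HD i) t0 Oy) => z Oz; exact: pE.
split; last first.
  move=> t x t0 Ox; have [_ ->] := derive1_limfun H t0 Ox.
  by rewrite /laplacian -sumrB big1// => i _; rewrite ppE// subrr.
split.
- move=> t x [/= t0 Ox]; split.
  + by have [] := derive1_limfun H t0 Ox.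
  + exact: (limfun_differentiable oO H t0).
  + by move=> i; apply: (limfun_differentiable oO (HD i) t0) => // y Oy; exact: pE.
- exact: limfun_within H _.
- apply/within_contP => -[t x] [/= t0 Ox] e e0.
  have nr : 0 < n%:R :> R by rewrite ltr0n.
  have e1 : 0 < e / n.+1%:R by rewrite divr_gt0.
  have /boolp.choice[q Hq] : forall i, exists q, 0 < q /\ forall z, cylinder Omega z ->
     `|(t, x) - z| < q -> `|limfun F h (ldiff h i (ldiff h i w)) t x - limfun F h (ldiff h i (ldiff h i w)) z.1 z.2| < e / n.+1%:R.
    move=> i; have cont := limfun_within (HDD i i) (fun t x _ _ => erefl).
    by have [q q0 Hq] := (within_contP _ _).1 cont (t, x) (conj t0 Ox) _ e1; exists q.
  exists (\big[Num.min/1]_i q i); first by apply: lt_bigmin => // i _; case: (Hq i).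
  move=> [t' x'] [/= t'0 Ox'] near.
  have [_ ->] := derive1_limfun H t0 Ox; have [_ ->] := derive1_limfun H t'0 Ox'.
  rewrite -sumrB (le_lt_trans (ler_norm_sum _ _ _))//.
  apply: (@le_lt_trans _ _ (\sum_(i < n) e / n.+1%:R)); last first.
    by rewrite sumr_const card_ord -[_ *+ n]mulr_natl mulrA ltr_pdivrMr// mulrC ltr_pM2l// ltr_nat.
  apply: ler_sum => i _; apply: ltW; have [_ Hi] := Hq i; apply: (Hi (t', x')) => //.
  by apply: (lt_le_trans near); exact: bigmin_le_cond.
- by move=> i; apply: (limfun_within (v := fun t => partial i (limfun F h w t)) (HD i)) => t x t0 Ox; exact: pE.
- by move=> i j; apply: (limfun_within (v := fun t => partial j (partial i (limfun F h w t))) (HDD i j))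
    => t x t0 Ox; exact: ppE.
Qed.

End CaloricSmooth.

(** * The heat semigroup as a limit of killed random walks *)

Section HeatLimit.
Context {R : realType} {n : nat}.
Local Notation V := 'rV[R]_n.
Local Notation Z := 'rV[int]_n.
Local Notation ee i := (delta_mx 0 i : V).
Hypothesis hn : (0 < n)%N.
Variables (Omega : set V) (r L : R) (f : V -> R).
Hypotheses (oO : open Omega) (bO : bounded_set Omega) (r0 : 0 < r).
Hypothesis ext : exterior_ball Omega r.
Hypotheses (f0 : forall x, 0 <= f x) (fO : forall x, ~ Omega x -> f x = 0).
Hypotheses (L0 : 0 <= L) (fL : forall x y, `|f x - f y| <= L * `|x - y|).
Variable F : set_system nat.
Context {PF : ProperFilter F}.
Hypothesis bF : bounded_cvg (R := R) F.
Hypothesis Foo : \oo `<=` F.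

(** Reciprocals of integers, so that one unit of time is exactly [4 n (i + 1)^2] steps. *)
Definition mesh (i : nat) : R := i.+1%:R^-1.
Definition walk i k : Z -> R := kwalk Omega (mesh i) (fun z => f (pt (mesh i) z)) k.
Definition heat_lim := limfun F mesh walk.

Lemma mesh_gt0 i : 0 < mesh i.
Proof. by rewrite invr_gt0. Qed.

Lemma mesh_lim e : 0 < e -> \forall i \near F, mesh i < e.
Proof.
move=> e0; apply: Foo; near=> i.
rewrite /mesh invf_plt ?posrE//; near: i.
exists (Num.bound e^-1) => // m /= hm.
have ei : 0 <= e^-1 by rewrite invr_ge0 ltW.
by apply: (lt_le_trans (archi_boundP ei)); rewrite ler_nat (leq_trans hm).
Unshelve. all: by end_near. Qed.

Lemma f_bounded : exists2 M : R, 0 < M & forall x, f x <= M.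
Proof.
have [D [Dr HD]] := bO; pose D1 := `|D| + 1.
have HD1 x : Omega x -> `|x| <= D1.
  by move=> Ox; apply: (HD D1) => //; rewrite (le_lt_trans (ler_norm D))// ltrDl.
have D10 : 0 < D1 by rewrite ltr_wpDl.
pose x0 : V := const_mx (2 * D1).
have nx0 : ~ Omega x0.
  move=> /HD1; have := coord_le_norm x0 (Ordinal hn); rewrite mxE ger0_norm; last by lra.
  lra.
exists (L * (D1 + `|x0|) + 1).
  by rewrite ltr_wpDl// mulr_ge0// addr_ge0// ltW.
move=> x; have [Ox|nO] := pselect (Omega x); last first.
  by rewrite fO// addr_ge0// mulr_ge0// addr_ge0// ltW.
have := fL x x0; rewrite (fO nx0) subr0 ger0_norm// => H.
apply: (le_trans H); rewrite -[leLHS]addr0 lerD// ler_wpM2l//.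
by rewrite (le_trans (ler_normB _ _))// lerD2r HD1.
Qed.

Lemma off_f i : offzero Omega (mesh i) (fun z => f (pt (mesh i) z)).
Proof. by move=> z; exact: fO. Qed.

Lemma walk_ge0 i k z : 0 <= walk i k z.
Proof. by apply: kwalk_ge0. Qed.

Lemma walk_bounded : exists2 M : R, 0 < M & forall i k z, 0 <= walk i k z <= M.
Proof.
have [M M0 HM] := f_bounded; exists M => // i k z.
rewrite walk_ge0/=; apply: kwalk_le_cst => //; exact: ltW.
Qed.

Lemma walk_caloric : caloric_in F mesh Omega walk.
Proof.
move=> t x t0 Ox; have [d d0 Hd] := open_normP oO Ox; have [M M0 HM] := walk_bounded.
exists d, M; split=> //; apply: filterE => i k z _ Hz.
have /andP[w0 wM] := HM i k z; split; first by rewrite ger0_norm.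
by apply: kwalk_in; apply: Hd; rewrite distrC.
Qed.

Lemma walk_estimates : exists C, 0 < C /\ \forall i \near F,
    (forall k z w, ~ Omega w -> walk i k z <= C * (`|pt (mesh i) z - w| + mesh i)) /\
    forall k z v, `|walk i k (z + v) - walk i k z| <= C * (`|pt (mesh i) v| + mesh i).
Proof.
have [C [h0 [C0 h00 H]]] := kwalk_lipschitz hn oO bO r0 ext f0 fO L0 fL.
exists C; split=> //; apply: filterS (mesh_lim h00) => i hi.
have [|A B] := H (mesh i); first by rewrite mesh_gt0 ltW.
by split.
Qed.

Lemma sample_cvg t x : cvg ((fun i => sample mesh walk i t x) @ F).
Proof.
have [M M0 HM] := walk_bounded; apply: bF; exists M; apply: filterE => i.
rewrite /sample ger0_norm ?walk_ge0//.
by have /andP[] := HM i (stepno (n := n) mesh i t) (rnd (mesh i) x).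
Qed.

Lemma rnd_dist d (x x' : V) : 0 < d ->
  `|pt d (rnd d x') - pt d (rnd d x)| <= `|x' - x| + 2 * d.
Proof.
move=> d0; have X1 := rnd_near x d0; have X2 := rnd_near x' d0.
have -> : pt d (rnd d x') - pt d (rnd d x) = (pt d (rnd d x') - x') - (pt d (rnd d x) - x) + (x' - x).
  by apply/rowP => j; rewrite !mxE; ring.
rewrite (le_trans (ler_normD _ _))// addrC lerD2l (le_trans (ler_normB _ _))//; lra.
Qed.

Lemma heat_lim_ge0 t x : 0 <= heat_lim t x.
Proof. by apply: limr_ge; [exact: sample_cvg|apply: filterE => i; exact: walk_ge0]. Qed.

Lemma lim_le (a : nat -> R) c : cvg (a @ F) ->
  (forall e, 0 < e -> \forall i \near F, a i <= c + e) -> lim (a @ F) <= c.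
Proof.
by move=> ca H; apply/ler_addgt0Pr => e e0; apply: limr_le => //; exact: H.
Qed.

Lemma heat_lim_bdry : exists2 C, 0 < C & forall t x w, 0 <= t -> ~ Omega w ->
  heat_lim t x <= C * `|x - w|.
Proof.
have [C [C0 H]] := walk_estimates; exists C => // t x w t0 nw.
apply: lim_le; first exact: sample_cvg.
move=> e e0; apply: filterS2 H (lim_small mesh_gt0 mesh_lim (2 * C) e0) => i [Hi _] hs.
apply: (le_trans (Hi _ _ w nw)).
have X := rnd_near x (mesh_gt0 i).
apply: (@le_trans _ _ (C * (`|x - w| + mesh i + mesh i))); last by lra.
rewrite ler_pM2l// lerD2r.
have -> : pt (mesh i) (rnd (mesh i) x) - w = (x - w) + (pt (mesh i) (rnd (mesh i) x) - x).
  by apply/rowP => j; rewrite !mxE; ring.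
by rewrite (le_trans (ler_normD _ _))// lerD2l.
Qed.

(** Unlike the local estimates, this is uniform down to [t = 0] and up to the boundary. The
    parameter [d] is fixed only when continuity is proved. *)
Lemma heat_lim_modulus : exists2 C, 0 < C & forall t t' x x' d, 0 <= t -> 0 <= t' -> 0 < d ->
  `|heat_lim t' x' - heat_lim t x| <= C * (`|x' - x| + d + `|t' - t| / d).
Proof.
have [C [C0 H]] := walk_estimates.
pose K := C * (1 + 2 * n%:R).
have n0 : 0 < n%:R :> R by rewrite ltr0n.
have CK : C <= K by rewrite /K mulrDr mulr1 lerDl !mulr_ge0// ltW.
have K0 : 0 < K by exact: lt_le_trans CK.
have time k m i d z : 0 < d -> (forall k z v, `|walk i k (z + v) - walk i k z| <= C * (`|pt (mesh i) v| + mesh i)) ->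
    `|walk i (m + k)%N z - walk i k z| <= C * (mesh i + d + m%:R * mesh i ^+ 2 / 2 / d).
  move=> d0 Hi; rewrite {1}/walk kwalkD -/(walk i k).
  apply: (kwalk_time hn) => //.
  - exact: ltW (mesh_gt0 i).
  - exact: ltW.
  - by move=> y; exact: walk_ge0.
  - by apply: kwalk_out; exact: off_f.
exists K => // t t' x x' d t0 t'0 d0.
rewrite /heat_lim /limfun -limB; [|exact: sample_cvg|exact: sample_cvg].
have cB : cvg ((fun i => sample mesh walk i t' x' - sample mesh walk i t x) @ F).
  by apply: is_cvgB; exact: sample_cvg.
apply: (lim_norm_le (F := F) cB) => e e0.
have hs0 := @lim_small _ _ F PF mesh mesh_gt0 mesh_lim (4 * C + 4 * n%:R * C / d) e e0.
have h10 := mesh_lim (@ltr01 R).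
apply: filterS3 H hs0 h10 => i [_ Hi] hs h1.
have hp := mesh_gt0 i.
set k := stepno (n := n) mesh i t; set k' := stepno (n := n) mesh i t'; set z := rnd (mesh i) x; set z' := rnd (mesh i) x'.
rewrite /sample -/k -/k' -/z -/z'.
rewrite (_ : _ - _ = (walk i k' z' - walk i k' z) + (walk i k' z - walk i k z)); last by ring.
apply: (le_trans (ler_normD _ _)).
have S1 : `|walk i k' z' - walk i k' z| <= C * (`|x' - x| + 3 * mesh i).
  have := Hi k' z (z' - z); rewrite [z + _]addrC subrK => /le_trans; apply.
  rewrite ler_pM2l// ptD ptN; have := rnd_dist x x' hp; lra.
have T1 := stepno_near hn mesh_gt0 i t0; have T2 := stepno_near hn mesh_gt0 i t'0.
have th := tau_le hn mesh_gt0 (ltW h1).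
have tp := tau_gt0 hn mesh_gt0 i.
have S2 : `|walk i k' z - walk i k z| <= C * (mesh i + d + (`|t' - t| + 2 * mesh i) * (2 * n%:R) / d).
  have aux a b (m : nat) : m%:R * tau (n := n) mesh i <= `|t' - t| + 2 * mesh i -> b = (m + a)%N ->
     `|walk i b z - walk i a z| <= C * (mesh i + d + (`|t' - t| + 2 * mesh i) * (2 * n%:R) / d).
    move=> mt ->; apply: (le_trans (time a m i d z d0 Hi)).
    rewrite ler_pM2l// lerD2l ler_pM2r ?invr_gt0//.
    rewrite [leLHS](_ : _ = m%:R * tau (n := n) mesh i * (2 * n%:R)); last by rewrite /tau; field; rewrite gt_eqF.
    by rewrite ler_pM2r ?mulr_gt0.
  have E : tm (n := n) mesh i k' - tm (n := n) mesh i k = (tm (n := n) mesh i k' - t') - (tm (n := n) mesh i k - t) + (t' - t) by ring.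
  have EE : `|tm (n := n) mesh i k' - tm (n := n) mesh i k| <= `|t' - t| + 2 * mesh i.
    rewrite E (le_trans (ler_normD _ _))// addrC lerD2l (le_trans (ler_normB _ _))//.
    rewrite -/k in T1; rewrite -/k' in T2; lra.
  rewrite tmB normrM (gtr0_norm tp) in EE.
  have [kk|kk] := leqP k k'.
    apply: (aux k k' (k' - k)%N); last by rewrite subnK.
    by rewrite natrB// -[X in X * _]ger0_norm ?subr_ge0 ?ler_nat.
  have kk' := ltnW kk.
  rewrite distrC; apply: (aux k' k (k - k')%N); last by rewrite subnK.
  by rewrite natrB// -[X in X * _]ger0_norm ?subr_ge0 ?ler_nat// distrC.
have N1 := normr_ge0 (x' - x); have N2 := normr_ge0 (t' - t).
have P1 : 0 <= C * n%:R * `|x' - x| by rewrite !mulr_ge0// ltW.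
have P2 : 0 <= C * n%:R * d by rewrite !mulr_ge0// ltW.
have P3 : 0 <= C * (`|t' - t| / d) by rewrite !mulr_ge0 ?invr_ge0// ltW.
apply: (le_trans (lerD S1 S2)).
apply: (@le_trans _ _ (K * (`|x' - x| + d + `|t' - t| / d) + (4 * C + 4 * n%:R * C / d) * mesh i)); last first.
  by rewrite lerD2l.
rewrite -subr_ge0 [leRHS](_ : _ = 2 * (C * n%:R * `|x' - x|) + 2 * (C * n%:R * d) + C * (`|t' - t| / d)).
  by rewrite !addr_ge0// mulr_ge0.
by rewrite /K; field; rewrite gt_eqF.
Qed.

Lemma heat_lim_out t x : 0 <= t -> ~ Omega x -> heat_lim t x = 0.
Proof.
move=> t0 nx; have [C C0 H] := heat_lim_bdry.
apply/eqP; rewrite eq_le heat_lim_ge0 andbT.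
by have := H t x x t0 nx; rewrite subrr normr0 mulr0.
Qed.

Lemma heat_lim_init x : heat_lim 0 x = f x.
Proof.
apply: cvg_lim => //; apply/cvgrPdist_le => e e0.
apply: filterS (lim_small mesh_gt0 mesh_lim L e0) => i hs.
rewrite /sample /stepno mul0r truncn0 /walk /=.
apply: (le_trans (fL _ _)); rewrite distrC (le_trans _ hs)// ler_wpM2l//.
exact: rnd_near (mesh_gt0 i).
Qed.

(** Inside, smoothness and the equation come from the theory of caloric limits; continuity up to the
    parabolic boundary comes from [heat_lim_modulus]. *)
Theorem heat_lim_solution : heat_solution Omega f heat_lim.
Proof.
have [C2 E] := limfun_C12 hn mesh_gt0 mesh_lim bF oO walk_caloric.
split=> //.
- apply/within_contP => -[t x] [/= t0 cx] e e0.
  have [C C0 H] := heat_lim_modulus.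
  have C4 : 0 < 4 * C by rewrite mulr_gt0.
  pose d := e / (4 * C); have d0 : 0 < d by rewrite divr_gt0.
  exists (Num.min d (d * d)) => [|[t' x'] [/= t'0 cx']]; first by rewrite lt_min d0 mulr_gt0.
  rewrite [`|_|]prod_normE/= gt_max !lt_min => /andP[/andP[_ H1] /andP[H2 _]].
  apply: (le_lt_trans (H t' t x' x d t'0 t0 d0)).
  have : `|t - t'| / d < d by rewrite ltr_pdivrMr.
  move=> H3; have -> : e = C * (4 * d) by rewrite /d; field; rewrite gt_eqF.
  by rewrite ltr_pM2l//; lra.
- by move=> t x t0 bx; apply: heat_lim_out; [exact: ltW|exact: bdry_out].
- by move=> x _; exact: heat_lim_init.
Qed.

End HeatLimit.

(** * The uniform exterior ball condition *)

Section ExteriorBall.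
Context {R : realType} {n : nat}.
Local Notation V := 'rV[R]_n.
Local Notation ee i := (delta_mx 0 i : V).

Lemma partial_sum (f : V -> R) (v z : V) : differentiable f z ->
  'D_v f z = \sum_i v 0 i * partial i f z.
Proof.
move=> dc; have D (u : V) : 'D_u f z = 'd f z u := deriveE u dc.
have -> : \sum_i v 0 i * partial i f z = \sum_i v 0 i *: 'd f z (ee i).
  by apply: eq_bigr => i _; rewrite -D.
rewrite D [in LHS](row_sum_delta v) linear_sum.
by apply: eq_bigr => i _; rewrite linearZ.
Qed.

Lemma le_sum_term (F : 'I_n -> R) j : (forall i, 0 <= F i) -> F j <= \sum_i F i.
Proof. by move=> F0; rewrite (bigD1 j)//= lerDl sumr_ge0. Qed.

Lemma norm_le_near (s t S : R) : `|s - t| < 1 -> `|s| <= S -> `|t| <= 1 + S.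
Proof.
move=> H1 H2; rewrite -(subrK s t) (le_trans (ler_normD _ _))// lerD//.
by rewrite distrC ltW.
Qed.

Lemma segment_MVT (f : V -> R) (x y : V) :
  (forall s : R, 0 <= s <= 1 -> differentiable f (x + s *: (y - x))) ->
  exists2 c : R, 0 < c < 1 &
    f y - f x = \sum_i (y - x) 0 i * partial i f (x + c *: (y - x)).
Proof.
move=> H; pose v := y - x.
have [||c c01 E] := @MVT_seg R (fun s : R => f (x + s *: v)) (fun s => 'D_v f (x + s *: v)) 0 1.
- exact: ltr01.
- by move=> s s01; apply: dird_slice; apply: diff_dird; exact: H.
exists c => //; rewrite scale1r scale0r addr0 subr0 mulr1 in E.
have -> : f y = f (x + v) by rewrite /v addrC subrK.
by rewrite E partial_sum//; apply: H; case/andP: c01 => *; rewrite !ltW.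
Qed.

Lemma sqn_add_scale (v e : V) (c : R) :
  sqn (v + c *: e) = sqn v + 2 * c * (\sum_i v 0 i * e 0 i) + c ^+ 2 * sqn e.
Proof.
rewrite /sqn !mulr_sumr -!big_split/=; apply: eq_bigr => i _; rewrite !mxE; ring.
Qed.

Lemma dot_le_sqn (v e : V) (s : R) : 0 < s -> sqn e = 1 -> s ^+ 2 <= sqn v ->
  s * (\sum_i v 0 i * e 0 i) <= sqn v.
Proof.
move=> s0 e1 sv; have := sqn_ge0 (v + (- s) *: e).
rewrite sqn_add_scale e1 sqrrN mulr1 mulrN mulNr => H.
nra.
Qed.

(** Expand [|x - w - r e|^2 = |x - w|^2 - 2 r <x - w, e> + r^2]. Near [w] the hypothesis with
    [2 r A <= 1] controls the middle term; far away [r <= q / 2] and Cauchy-Schwarz do. *)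
Lemma exterior_touching (Omega : set V) (w e : V) (r0 q A : R) :
  0 < r0 -> 0 < q -> sqn e = 1 -> r0 <= q / 2 -> r0 * (2 * A) <= 1 ->
  (forall x, Omega x -> `|x - w| < q -> \sum_i (x - w) 0 i * e 0 i <= A * sqn (x - w)) ->
  forall r : R, 0 < r <= r0 -> exists y, sqn (w - y) = r ^+ 2 /\
    forall x, Omega x -> r ^+ 2 <= sqn (x - y).
Proof.
move=> r00 q0 e1 rq rA H r /andP[rp rr]; exists (w + r *: e); split.
  by rewrite opprD addrA subrr sub0r -scaleNr sqnZ sqrrN e1 mulr1.
move=> x Ox; rewrite opprD addrA -scaleNr sqn_add_scale e1 sqrrN mulr1 lerDr.
set S := \sum_i _.
have S0 := sqn_ge0 (x - w).
have [xq|xq] := ltP `|x - w| q.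
  have HS : S <= A * sqn (x - w) := H x Ox xq.
  have P1 : r * S <= r * (A * sqn (x - w)) by rewrite ler_pM2l.
  have P2 : 0 <= 1 - 2 * (r * A).
    have [A0|A0] := leP 0 A; last by clear -A0 rp; nra.
    by clear -A0 rp rA rr; nra.
  by clear -P1 P2 S0; nra.
have qs : q ^+ 2 <= sqn (x - w).
  rewrite leNgt; apply/negP => sq.
  move: xq; rewrite leNgt => /negP; apply; apply: norm_lt_coord => // i.
  rewrite -(@ltr_pXn2r _ 2)// ?nnegrE ?(ltW q0)// real_normK ?num_real//.
  exact: le_lt_trans (coord_le_sqn _ _) sq.
have HS := dot_le_sqn q0 e1 qs; rewrite -/S in HS.
have [S1|S1] := leP S 0; first by clear -S1 S0 rp; nra.
have : 2 * r * S <= q * S by rewrite ler_pM2r//; lra.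
by clear -HS; nra.
Qed.

Lemma C1_Lipschitz_partial (f : V -> R) (D : set V) (B : R) : 0 <= B ->
  (forall x y (s : R), D x -> D y -> 0 <= s <= 1 -> D (x + s *: (y - x))) ->
  (forall x, D x -> differentiable f x) ->
  (forall x i, D x -> `|partial i f x| <= B) ->
  forall x y, D x -> D y -> `|f y - f x| <= n%:R * B * `|y - x|.
Proof.
move=> B0 conv df bf x y Dx Dy.
have [s s01|c /andP[c0 c1] ->] := @segment_MVT f x y; first by apply: df; exact: conv.
have -> : n%:R * B * `|y - x| = \sum_(i < n) B * `|y - x|.
  by rewrite sumr_const card_ord -[RHS]mulr_natl mulrA.
rewrite (le_trans (ler_norm_sum _ _ _))//; apply: ler_sum => i _.
rewrite normrM mulrC ler_pM//; last exact: coord_le_norm.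
by apply: bf; apply: conv => //; rewrite !ltW.
Qed.

Lemma ball_convex (x0 : V) (r : R) x y (s : R) : `|x - x0| < r -> `|y - x0| < r ->
  0 <= s <= 1 -> `|x + s *: (y - x) - x0| < r.
Proof.
move=> xr yr /andP[s0 s1].
have -> : x + s *: (y - x) - x0 = (1 - s) *: (x - x0) + s *: (y - x0).
  by apply/rowP => j; rewrite !mxE; ring.
rewrite (le_lt_trans (ler_normD _ _))// !normrZ ger0_norm ?subr_ge0// (ger0_norm s0).
have [->|s1'] := eqVneq s 1; first by rewrite subrr mul0r add0r mul1r.
have s2 : 0 < 1 - s by rewrite subr_gt0 lt_neqAle s1'.
have := ltr_pM2l s2 `|x - x0| r; rewrite xr => H1.
have H2 : s * `|y - x0| <= s * r by rewrite ler_wpM2l// ltW.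
by clear -H1 H2; lra.
Qed.

(** Bounded second partials of the graph function bound the outer normal component of [x - w] by a
    multiple of [|x - w|^2], as [exterior_touching] requires. All radii up to [d] are kept so that a
    common one can be chosen later. *)
Lemma exterior_ball_near (Omega : set V) x0 : open Omega -> C3_boundary Omega -> bdry Omega x0 ->
  exists2 d : R, 0 < d & forall w, bdry Omega w -> `|w - x0| < d ->
   forall r : R, 0 < r <= d -> exists y, sqn (w - y) = r ^+ 2 /\
    forall x, Omega x -> r ^+ 2 <= sqn (x - y).
Proof.
move=> oO C3 bx0; have [i [b [g [[dg Hg] inv near]]]] := C3 x0 bx0.
set sg : R := (-1) ^+ b in near.
have /near_normP[q1 q10 Hq1] := near.
have cont j k : {for x0, continuous (partial k (partial j g))}.
  by have [_ /(_ k)[dd _]] := Hg j; apply: differentiable_continuous; exact: dd.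
pose B : R := 1 + \sum_j \sum_k `|partial k (partial j g) x0|.
have B1 : 1 <= B by rewrite lerDl; apply: sumr_ge0 => j _; apply: sumr_ge0.
have B0 : 0 < B by exact: lt_le_trans ltr01 B1.
have /boolp.choice[qq Hqq] : forall jk : 'I_n * 'I_n, exists q, 0 < q /\
    forall y, `|x0 - y| < q -> `|partial jk.2 (partial jk.1 g) y| <= B.
  move=> [j k] /=; have [q q0 Hq] := (contP _ _).1 (cont j k) 1 ltr01.
  exists q; split=> // y yq; have H1 := Hq y yq.
  have H2 : `|partial k (partial j g) x0| <= \sum_j \sum_k `|partial k (partial j g) x0|.
    apply: le_trans (le_sum_term (F := fun j => \sum_k `|partial k (partial j g) x0|) j _).
      by apply: (le_sum_term (F := fun k => `|partial k (partial j g) x0|) k).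
    by move=> l; exact: sumr_ge0.
  exact: norm_le_near H1 H2.
pose q2 : R := \big[Num.min/1]_jk qq jk.
have q20 : 0 < q2 by apply: lt_bigmin => // jk _; case: (Hqq jk).
have Hq2 y : `|x0 - y| < q2 -> forall j k, `|partial k (partial j g) y| <= B.
  move=> yq j k; have [_ H] := Hqq (j, k); apply: H; apply: (lt_le_trans yq).
  exact: bigmin_le_cond.
pose q : R := Num.min q1 q2 / 2.
have q0 : 0 < q by rewrite divr_gt0// lt_min q10.
have Hq y : `|y - x0| < q + q -> (Omega y <-> g y < sg * y 0 i) /\ forall j k, `|partial k (partial j g) y| <= B.
  rewrite -splitr lt_min => /andP[y1 y2].
  by split; [apply: Hq1; rewrite /= distrC|apply: Hq2; rewrite /= distrC].
have sg2 : sg ^+ 2 = 1 by rewrite /sg; case: (b); rewrite ?expr1 ?sqrrN ?expr1n.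
pose A : R := n%:R * (n%:R * B).
pose d := Num.min q (Num.min (q / 2) (2 * (A + 1))^-1).
have A0 : 0 <= A by rewrite /A !mulr_ge0// ltW.
have d0 : 0 < d by rewrite !lt_min q0 divr_gt0// invr_gt0 mulr_gt0// ltr_wpDl.
exists d => // w bw wd.
have wq : `|w - x0| < q by rewrite (lt_le_trans wd)// /d ge_min lexx.
have wqq : `|w - x0| < q + q by rewrite (lt_le_trans wq)// lerDl ltW.
(* The gradient at [w] of [g - sg * x_i], which near [x0] is negative exactly on [Omega]. As [g]
   does not depend on [x_i], component [i] is [- sg], so the length is at least one. *)
pose G (j : 'I_n) : R := partial j g w - sg * (j == i)%:R.
have Gi : G i = - sg.
  rewrite /G eqxx mulr1 (_ : partial i g w = 0) ?sub0r//.
  have E0 : dird g w (ee i) 0.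
    by move=> e e0; exists 1 => // s _; rewrite inv subrr mulr0 subrr normr0 mulr_ge0// ltW.
  by have [_] := dird_is E0.
pose N2 := \sum_j G j ^+ 2.
have N21 : 1 <= N2.
  rewrite /N2 (bigD1 i)//= Gi sqrrN sg2 lerDl; apply: sumr_ge0 => j _; exact: sqr_ge0.
pose N := Num.sqrt N2.
have NN : N ^+ 2 = N2 by rewrite sqr_sqrtr// (le_trans ler01).
have N1 : 1 <= N by rewrite -[leLHS]sqrtr1 ler_wsqrtr.
have N0 : 0 < N by exact: lt_le_trans ltr01 N1.
pose e : V := \row_j (G j / N).
apply: (@exterior_touching Omega w e d q A) => //.
- have -> : e = N^-1 *: (\row_j G j) by apply/rowP => j; rewrite !mxE mulrC.
  rewrite sqnZ /sqn (eq_bigr (fun j => G j ^+ 2)); last by move=> j _; rewrite mxE.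
  by rewrite -/N2 exprVn NN mulVf// gt_eqF// (lt_le_trans ltr01).
- by rewrite /d !ge_min lexx orbT.
- have : d <= (2 * (A + 1))^-1 by rewrite /d !ge_min lexx !orbT.
  have A10 : 0 < 2 * (A + 1) by rewrite mulr_gt0// ltr_wpDl.
  rewrite -(ler_pM2r A10) mulVf ?gt_eqF// => H.
  by apply: le_trans H; rewrite ler_pM2l//; lra.
move=> x Ox xw.
have xq : `|x - x0| < q + q.
  by rewrite -(subrK w x) -addrA (le_lt_trans (ler_normD _ _))// ltrD.
have gx : g x < sg * x 0 i by apply/(Hq x xq).1.
have gw : sg * w 0 i <= g w.
  rewrite leNgt; apply/negP => H; apply: (bdry_out oO bw); exact/(Hq w wqq).1.
have [s _|c /andP[c0 c1] E] := @segment_MVT g w x; first exact: dg.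
set v := x - w in E xw *; set xi := w + c *: v in E.
have S0 := sqn_ge0 v.
have T j : v 0 j * G j <= v 0 j * partial j g xi - sg * (v 0 j * (j == i)%:R) + n%:R * B * sqn v.
  have L : `|partial j g w - partial j g xi| <= n%:R * B * `|w - xi|.
    apply: (@C1_Lipschitz_partial _ (fun y => `|y - x0| < q + q)) => //.
    - exact: ltW.
    - by move=> *; exact: ball_convex.
    - by move=> y _; have [dd _] := Hg j; exact: dd.
    - by move=> y k /Hq[_].
    - by apply: ball_convex => //; rewrite !ltW.
  have wxi : `|w - xi| <= `|v|.
    by rewrite /xi opprD addrA subrr sub0r normrN normrZ ger0_norm ?ler_piMl// ltW.
  have vj := coord_le_norm v j.
  have vv : `|v| ^+ 2 <= sqn v.
    rewrite leNgt; apply/negP => H; have [v0|v0] := eqVneq `|v| 0.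
      by move: H; rewrite v0 expr0n/= ltNge S0.
    have vp : 0 < `|v| by rewrite lt_neqAle eq_sym v0/=.
    have : `|v| < `|v|; last by rewrite ltxx.
    apply: norm_lt_coord => // k.
    rewrite -(@ltr_pXn2r _ 2)// ?nnegrE// real_normK ?num_real//.
    exact: le_lt_trans (coord_le_sqn _ _) H.
  have P : `|v 0 j * (partial j g w - partial j g xi)| <= n%:R * B * sqn v.
    rewrite normrM (le_trans (ler_pM _ _ vj L))//.
    rewrite mulrCA ler_wpM2l ?mulr_ge0 ?(ltW B0)// (le_trans _ vv)// expr2 ler_wpM2l//.
  have := le_trans (ler_norm _) P; rewrite /G => Q.
  have -> : v 0 j * (partial j g w - sg * (j == i)%:R) =
     v 0 j * partial j g xi - sg * (v 0 j * (j == i)%:R) + v 0 j * (partial j g w - partial j g xi) by ring.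
  by rewrite lerD2l.
have SS : \sum_j v 0 j * G j <= A * sqn v.
  apply: (le_trans (ler_sum _ (fun j _ => T j))).
  rewrite big_split/= sumrB -E -mulr_sumr (bigD1 i)//= eqxx mulr1 big1 ?addr0; last first.
    by move=> j /negbTE ->; rewrite mulr0.
  rewrite sumr_const card_ord -[_ *+ n]mulr_natl [n%:R * _]mulrA -/A.
  have -> : v 0 i = x 0 i - w 0 i by rewrite !mxE.
  rewrite mulrBr; have := gx; have := gw; clear; lra.
have -> : \sum_j v 0 j * e 0 j = N^-1 * \sum_j v 0 j * G j.
  by rewrite mulr_sumr; apply: eq_bigr => j _; rewrite [e 0 j]mxE mulrA mulrC.
have AS : 0 <= A * sqn v by rewrite mulr_ge0.
rewrite mulrC ler_pdivrMr//.
by rewrite (le_trans SS)// ler_peMr.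
Qed.

(** Each boundary point has a neighbourhood in which all small radii work; compactness of the
    boundary leaves one radius for all. *)
Lemma C3_exterior_ball (Omega : set V) : open Omega -> bounded_set Omega -> C3_boundary Omega ->
  exists2 r, 0 < r & exterior_ball Omega r.
Proof.
move=> oO bO C3.
have cb : compact (bdry Omega).
  apply: (@subclosed_compact _ (bdry Omega) (closure Omega)); last 2 first.
  - exact: compact_closure.
  - by move=> x [].
  apply: closedI; first exact: closed_closure.
  by apply: open_closedC; exact: open_interior.
have /compact_near_coveringP nc := cb.
have := nc R (0^'+) (fun r w => bdry Omega w -> exists y, sqn (w - y) = r ^+ 2 /\
    forall x, Omega x -> r ^+ 2 <= sqn (x - y)) _.
case.
  move=> x bx; have [d d0 Hd] := exterior_ball_near oO C3 bx.
  exists ([set w | `|x - w| < d], [set r | 0 < r <= d]); last first.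
    by move=> -[w r] /= [wd rd] bw; apply: Hd => //; rewrite distrC.
  split; first by apply: (near_normP x (fun w => `|x - w| < d)).2; exists d.
  by rewrite /=; near=> r; apply/andP; split; near: r; [exact: nbhs_right_gt|exact: nbhs_right_le].
move=> e /= e0 He; have h0 : 0 < e / 2 by rewrite divr_gt0.
exists (e / 2) => // w bw; apply: (He (e / 2)) => //=.
by rewrite sub0r normrN gtr0_norm// ltr_pdivrMr// mulrC ltr_pMl// ltr1n.
Unshelve. all: by end_near. Qed.

End ExteriorBall.

(** * Spectral decay of the walk *)

Section SymmetricWalk.
Context {R : realType} {n : nat}.
Local Notation V := 'rV[R]_n.
Local Notation Z := 'rV[int]_n.
Local Notation ez i := (delta_mx 0 i : Z).
Hypothesis hn : (0 < n)%N.
Variables (Omega : set V) (h : R) (s : seq Z).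
Hypotheses (us : uniq s) (sO : forall z, z \in s <-> Omega (pt h z)).
Implicit Types (g : Z -> R) (z y : Z).
Local Notation off := (offzero Omega h).
Local Notation P := (kstep Omega h).
Local Notation U := (kwalk Omega h).

Definition dot g1 g2 : R := \sum_(z <- s) g1 z * g2 z.

Lemma dotC g1 g2 : dot g1 g2 = dot g2 g1.
Proof. by apply: eq_bigr => z _; rewrite mulrC. Qed.

Lemma dotZB g1 g2 a b : dot (fun z => a * g1 z - b * g2 z) (fun z => a * g1 z - b * g2 z) =
  a ^+ 2 * dot g1 g1 - 2 * a * b * dot g1 g2 + b ^+ 2 * dot g2 g2.
Proof.
by rewrite /dot !mulr_sumr -sumrB -big_split/=; apply: eq_bigr => z _; ring.
Qed.

Lemma dot_ge0 g : 0 <= dot g g.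
Proof. by apply: sumr_ge0 => z _; rewrite -expr2 sqr_ge0. Qed.

Lemma dot_term g z : off g -> g z ^+ 2 <= dot g g.
Proof.
move=> og; have [zs|zs] := boolP (z \in s); last first.
  by rewrite og ?expr0n ?dot_ge0// => /sO; rewrite (negbTE zs).
rewrite /dot (bigD1_seq z)//= -expr2 lerDl; apply: sumr_ge0 => y _.
by rewrite -expr2 sqr_ge0.
Qed.

Lemma dot_cauchy g1 g2 : dot g1 g2 ^+ 2 <= dot g1 g1 * dot g2 g2.
Proof.
have A := dot_ge0 g1; have B := dot_ge0 g2.
have H := dot_ge0 (fun z => dot g2 g2 * g1 z - dot g1 g2 * g2 z).
rewrite dotZB in H.
have H1 : 0 <= dot g2 g2 * (dot g1 g1 * dot g2 g2 - dot g1 g2 ^+ 2).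
  by apply: le_trans H _; rewrite le_eqVlt; apply/orP; left; apply/eqP; ring.
have [B0|B0] := eqVneq (dot g2 g2) 0; last first.
  by move: H1; rewrite pmulr_rge0 ?subr_ge0// lt_neqAle eq_sym B0.
have [->|x0] := eqVneq (dot g1 g2) 0; first by rewrite B0 mulr0 expr0n.
(* With [dot g2 g2 = 0] the square of [g1 - c g2] is linear in [c], and this [c] makes it
   [dot g1 g1 - 2 (dot g1 g1 + 1)], which is negative. *)
have := dot_ge0 (fun z => 1 * g1 z - ((dot g1 g1 + 1) / dot g1 g2) * g2 z).
rewrite dotZB B0 mulr0 addr0 -[_ * dot g1 g2]mulrA divfK// => H2.
by exfalso; lra.
Qed.

Definition kern z y : R := 2^-1 * (y == z)%:R +
  (4 * n%:R)^-1 * \sum_i ((y == z + ez i)%:R + (y == z - ez i)%:R).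

Lemma kernC z y : kern z y = kern y z.
Proof.
rewrite /kern eq_sym; congr (_ + _ * _); apply: eq_bigr => i _.
by rewrite addrC; congr (_%:R + _%:R); congr nat_of_bool;
  apply/eqP/eqP => ->; rewrite ?subrK ?addrK.
Qed.

Lemma sum_pick g y : off g -> \sum_(z <- s) (z == y)%:R * g z = g y.
Proof.
move=> og; have [ys|ys] := boolP (y \in s); last first.
  rewrite big1_seq => [|z /andP[_ zs]]; last first.
    have [zy|] := eqVneq z y; last by rewrite mul0r.
    by rewrite -zy zs in ys.
  by apply/esym/og => /sO; rewrite (negbTE ys).
rewrite (bigD1_seq y)//= eqxx mul1r big1 ?addr0// => z /negbTE ->.
by rewrite mul0r.
Qed.

Lemma kstep_kern g z : off g -> z \in s -> P g z = \sum_(y <- s) kern z y * g y.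
Proof.
move=> og /sO Oz; rewrite /kstep asboolT// /lavg.
rewrite [RHS](_ : _ = 2^-1 * (\sum_(y <- s) (y == z)%:R * g y) + (4 * n%:R)^-1 *
   \sum_i ((\sum_(y <- s) (y == z + ez i)%:R * g y) + (\sum_(y <- s) (y == z - ez i)%:R * g y))).
  by rewrite !sum_pick//; congr (_ + _ * _); apply: eq_bigr => i _; rewrite !sum_pick.
under [X in _ = _ + _ * X]eq_bigr do rewrite -big_split/=.
rewrite exchange_big/= !mulr_sumr -big_split/=; apply: eq_bigr => y _.
rewrite /kern mulrDl -!mulrA; congr (_ + _ * _).
by rewrite mulr_suml; apply: eq_bigr => i _; rewrite mulrDl.
Qed.

Lemma kstep_off g : off (P g).
Proof. by move=> z nz; rewrite /kstep asboolF. Qed.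

Lemma kstep_sym g1 g2 : off g1 -> off g2 -> dot (P g1) g2 = dot g1 (P g2).
Proof.
move=> o1 o2; rewrite /dot.
have -> : \sum_(z <- s) P g1 z * g2 z = \sum_(z <- s) \sum_(y <- s) kern z y * g1 y * g2 z.
  rewrite big_seq [RHS]big_seq; apply: eq_bigr => z zs.
  by rewrite kstep_kern// mulr_suml.
have -> : \sum_(z <- s) g1 z * P g2 z = \sum_(z <- s) \sum_(y <- s) kern z y * g1 z * g2 y.
  rewrite big_seq [RHS]big_seq; apply: eq_bigr => z zs.
  by rewrite kstep_kern// mulr_sumr; apply: eq_bigr => y _; ring.
rewrite exchange_big/=; apply: eq_bigr => z _; apply: eq_bigr => y _.
by rewrite kernC.
Qed.

(** By symmetry only [a + b] matters; together with Cauchy-Schwarz this is the source of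
    log-convexity. *)
Lemma dot_kwalk g a b : off g -> dot (U g a) (U g b) = dot g (U g (a + b)%N).
Proof.
move=> og; elim: a b => [//|a IH] b.
rewrite [U g a.+1]/= kstep_sym; [|exact: kwalk_out|exact: kwalk_out].
by rewrite (IH b.+1) addnS addSn.
Qed.

Lemma kstepZ g c z : P (fun z => c * g z) z = c * P g z.
Proof. by rewrite /kstep; case: ifP => _; rewrite ?mulr0// lavgZ. Qed.

Lemma kstepD g1 g2 z : P (fun z => g1 z + g2 z) z = P g1 z + P g2 z.
Proof. by rewrite /kstep; case: ifP => _; rewrite ?addr0// lavgD. Qed.

Lemma dot_kstep_bound : exists2 K : R, 0 < K & forall g, off g -> dot (P g) (P g) <= K * dot g g.
Proof.
exists (1 + \sum_(z <- s) \sum_(y <- s) kern z y * kern z y).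
  rewrite ltr_wpDr//; apply: sumr_ge0 => z _; apply: sumr_ge0 => y _.
  by rewrite -expr2 sqr_ge0.
move=> g og; rewrite mulrDl mul1r.
apply: (@le_trans _ _ ((\sum_(z <- s) \sum_(y <- s) kern z y * kern z y) * dot g g)); last first.
  by rewrite lerDr dot_ge0.
rewrite mulr_suml {1}/dot big_seq [leRHS]big_seq; apply: ler_sum => z zs.
rewrite kstep_kern// -expr2; exact: (dot_cauchy (kern z) g).
Qed.

Variable F : set_system nat.
Context {PF : ProperFilter F}.
Hypotheses (bF : bounded_cvg (R := R) F) (Foo : \oo `<=` F).

(** Laziness keeps at least half of the value at each step, so no iterate vanishes and all can be
    normalised. *)
Lemma kwalk_pos g m z : (forall y, 0 <= g y) -> Omega (pt h z) ->
  2^-1 ^+ m * g z <= U g m z.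
Proof.
move=> g0 Oz; elim: m => [|m IH]; first by rewrite expr0 mul1r.
rewrite kwalk_in// /lavg exprS -mulrA.
apply: (@le_trans _ _ (2^-1 * U g m z)); first by rewrite ler_pM2l// invr_gt0.
rewrite lerDl mulr_ge0 ?invr_ge0 ?mulr_ge0//.
by apply: sumr_ge0 => i _; rewrite addr_ge0//; exact: kwalk_ge0.
Qed.

Lemma log_convex_limit (c : nat -> R) K : (forall a, 0 < c a) ->
  (forall a, c a.+1 ^+ 2 <= c a * c a.+2) -> (forall a, c a.+1 <= K * c a) ->
  exists rho : R, [/\ 0 < rho, (fun a => c a.+1 / c a) @ \oo --> rho & forall a, c a <= rho ^+ a * c 0%N].
Proof.
move=> c0 lc cK; pose x a := c a.+1 / c a.
have xnd : nondecreasing_seq x.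
  apply/nondecreasing_seqP => a; rewrite /x ler_pdivlMr// mulrAC ler_pdivrMr// -expr2.
  by rewrite [leRHS]mulrC.
have xc : cvg (x @ \oo).
  apply: nondecreasing_is_cvgn => //; exists K => _ [a _ <-].
  by rewrite /x ler_pdivrMr.
have xl a : x a <= lim (x @ \oo) by exact: nondecreasing_cvgn_le.
exists (lim (x @ \oo)); split; [|exact: xc|].
  by apply: (lt_le_trans _ (xl 0%N)); rewrite divr_gt0.
elim=> [|a IH]; first by rewrite expr0 mul1r.
have := xl a; rewrite /x ler_pdivrMr// => /le_trans; apply.
rewrite exprS -mulrA ler_pM2l//; apply: (lt_le_trans _ (xl 0%N)).
by rewrite divr_gt0.
Qed.

Lemma lim_dot (v : nat -> Z -> R) w : (forall z, (fun a => v a z) @ F --> w z) ->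
  (fun a => dot (v a) (v a)) @ F --> dot w w.
Proof.
move=> H; rewrite /dot; elim: (s) => [|z l IH].
  rewrite big_nil; under eq_fun do rewrite big_nil; exact: cvg_cst.
rewrite big_cons; under eq_fun do rewrite big_cons.
by apply: cvgD => //; exact: cvgM.
Qed.

Lemma seq_max (l : seq Z) g : (exists z, z \in l) ->
  exists2 z1, z1 \in l & forall z, z \in l -> g z <= g z1.
Proof.
elim: l => [[z]//|y l IH _]; case: l IH => [_|x l IH].
  by exists y; rewrite ?mem_head// => z; rewrite inE => /eqP ->.
have [|z1 z1l H1] := IH; first by exists x; rewrite mem_head.
have [yz|zy] := leP (g y) (g z1).
  exists z1; first by rewrite inE z1l orbT.
  by move=> z; rewrite inE => /orP[/eqP ->//|]; exact: H1.
exists y; first exact: mem_head.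
move=> z; rewrite inE => /orP[/eqP ->//|/H1 H]; exact: le_trans H (ltW zy).
Qed.

Lemma lim_kstep (v : nat -> Z -> R) w z : (forall z, (fun a => v a z) @ F --> w z) ->
  (fun a => P (v a) z) @ F --> P w z.
Proof.
move=> H; rewrite /kstep; case: ifP => _; last exact: cvg_cst.
rewrite /lavg; apply: cvgD; first by apply: cvgM => //; exact: cvg_cst.
apply: cvgM; first exact: cvg_cst.
by apply: cvg_ord_sum => i; exact: cvgD.
Qed.

(** The limit of the normalised iterates is at first an eigenvector of [P^2] only. A possible
    component for the eigenvalue [- rho] of [P] is removed through
    [P^2 - rho^2 = (P - rho) (P + rho)]. *)
Theorem walk_eigenvector g z0 : off g -> (forall z, 0 <= g z) -> z0 \in s -> 0 < g z0 ->
  exists rho psi, [/\ 0 < rho <= 1, off psi, forall z, 0 <= psi z <= 1,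
    (exists2 z1, z1 \in s & psi z1 = 1) & (forall z, P psi z = rho * psi z)] /\
    forall m, dot (U g m) (U g m) <= rho ^+ (2 * m) * dot g g.
Proof.
move=> og g0 z0s gz0; pose c a := dot (U g a) (U g a).
have c0 a : 0 < c a.
  apply: (@lt_le_trans _ _ (U g a z0 ^+ 2)); last by apply: dot_term; exact: kwalk_out.
  rewrite exprn_gt0// (lt_le_trans _ (kwalk_pos _ g0 _))//; last exact/sO.
  by rewrite mulr_gt0// exprn_gt0// invr_gt0.
have lc a : c a.+1 ^+ 2 <= c a * c a.+2.
  apply: le_trans (dot_cauchy (U g a) (U g a.+2)).
  by rewrite /c !dot_kwalk// addSn -addnS.
have [K K0 HK] := dot_kstep_bound.
have cK a : c a.+1 <= K * c a by apply: HK; exact: kwalk_out.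
have [r2 [r20 xr0 cr]] := log_convex_limit c0 lc cK.
pose v a z := U g a z / Num.sqrt (c a).
have sc a : 0 < Num.sqrt (c a) by rewrite sqrtr_gt0.
have sc2 a : Num.sqrt (c a) ^+ 2 = c a by rewrite sqr_sqrtr// ltW.
have voff a : off (v a) by move=> z nz; rewrite /v (kwalk_out a og nz) mul0r.
have v0 a z : 0 <= v a z by rewrite divr_ge0 ?kwalk_ge0// ltW.
have vv a : dot (v a) (v a) = 1.
  rewrite /dot (eq_bigr (fun z => (U g a z * U g a z) / c a)); last first.
    by move=> z _; rewrite /v mulrACA -invfM -[in RHS](sc2 a) expr2.
  by rewrite -mulr_suml divff// gt_eqF// c0.
have v1 a z : v a z <= 1.
  rewrite -(@ler_pXn2r _ 2)// ?nnegrE// expr1n -(vv a); exact: dot_term.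
have cv z : cvg ((fun a => v a z) @ F).
  by apply: bF; exists 1; apply: filterE => a; rewrite ger0_norm.
pose psi0 z := lim ((fun a => v a z) @ F).
have vpsi z : (fun a => v a z) @ F --> psi0 z by exact: cv.
have p00 z : 0 <= psi0 z by apply: limr_ge; [exact: cv|apply: filterE => a].
have p0off : off psi0.
  move=> z nz; rewrite /psi0; under eq_fun do rewrite voff//; exact: lim_cst.
(* [|P^2 v_a - r2 v_a|^2] is an expression in the ratios [x a] and [x a.+1] that tends to zero, and
   it bounds the square at the single point [z]. *)
have P2 z : P (P psi0) z = r2 * psi0 z.
  apply/eqP; rewrite -subr_eq0 -sqrf_eq0; apply/eqP/le_anti; rewrite sqr_ge0 andbT.
  have L1 : (fun a => (P (P (v a)) z - r2 * v a z) ^+ 2) @ F --> (P (P psi0) z - r2 * psi0 z) ^+ 2.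
    rewrite expr2; under eq_fun do rewrite expr2.
    have L2 : (fun a => P (P (v a)) z - r2 * v a z) @ F --> P (P psi0) z - r2 * psi0 z.
      apply: cvgB; last by apply: cvgM => //; exact: cvg_cst.
      by apply: lim_kstep => y; exact: lim_kstep.
    exact: cvgM.
  pose x a := c a.+1 / c a.
  have xr : x @ F --> r2 by move=> A HA; apply: Foo; exact: xr0.
  have xr1 : (fun a => x a.+1) @ F --> r2.
    have xs : (fun a => x a.+1) @ \oo --> r2 by rewrite (cvg_shiftS x).
    by move=> A HA; apply: Foo; exact: xs.
  have L3 : (fun a => x a.+1 * x a - 2 * r2 * x a + r2 ^+ 2) @ F --> r2 * r2 - 2 * r2 * r2 + r2 ^+ 2.
    apply: cvgD; last exact: cvg_cst.
    by apply: cvgB; apply: cvgM => //; exact: cvg_cst.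
  have -> : 0 = r2 * r2 - 2 * r2 * r2 + r2 ^+ 2 by ring.
  rewrite -(cvg_lim _ L3)// -(cvg_lim _ L1)//; apply: ler_lim.
  - by apply/cvg_ex; eexists; exact: L1.
  - by apply/cvg_ex; eexists; exact: L3.
  apply: filterE => a.
  have PP y : P (P (v a)) y - r2 * v a y = (Num.sqrt (c a))^-1 * U g a.+2 y - (Num.sqrt (c a))^-1 * r2 * U g a y.
    have -> : v a = fun z => (Num.sqrt (c a))^-1 * U g a z by apply/funext => ?; rewrite /v mulrC.
    have -> : P (fun z => (Num.sqrt (c a))^-1 * U g a z) = fun z => (Num.sqrt (c a))^-1 * U g a.+1 z.
      by apply/funext => ?; rewrite kstepZ.
    by rewrite kstepZ mulrA [r2 * _]mulrC.
  have := @dot_term (fun y => (Num.sqrt (c a))^-1 * U g a.+2 y - (Num.sqrt (c a))^-1 * r2 * U g a y) z.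
  rewrite -PP dotZB => /(_ _) H; apply: le_trans (H _) _.
    by move=> y ny; rewrite (kwalk_out a.+2 og ny) (kwalk_out a og ny) !mulr0 subrr.
  rewrite le_eqVlt; apply/orP; left; apply/eqP.
  rewrite dotC -/(c a) -/(c a.+2) -/(dot _ _).
  have -> : dot (U g a) (U g a.+2) = c a.+1 by rewrite /c !dot_kwalk// addSn -addnS.
  have := sc2 a; have := sc a; rewrite /x; set sq := Num.sqrt _; move: sq => sq sq0 <-.
  by field; rewrite !gt_eqF.
have cp0 : dot psi0 psi0 = 1.
  have := lim_dot vpsi; under eq_fun do rewrite vv.
  by move=> /(cvg_lim (@Rhausdorff R)) <-; rewrite lim_cst.
pose r := Num.sqrt r2; have r0 : 0 < r by rewrite sqrtr_gt0.
have rr : r ^+ 2 = r2 by rewrite sqr_sqrtr// ltW.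
(* [P + r] maps [psi0] to an eigenvector for [r]. It is non-negative and, as [q >= r * psi0], not
   zero. *)
pose q z := P psi0 z + r * psi0 z.
have Pp0 z : 0 <= P psi0 z by exact: (@kwalk_ge0 R n hn Omega h psi0 1 p00 z).
have q0 z : 0 <= q z by rewrite addr_ge0// mulr_ge0// ltW.
have qoff : off q by move=> z nz; rewrite /q (kstep_off _ nz) p0off// mulr0 addr0.
have Pq z : P q z = r * q z.
  by rewrite kstepD P2 kstepZ -rr /q; ring.
have [z1 z1s Hz1] : exists2 z1, z1 \in s & forall z, z \in s -> q z <= q z1.
  by apply: seq_max; exists z0.
have qz1 : 0 < q z1.
  rewrite ltNge; apply/negP => Hq; have : dot psi0 psi0 = 0; last first.
    by rewrite cp0 => /eqP; rewrite oner_eq0.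
  rewrite /dot big1_seq// => z /andP[_ zs].
  have := le_trans (Hz1 z zs) Hq; rewrite /q => H.
  have : r * psi0 z <= 0 by apply: le_trans H; rewrite lerDr.
  rewrite pmulr_rle0// => H'; have -> : psi0 z = 0 by apply/le_anti; rewrite H' p00.
  by rewrite mulr0.
have qle z : q z <= q z1.
  have [zs|zs] := boolP (z \in s); first exact: Hz1.
  by rewrite qoff ?(ltW qz1)// => /sO; rewrite (negbTE zs).
have r1 : r <= 1.
  have := @kwalk_le_cst R n hn Omega h q 1 (q z1) (ltW qz1) qle z1.
  by rewrite [kwalk _ _ _ _ _]Pq -[leRHS]mul1r ler_pM2r.
exists r, (fun z => (q z1)^-1 * q z); split; last first.
  move=> m; rewrite exprM rr; exact: cr.
split.
- by rewrite r0.
- by move=> z nz; rewrite /= (qoff _ nz) mulr0.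
- by move=> z; rewrite mulr_ge0 ?invr_ge0 ?(ltW qz1)//= mulrC ler_pdivrMr// mul1r.
- by exists z1 => //; rewrite mulVf// gt_eqF.
- by move=> z; rewrite kstepZ Pq; ring.
Qed.

End SymmetricWalk.

(** * Lattice points against volume *)

Section Counting.
Context {R : realType} {n : nat}.
Local Notation V := 'rV[R]_n.
Local Notation Z := 'rV[int]_n.

Definition box (q : nat) (f : {ffun 'I_n -> 'I_q}) : Z := \row_i (f i)%:Z.

Lemma box_inj q : injective (@box q).
Proof.
move=> f f' /rowP H; apply/ffunP => i; apply: val_inj => /=.
by have := H i; rewrite !mxE => -[].
Qed.

Definition boxes q (z : Z) : seq Z := [seq z + box f | f <- enum {ffun 'I_n -> 'I_q}].

Lemma boxes_uniq q z : uniq (boxes q z).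
Proof.
rewrite map_inj_uniq ?enum_uniq// => f f' /addrI; exact: box_inj.
Qed.

Lemma size_boxes q z : size (boxes q z) = (q ^ n)%N.
Proof. by rewrite size_map -cardE card_ffun !card_ord. Qed.

Lemma lattice_points (Omega : set V) (h D : R) : 0 < h -> 0 <= D ->
  (forall x, Omega x -> `|x| <= D) ->
  exists s : seq Z, [/\ uniq s, forall z, z \in s <-> Omega (pt h z) &
    h ^+ n * (size s)%:R <= (2 * D + h) ^+ n].
Proof.
move=> h0 D0 HD; pose B := Num.truncn (D / h).
pose l := boxes (2 * B).+1 (const_mx (- B%:Z)).
exists [seq z <- l | `[< Omega (pt h z) >] ]; split.
- by rewrite filter_uniq// boxes_uniq.
- move=> z; rewrite mem_filter; split=> [/andP[/asboolP//]|Oz].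
  apply/andP; split; first exact/asboolP.
  have zB i : (`|z 0%R i| <= B)%N.
    rewrite /B; have := coord_le_norm (pt h z) i; have := HD _ Oz; rewrite mxE => H1 H2.
    have := le_trans H2 H1; rewrite normrM gtr0_norm// mulrC -ler_pdivlMr// => H3.
    rewrite truncn_ge_nat ?divr_ge0 ?(ltW h0)//.
    by rewrite natr_absz intr_norm.
  have fB i : (`|(z 0 i + B%:Z)%R| < (2 * B).+1)%N by have := zB i; lia.
  apply/mapP; exists [ffun i => Ordinal (fB i)]; first by rewrite mem_enum.
  apply/rowP => i; rewrite !mxE ffunE/=; by have := zB i; move: (z 0 i) => zi; lia.
have BD : h * B%:R <= D.
  by rewrite mulrC -ler_pdivlMr//; have /andP[] := truncn_itv (divr_ge0 D0 (ltW h0)).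
apply: (@le_trans _ _ (h ^+ n * ((2 * B).+1 ^ n)%:R)).
  rewrite ler_wpM2l ?exprn_ge0 ?(ltW h0)// ler_nat size_filter.
  by rewrite (leq_trans (count_size _ _))// size_boxes.
rewrite natrX -exprMn lerXn2r ?nnegrE ?mulr_ge0 ?addr_ge0 ?mulr_ge0 ?(ltW h0)//.
rewrite -natr1 natrM mulrDr mulr1 lerD2r mulrCA; lra.
Qed.

Lemma sum_sub_seq (s b : seq Z) (G : Z -> R) : uniq s -> uniq b -> {subset b <= s} ->
  (forall z, 0 <= G z) -> \sum_(z <- b) G z <= \sum_(z <- s) G z.
Proof.
move=> us ub bs G0; have p : perm_eq b [seq z <- s | z \in b].
  apply: uniq_perm => //; first exact: filter_uniq.
  move=> z; rewrite mem_filter; case: (boolP (z \in b)) => //= /bs ->//.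
rewrite (perm_big _ p)/= big_filter [leRHS](bigID (fun z => z \in b))/= lerDl.
exact: sumr_ge0.
Qed.

(** This is where pointwise size becomes [l^2] mass independently of the mesh. It is enough to count
    a box with corner [z0]: it has at least [(d / h)^n] lattice points, all in [Omega] because [g]
    vanishes elsewhere. *)
Lemma count_lower (Omega : set V) (h d A : R) (s : seq Z) g z0 : 0 < h -> 0 < d -> 0 < A ->
  uniq s -> (forall z, z \in s <-> Omega (pt h z)) -> offzero Omega h g ->
  (forall v, `|pt h v| <= d -> A <= g (z0 + v)) -> d ^+ n * A ^+ 2 <= h ^+ n * dot s g g.
Proof.
move=> h0 d0 A0 us sO og H; pose q := Num.truncn (d / h).
have q0 : 0 <= d / h by rewrite divr_ge0// ltW.
have /andP[q1 q2] := truncn_itv q0; rewrite -/q in q1 q2.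
have bd f : `|pt h (@box q.+1 f)| <= d.
  apply: norm_le_coord => [|i]; first exact: ltW.
  rewrite !mxE normrM gtr0_norm// mulrC -ler_pdivlMr// (le_trans _ q1)//.
  by rewrite [_%:~R]/((f i)%:R) normr_nat ler_nat -ltnS.
have Ab z : z \in boxes q.+1 z0 -> A <= g z by move=> /mapP[f _ ->]; exact/H/bd.
apply: (@le_trans _ _ (h ^+ n * \sum_(z <- boxes q.+1 z0) g z * g z)); last first.
  rewrite ler_wpM2l ?exprn_ge0 ?(ltW h0)//; apply: sum_sub_seq => //.
  - exact: boxes_uniq.
  - move=> z /Ab Az; apply/sO; apply: contrapT => nO; move: Az; rewrite og//.
    by rewrite leNgt A0.
  - by move=> z; rewrite -expr2 sqr_ge0.
apply: (@le_trans _ _ (h ^+ n * \sum_(z <- boxes q.+1 z0) A ^+ 2)); last first.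
  rewrite ler_wpM2l ?exprn_ge0 ?(ltW h0)//; rewrite big_seq [leRHS]big_seq.
  by apply: ler_sum => z /Ab Az; rewrite expr2 ler_pM// ltW.
rewrite big_const_seq count_predT size_boxes iter_addr addr0 -mulr_natr [leRHS]mulrCA.
rewrite [leLHS]mulrC ler_pM2l ?exprn_gt0// natrX -exprMn lerXn2r ?nnegrE ?(ltW d0)//.
  by rewrite mulr_ge0// ltW.
by rewrite mulrC -ler_pdivrMr// ltW.
Qed.

End Counting.

(** * Smoothing and decay of the walk, uniformly in the mesh *)

Section UniformDecay.
Context {R : realType} {n : nat}.
Local Notation V := 'rV[R]_n.
Local Notation Z := 'rV[int]_n.
Local Notation ez i := (delta_mx 0 i : Z).
Hypothesis hn : (0 < n)%N.
Variables (Omega : set V) (r D : R).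
Hypotheses (oO : open Omega) (bO : bounded_set Omega) (r0 : 0 < r).
Hypothesis ext : exterior_ball Omega r.
Hypotheses (D0 : 0 < D) (HD : forall x, Omega x -> `|x| <= D).

(** For the Lipschitz bound there are two stages: the first [k2] steps produce the boundary bound,
    which feeds the interior estimate during [k1] further steps. *)
Lemma kwalk_smoothing : exists C h0 : R, [/\ 0 < C, 0 < h0 & forall h, 0 < h <= h0 ->
  forall g m, 0 <= m -> (forall z, 0 <= g z <= m) -> offzero Omega h g ->
  (forall k, 4 * n%:R <= k%:R * h ^+ 2 -> forall z w, ~ Omega w ->
    kwalk Omega h g k z <= C * m * (`|pt h z - w| + h)) /\
  (forall k1 k2, 4 * n%:R <= k1%:R * h ^+ 2 -> 4 * n%:R <= k2%:R * h ^+ 2 -> forall z v,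
    `|kwalk Omega h g (k1 + k2) (z + v) - kwalk Omega h g (k1 + k2) z| <= C * m * `|pt h v|)].
Proof.
have [C [h0 [C0 h00 H]]] := boundary_smoothing hn oO bO r0 ext.
pose C2 : R := n%:R * ((2 * C / D + 2^-1) * (D + h0)).
have C20 : 0 <= C2.
  rewrite !mulr_ge0 ?addr_ge0 ?divr_ge0 ?mulr_ge0 ?invr_ge0//; exact: ltW.
exists (C + C2), h0; split=> //; first by rewrite ltr_pwDl.
move=> h /andP[hp hh] g m m0 gm og.
have HB := H h _ g m m0 gm og; split.
  move=> k kh z w nw; apply: (le_trans (HB _ k kh z w nw)); first by rewrite hp.
  by rewrite ler_wpM2r ?addr_ge0 ?(ltW hp)// ler_wpM2r// lerDl.
move=> k1 k2 kh1 kh2 z v; rewrite kwalkD.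
set g2 := kwalk Omega h g k2.
have gl y : 0 <= g y by have /andP[] := gm y.
have gr y : g y <= m by have /andP[] := gm y.
have g2m y : 0 <= g2 y <= m.
  by apply/andP; split; [exact: kwalk_ge0|exact: kwalk_le_cst].
have og2 : offzero Omega h g2 by exact: kwalk_out.
have step i y : `|kwalk Omega h g2 k1 (y + ez i) - kwalk Omega h g2 k1 y| <=
    ((2 * C / D + 2^-1) * (D + h0) * m) * h.
  have := @interior_smoothing R n hn Omega h D C m g2 k1 oO D0 HD hp (ltW C0) m0 g2m og2.
  move=> /(_ _ kh1) IS; apply: le_trans (IS _ i y) _.
    move=> k y' w nw; rewrite -kwalkD; apply: HB => //; first by rewrite hp.
    rewrite (le_trans kh2)// ler_wpM2r ?sqr_ge0// ler_nat leq_addl//.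
  have P : 0 <= (2 * C / D + 2^-1) * m * h.
    by rewrite !mulr_ge0 ?addr_ge0 ?divr_ge0 ?mulr_ge0 ?invr_ge0//; exact: ltW.
  apply: (@le_trans _ _ ((2 * C / D + 2^-1) * m * h * (D + h0))).
    by rewrite ler_wpM2l// lerD2l.
  move: (2 * C / D + 2^-1) => c; rewrite le_eqVlt; apply/orP; left; apply/eqP.
  by rewrite -!mulrA; congr (c * _); rewrite [RHS]mulrC -mulrA [h * _]mulrC.
pose rho := `|pt h z| + `|pt h (z + v)| + 1.
have := @lattice_lipschitz R n (kwalk Omega h g2 k1) h 0 rho _ hp (fun y i _ => step i y) z (z + v).
rewrite !subr0 /rho => LL; apply: le_trans (LL _ _) _.
- by rewrite -addrA ltrDl ltr_wpDl.
- by rewrite addrAC ltrDr ltr_wpDl.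
rewrite ptD [pt h z + _]addrC addrK ler_wpM2r//.
rewrite [leLHS](_ : _ = C2 * m); last by rewrite /C2 !mulrA.
by rewrite ler_wpM2r// lerDr ltW.
Qed.

Variables (L : R) (f : V -> R) (x0 : V).
Hypotheses (f0 : forall x, 0 <= f x) (fO : forall x, ~ Omega x -> f x = 0).
Hypotheses (L0 : 0 <= L) (fL : forall x y, `|f x - f y| <= L * `|x - y|).
Hypothesis fx0 : 0 < f x0.
Local Notation fh h := (fun z => f (pt h z)).
Local Notation W h := (kwalk Omega h (fh h)).

Lemma sum_upper (s : seq Z) h M g : 0 <= M -> 0 < h <= 1 -> (forall z, 0 <= g z <= M) ->
  h ^+ n * (size s)%:R <= (2 * D + h) ^+ n -> h ^+ n * (\sum_(z <- s) g z) <= M * (2 * D + 1) ^+ n.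
Proof.
move=> M0 /andP[h0 h1] gM Hs.
apply: (@le_trans _ _ (h ^+ n * \sum_(z <- s) M)).
  by rewrite ler_wpM2l ?exprn_ge0 ?(ltW h0)//; apply: ler_sum => z _; case/andP: (gM z).
rewrite big_const_seq count_predT iter_addr addr0 -[M *+ _]mulr_natr mulrCA ler_wpM2l//.
apply: (le_trans Hs); rewrite lerXn2r ?nnegrE ?addr_ge0 ?mulr_ge0 ?(ltW D0) ?(ltW h0)//.
by rewrite lerD2l.
Qed.

Lemma dot_init_lower : exists2 A : R, 0 < A & exists2 h0 : R, 0 < h0 & forall h s, 0 < h <= h0 ->
  uniq s -> (forall z, z \in s <-> Omega (pt h z)) -> A <= h ^+ n * dot s (fh h) (fh h).
Proof.
pose d : R := f x0 / (4 * (L + 1)).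
have L1 : 0 < L + 1 by rewrite ltr_wpDl.
have d0 : 0 < d by rewrite divr_gt0// mulr_gt0.
exists (d ^+ n * (f x0 / 2) ^+ 2); first by rewrite mulr_gt0// exprn_gt0// divr_gt0.
exists d => // h s /andP[hp hd] us sO.
apply: (@count_lower R n Omega h d (f x0 / 2) s _ (rnd h x0)) => //.
- by rewrite divr_gt0.
- by move=> z; exact: fO.
move=> v vd; have := fL x0 (pt h (rnd h x0 + v)); rewrite ptD => H.
have N : `|x0 - (pt h (rnd h x0) + pt h v)| <= d + d.
  rewrite opprD addrA (le_trans (ler_normB _ _))// lerD// distrC.
  by rewrite (le_trans (rnd_near _ hp)).
have := le_trans (ler_norm _) (le_trans H (ler_wpM2l L0 N)).
have dE : (L + 1) * (d + d) = f x0 / 2 by rewrite /d; field; rewrite gt_eqF.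
lra.
Qed.

(** The decay rate cannot blow up as the mesh shrinks. For a short time, fixed independently of [h],
    the walk stays close to [f], so [(f, P^(2m) f) >= |f|^2 / 2], which forces [rho^(2m) >= 1/2];
    finitely many such blocks cover one unit of time. *)
Lemma rho_lower : exists2 b : R, 0 < b <= 1 & exists2 h0 : R, 0 < h0 & forall h s kap rho, 0 < h <= h0 ->
  uniq s -> (forall z, z \in s <-> Omega (pt h z)) ->
  h ^+ n * (size s)%:R <= (2 * D + h) ^+ n ->
  kap%:R * h ^+ 2 = 4 * n%:R -> 0 < rho <= 1 ->
  (forall m, dot s (W h m) (W h m) <= rho ^+ (2 * m) * dot s (fh h) (fh h)) ->
  b <= rho ^+ kap.
Proof.
have [A A0 [h1 h10 HA]] := dot_init_lower.
have [M M0 HM] := f_bounded hn bO f0 fO L0 fL.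
have [C [h2 [C0 h20 HC]]] := kwalk_lipschitz hn oO bO r0 ext f0 fO L0 fL.
pose F1 := M * (2 * D + 1) ^+ n.
have F10 : 0 < F1 by rewrite mulr_gt0// exprn_gt0// addr_gt0// mulr_gt0.
(* Makes the error [eta * h^n] times the sum of [f] at most [A / 2], hence at most half of
   [h^n |f|^2]. The three errors in [kwalk_time] then each receive [C * d = eta / 3]. *)
pose eta : R := A / (2 * F1).
have eta0 : 0 < eta by rewrite divr_gt0// mulr_gt0.
pose d : R := eta / (3 * C).
have d0 : 0 < d by rewrite divr_gt0// mulr_gt0.
pose q := Num.truncn (4 * n%:R / d ^+ 2).
have qd : 4 * n%:R <= q.+1%:R * d ^+ 2.
  by rewrite -ler_pdivrMr ?exprn_gt0// ltW// truncnS_gt.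
exists (2^-1 ^+ q.+1).
  by rewrite exprn_gt0 ?invr_gt0//= exprn_ile1// ?invr_ge0// invf_le1// ler1n.
exists (Num.min (Num.min 1 d) (Num.min h1 h2)); first by rewrite !lt_min ltr01 d0 h10.
move=> h s kap rho /andP[hp]; rewrite !le_min => /andP[/andP[hle1 hd] /andP[hh1 hh2]] us sO Hs kE rho01 Hrho.
have hn0 : 0 < h ^+ n by rewrite exprn_gt0.
have h20' : 0 < h ^+ 2 by rewrite exprn_gt0.
pose m := Num.truncn (d ^+ 2 / h ^+ 2).
have dh0 : 0 <= d ^+ 2 / h ^+ 2 by rewrite divr_ge0// ltW// exprn_gt0.
have /andP[m1 m2] := truncn_itv dh0; rewrite -/m in m1 m2.
rewrite ler_pdivlMr// in m1; rewrite ltr_pdivrMr// -natr1 mulrDl mul1r in m2.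
have mp : (0 < m)%N.
  rewrite lt0n; apply/eqP => mE; move: m2; rewrite mE mul0r add0r.
  by apply/negP; rewrite -leNgt lerXn2r// nnegrE ltW.
have hm : h ^+ 2 <= m%:R * h ^+ 2 by rewrite ler_peMl ?(ltW h20')// ler1n.
have [_ HL] := HC h (introT andP (conj hp hh2)).
have close z : `|W h (2 * m) z - fh h z| <= eta.
  have := @kwalk_time R n hn Omega h (fh h) C (ltW hp) (ltW C0) (fun z => f0 _) (fun z => @fO _) (HL 0%N) d (2 * m)%N z d0.
  move=> /le_trans; apply; have -> : eta = C * (d + d + d) by rewrite /d; field; rewrite gt_eqF.
  rewrite ler_pM2l// lerD ?lerD// ler_pdivrMr// -expr2 natrM.
  by apply: le_trans m1; rewrite le_eqVlt; apply/orP; left; apply/eqP; field.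
have fM z : 0 <= fh h z <= M by rewrite f0 HM.
have SU := sum_upper (ltW M0) (introT andP (conj hp hle1)) fM Hs.
have DL := HA h s (introT andP (conj hp hh1)) us sO.
have off : offzero Omega h (fh h) by move=> z; exact: fO.
have half : 2^-1 <= rho ^+ (2 * m).
  have c0 : 0 < dot s (fh h) (fh h) by rewrite -(pmulr_rgt0 _ hn0) (lt_le_trans A0).
  rewrite -(ler_pM2r c0); apply: le_trans (Hrho m).
  rewrite (dot_kwalk us sO)// addnn -mul2n.
  have -> : dot s (fh h) (W h (2 * m)) = dot s (fh h) (fh h) + \sum_(z <- s) fh h z * (W h (2 * m) z - fh h z).
    by rewrite /dot -big_split/=; apply: eq_bigr => z _; ring.
  have low : - (eta * \sum_(z <- s) fh h z) <= \sum_(z <- s) fh h z * (W h (2 * m) z - fh h z).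
    rewrite mulr_sumr -sumrN; apply: ler_sum => z _; rewrite mulrC -mulrN ler_wpM2l//.
    by have := close z; rewrite ler_norml => /andP[].
  have E1 : h ^+ n * (eta * \sum_(z <- s) fh h z) <= h ^+ n * (2^-1 * dot s (fh h) (fh h)).
    rewrite mulrCA [leRHS]mulrCA.
    apply: (@le_trans _ _ (eta * F1)); first by rewrite ler_pM2l.
    rewrite /eta [leLHS](_ : _ = 2^-1 * A); first by rewrite ler_pM2l ?invr_gt0.
    by field; rewrite gt_eqF.
  rewrite ler_pM2l// in E1; lra.
apply: (@le_trans _ _ ((rho ^+ (2 * m)) ^+ q.+1)).
  by rewrite lerXn2r ?nnegrE ?invr_ge0//; case/andP: rho01 => *; rewrite exprn_ge0// ltW.
rewrite -exprM; case/andP: rho01 => rp r1; apply: ler_wiXn2l => //; first exact: ltW.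
rewrite -(ler_nat R) -(ler_pM2r h20') kE natrM natrM.
apply: (le_trans qd).
rewrite mulrAC [leLHS]mulrC ler_pM2r//.
by apply: (le_trans (ltW m2)); rewrite -mulrA mulrDl mul1r lerD2l.
Qed.

(** From [l^2] decay to sup decay, in blocks of two units of time: a value above the claimed bound
    would, by the Lipschitz estimate, persist at half the bound on a ball of radius [d] and so carry
    more [l^2] mass than [rho] permits. *)
Lemma walk_decay b : 0 < b <= 1 -> exists2 Y : R, 0 < Y & exists2 h0 : R, 0 < h0 &
  forall h s kap rho, 0 < h <= h0 ->
  uniq s -> (forall z, z \in s <-> Omega (pt h z)) ->
  h ^+ n * (size s)%:R <= (2 * D + h) ^+ n ->
  kap%:R * h ^+ 2 = 4 * n%:R -> 0 < rho <= 1 -> b <= rho ^+ kap ->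
  (forall m, dot s (W h m) (W h m) <= rho ^+ (2 * m) * dot s (fh h) (fh h)) ->
  forall k z, W h k z <= Y * rho ^+ k.
Proof.
move=> /andP[b0 b1].
have [M M0 HM] := f_bounded hn bO f0 fO L0 fL.
have [C [h1 [C0 h10 HS]]] := kwalk_smoothing.
pose F1 := M ^+ 2 * (2 * D + 1) ^+ n.
have F10 : 0 < F1 by rewrite mulr_gt0// exprn_gt0// addr_gt0// mulr_gt0.
have b20 : 0 < b ^+ 2 by rewrite exprn_gt0.
(* Over a block the target shrinks at most by the factor [b ^+ 2], so the Lipschitz constant [C * m]
   costs at most half of the target within distance [d]. *)
pose d : R := b ^+ 2 / (2 * C).
have d0 : 0 < d by rewrite divr_gt0// mulr_gt0.
have dn0 : 0 < d ^+ n by rewrite exprn_gt0.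
(* Bounds [f] itself, and by [Y >= 1] makes [d^n Y^2 > 4 F1], which is the contradiction in the
   block step. *)
pose Y : R := M + 1 + 4 * F1 / d ^+ n.
have FY0 : 0 < 4 * F1 / d ^+ n by rewrite divr_gt0// mulr_gt0.
have Y1 : 1 <= Y by rewrite /Y; clear -FY0 M0 hn oO bO r0 ext HD f0 fO L0 fL fx0 D0; lra.
have Y0 : 0 < Y by exact: lt_le_trans Y1.
have YF : 4 * F1 < d ^+ n * Y ^+ 2.
  apply: (@lt_le_trans _ _ (d ^+ n * Y)); last first.
    by rewrite ler_pM2l// expr2 ler_peMl// ltW.
  by rewrite [ltRHS]mulrC -ltr_pdivrMr// /Y ltrDr ltr_wpDl// ltW.
exists (Y / b ^+ 2); first by rewrite divr_gt0.
exists (Num.min 1 h1); first by rewrite lt_min ltr01.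
move=> h s kap rho /andP[hp]; rewrite le_min => /andP[hle1 hh1] us sO Hs kE /andP[rp r1] brho Hrho.
have off : offzero Omega h (fh h) by move=> z; exact: fO.
have rn m : 0 < rho ^+ m by rewrite exprn_gt0.
have hn0 : 0 < h ^+ n by rewrite exprn_gt0.
have fM z : 0 <= fh h z * fh h z <= M ^+ 2.
  by rewrite mulr_ge0//= expr2 ler_pM.
have SU := sum_upper (sqr_ge0 M) (introT andP (conj hp hle1)) fM Hs.
have base : forall j z, W h (j * (kap + kap)) z <= Y * rho ^+ (j * (kap + kap)).
  elim=> [|j IH] z; first by rewrite mul0n expr0 mulr1 (le_trans (HM _))// /Y -addrA lerDl; lra.
  set m := Y * rho ^+ (j * (kap + kap)) in IH.
  have m0 : 0 < m by rewrite mulr_gt0.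
  have gm y : 0 <= W h (j * (kap + kap)) y <= m by rewrite IH andbT kwalk_ge0.
  have [_ {}HS] := HS h (introT andP (conj hp hh1)) _ m (ltW m0) gm (kwalk_out _ off).
  have k4 : 4 * n%:R <= kap%:R * h ^+ 2 by rewrite kE.
  have {}HS := HS kap kap k4 k4.
  rewrite mulSn leNgt; apply/negP => zY.
  pose a := Y * rho ^+ (kap + kap + j * (kap + kap)).
  have a0 : 0 < a by rewrite mulr_gt0.
  have aE : a = m * (rho ^+ kap) ^+ 2.
    by rewrite /a /m exprD -exprM muln2 addnn [rho ^+ _ * _]mulrC mulrA.
  have bm : m * b ^+ 2 <= a.
    by rewrite aE ler_pM2l// lerXn2r// nnegrE ltW.
  have oW k : offzero Omega h (W h k) by exact: kwalk_out.
  have a20 : 0 < a / 2 by rewrite divr_gt0.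
  have := @count_lower R n Omega h d (a / 2) s (W h (kap + kap + j * (kap + kap))) z hp d0 a20 us sO (oW _).
  move=> CL; have {CL} : d ^+ n * (a / 2) ^+ 2 <= h ^+ n * dot s (W h (kap + kap + j * (kap + kap))) (W h (kap + kap + j * (kap + kap))).
    apply: CL => v vd; have := HS z v; rewrite -!kwalkD ler_norml => /andP[H _].
    have H2 : C * m * `|pt h v| <= m * b ^+ 2 / 2.
      apply: (@le_trans _ _ (C * m * d)); first by rewrite ler_pM2l// mulr_gt0.
      by rewrite /d le_eqVlt; apply/orP; left; apply/eqP; field; rewrite gt_eqF.
    rewrite -/a in zY; lra.
  apply/negP; rewrite -ltNge.
  apply: (@le_lt_trans _ _ (h ^+ n * (rho ^+ (2 * (kap + kap + j * (kap + kap))) * dot s (fh h) (fh h)))).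
    by rewrite ler_pM2l.
  rewrite mulrCA exprM; apply: (@le_lt_trans _ _ (rho ^+ 2 ^+ (kap + kap + j * (kap + kap)) * F1)).
    by rewrite ler_wpM2l// exprn_ge0// sqr_ge0.
  rewrite -exprM mulnC exprM.
  have -> : d ^+ n * (a / 2) ^+ 2 = (rho ^+ (kap + kap + j * (kap + kap))) ^+ 2 * (d ^+ n * Y ^+ 2 / 4).
    by rewrite /a; move: (rho ^+ _) (d ^+ n) => u v; field.
  by rewrite ltr_pM2l ?exprn_gt0// ltr_pdivlMr// mulrC.
move=> k z; set j := (k %/ (kap + kap))%N.
have kap0 : (0 < kap + kap)%N.
  rewrite addn_gt0 orbb lt0n; apply/eqP => k0; move: kE; rewrite k0 mul0r => /esym/eqP.
  by rewrite mulf_eq0 !pnatr_eq0/= => /eqP n0; move: hn; rewrite n0.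
have kj : (k = (k - j * (kap + kap)) + j * (kap + kap))%N.
  by rewrite subnK// leq_trunc_div.
have kk : (k <= kap + kap + j * (kap + kap))%N.
  by rewrite {1}(divn_eq k (kap + kap)) -/j addnC leq_add2r ltnW// ltn_pmod.
have -> : W h k z = kwalk Omega h (W h (j * (kap + kap))) (k - j * (kap + kap)) z.
  by rewrite -kwalkD -kj.
have yr0 m : 0 < Y * rho ^+ m by rewrite mulr_gt0.
(* Between block times the sup does not increase, while the power of [rho] loses at most the factor
   [b ^+ 2]. *)
apply: (le_trans (kwalk_le_cst hn _ _ _ (ltW (yr0 _)) (base j) z)).
rewrite -mulrA ler_pM2l// mulrC ler_pdivlMr//.
apply: (@le_trans _ _ (rho ^+ (j * (kap + kap)) * (rho ^+ kap) ^+ 2)).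
  by rewrite ler_pM2l// lerXn2r// nnegrE ltW.
rewrite -exprM muln2 -addnn -exprD addnC; apply: ler_wiXn2l => //; exact: ltW.
Qed.

End UniformDecay.

(** * The limiting eigenfunction and exponential decay *)

Section HeatDecay.
Context {R : realType} {n : nat}.
Local Notation V := 'rV[R]_n.
Local Notation Z := 'rV[int]_n.
Local Notation ez i := (delta_mx 0 i : Z).
Hypothesis hn : (0 < n)%N.
Variables (Omega : set V) (r L : R) (f : V -> R) (x0 : V).
Hypotheses (oO : open Omega) (bO : bounded_set Omega) (r0 : 0 < r).
Hypothesis ext : exterior_ball Omega r.
Hypotheses (f0 : forall x, 0 <= f x) (fO : forall x, ~ Omega x -> f x = 0).
Hypotheses (L0 : 0 <= L) (fL : forall x y, `|f x - f y| <= L * `|x - y|).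
Hypothesis fx0 : 0 < f x0.
Variable F : set_system nat.
Context {PF : ProperFilter F}.
Hypothesis bF : bounded_cvg (R := R) F.
Hypothesis Foo : \oo `<=` F.
Local Notation mesh := (@mesh R).
Local Notation W i := (kwalk Omega (mesh i) (fun z => f (pt (mesh i) z))).
Local Notation tm := (@tm R n nat mesh).
Local Notation stepno := (@stepno R n nat mesh).
Local Notation tau := (@tau R n nat mesh).

Definition unit_steps (i : nat) : nat := (4 * n * i.+1 ^ 2)%N.

Lemma unit_stepsE i : (unit_steps i)%:R * mesh i ^+ 2 = 4 * n%:R :> R.
Proof.
rewrite /unit_steps /mesh 2!natrM natrX exprVn -mulrA divff ?mulr1//.
Qed.

Lemma unit_steps_tau i : (unit_steps i)%:R * tau i = 1.
Proof.
rewrite /tau mulrA unit_stepsE divff// mulf_neq0 ?pnatr_eq0//.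
by rewrite -lt0n.
Qed.

Lemma bounded_by : exists2 D : R, 0 < D & forall x, Omega x -> `|x| <= D.
Proof.
have [D [Dr HD]] := bO; exists (`|D| + 1); first by rewrite ltr_wpDl.
by move=> x Ox; apply: (HD (`|D| + 1)) => //; rewrite (le_lt_trans (ler_norm D))// ltrDl.
Qed.

(** What is known at mesh [i]; the point is that [b] and [Y] do not depend on [i]. *)
Record eigen_data b Y i (rho : R) (psi : Z -> R) : Prop := EigenData {
  ed_rho : 0 < rho <= 1;
  ed_off : offzero Omega (mesh i) psi;
  ed_bnd : forall z, 0 <= psi z <= 1;
  ed_max : exists2 z, Omega (pt (mesh i) z) & psi z = 1;
  ed_eig : forall z, kstep Omega (mesh i) psi z = rho * psi z;
  ed_low : b <= rho ^+ unit_steps i;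
  ed_dec : forall k z, W i k z <= Y * rho ^+ k }.

Lemma eigen_family : exists b Y : R, [/\ 0 < b, 0 < Y & exists (rho : nat -> R) (psi : nat -> Z -> R),
  \forall i \near F, eigen_data b Y i (rho i) (psi i)].
Proof.
have [D D0 HD] := bounded_by.
have [A A0 [h1 h10 HA]] := dot_init_lower fO L0 fL fx0.
have [b b01 [h2 h20 HB]] := rho_lower hn oO bO r0 ext D0 f0 fO L0 fL fx0.
have [Y Y0 [h3 h30 HY]] := walk_decay hn oO bO r0 ext D0 HD f0 fO L0 fL b01.
exists b, Y; split=> //; first by case/andP: b01.
pose h0 : R := Num.min h1 (Num.min h2 h3).
have h00 : 0 < h0 by rewrite !lt_min h10 h20.
have /boolp.choice[p Hp] : forall i, exists p : R * (Z -> R), mesh i < h0 -> eigen_data b Y i p.1 p.2.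
  move=> i; have [hi|] := boolP (mesh i < h0); last by exists (0, fun=> 0).
  have mp := mesh_gt0 (R := R) i.
  move: hi; rewrite !lt_min => /and3P[i1 i2 i3].
  have [s [us sO Hs]] := lattice_points mp (ltW D0) HD.
  have c1 : 0 < mesh i <= h1 by rewrite mp ltW.
  have c2 : 0 < mesh i <= h2 by rewrite mp ltW.
  have c3 : 0 < mesh i <= h3 by rewrite mp ltW.
  have dp : 0 < dot s (fun z => f (pt (mesh i) z)) (fun z => f (pt (mesh i) z)).
    by rewrite -(pmulr_rgt0 _ (exprn_gt0 n mp)) (lt_le_trans A0)// HA.
  have [z0 z0s fz0] : exists2 z, z \in s & 0 < f (pt (mesh i) z).
    apply: contrapT => nH; move: dp; rewrite /dot big1_seq ?ltxx// => z /andP[_ zs].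
    have -> : f (pt (mesh i) z) = 0; last by rewrite mulr0.
    apply/le_anti; rewrite f0 andbT leNgt; apply/negP => H; apply: nH.
    by exists z.
  have og : offzero Omega (mesh i) (fun z => f (pt (mesh i) z)) by move=> z; exact: fO.
  have [rho [psi [[H1 H2 H3 [z1 z1s H4] H5] H6]]] :=
    walk_eigenvector hn us sO bF Foo og (fun z => f0 _) z0s fz0.
  have low := HB _ _ _ _ c2 us sO Hs (unit_stepsE i) H1 H6.
  exists (rho, psi) => _; split=> //=.
    by exists z1 => //; exact/sO.
  exact: (HY _ _ _ _ c3 us sO Hs (unit_stepsE i) H1 low H6).
exists (fun i => (p i).1), (fun i => (p i).2).
by apply: filterS (mesh_lim Foo h00) => i; exact: Hp.
Qed.

Section Limit.
Variables (b Y : R) (rho : nat -> R) (psi : nat -> Z -> R).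
Hypotheses (b0 : 0 < b) (Y0 : 0 < Y).
Hypothesis ED : \forall i \near F, eigen_data b Y i (rho i) (psi i).

(** As [unit_steps i] is the inverse of [tau i], this is [- ln (rho i) / tau i], the decay rate per
    unit of time. The lower bound [b] keeps it bounded. *)
Definition rate i : R := - ((unit_steps i)%:R * ln (rho i)).
Definition lim_rate : R := lim (rate @ F).

Lemma rho_expR i k : 0 < rho i -> rho i ^+ k = expR (- (rate i * tm i k)).
Proof.
move=> rp; have -> : - (rate i * tm i k) = k%:R * ln (rho i).
  rewrite /rate /tm; have := unit_steps_tau i.
  move: (unit_steps i)%:R (tau i) => K T E.
  by rewrite [RHS](_ : _ = k%:R * ln (rho i) * (K * T)); [ring|rewrite E mulr1].
by rewrite expRM_natl lnK.
Qed.

Lemma rate_cvg : rate @ F --> lim_rate.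
Proof.
apply: bF; exists (`|ln b|); apply: filterS ED => i [/andP[rp r1] _ _ _ _ low _].
rewrite /rate normrN mulr_natl -lnXn//.
have H1 : ln (rho i ^+ unit_steps i) <= 0.
  by rewrite ln_le0// exprn_ile1// ltW.
have H2 : ln b <= ln (rho i ^+ unit_steps i) by rewrite ler_ln ?posrE// exprn_gt0.
by rewrite !ler0_norm ?lerN2// (le_trans H2).
Qed.

Lemma tm_cvg t : 0 <= t -> (fun i => tm i (stepno i t)) @ F --> t.
Proof.
move=> t0; apply/cvgrPdist_le => e e0.
apply: filterS2 (mesh_lim Foo (@ltr01 R)) (mesh_lim Foo e0) => i m1 me.
rewrite distrC; apply: le_trans (stepno_near hn (@mesh_gt0 R) i t0) _.
exact: le_trans (tau_le hn (@mesh_gt0 R) (ltW m1)) (ltW me).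
Qed.

Lemma rho_cvg t : 0 <= t -> (fun i => rho i ^+ stepno i t) @ F --> expR (- (lim_rate * t)).
Proof.
move=> t0; have H : (fun i => expR (- (rate i * tm i (stepno i t)))) @ F --> expR (- (lim_rate * t)).
  apply: (@cvg_comp _ _ _ (fun i => - (rate i * tm i (stepno i t))) expR _ (nbhs (- (lim_rate * t)))).
    by apply: cvgN; apply: cvgM; [exact: rate_cvg|exact: tm_cvg].
  exact: continuous_expR.
apply: cvg_trans H; apply: near_eq_cvg; apply: filterS ED => i [/andP[rp _] _ _ _ _ _ _].
by rewrite rho_expR.
Qed.

(** Letting the eigenvector evolve turns it into a caloric family [rho^k psi], to which the
    parabolic smoothness theory applies. In the limit it is [e^(- lim_rate t)] times [profile], and
    the heat equation becomes the eigenvalue equation. *)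
Definition ewalk i k : Z -> R := kwalk Omega (mesh i) (psi i) k.

Lemma ewalkE i k z : eigen_data b Y i (rho i) (psi i) -> ewalk i k z = rho i ^+ k * psi i z.
Proof.
move=> [_ _ _ _ eig _ _]; elim: k z => [|k IH] z; first by rewrite expr0 mul1r.
rewrite /ewalk /kwalk iterS -/(kwalk Omega (mesh i) (psi i) k).
have -> : kwalk Omega (mesh i) (psi i) k = fun z => rho i ^+ k * psi i z by apply/funext; exact: IH.
by rewrite kstepZ eig exprSr mulrA.
Qed.

Lemma ewalk_bnd i k z : eigen_data b Y i (rho i) (psi i) -> 0 <= ewalk i k z <= 1.
Proof.
move=> [_ _ bnd _ _ _ _]; apply/andP; split.
  by apply: kwalk_ge0 => // y; case/andP: (bnd y).
by apply: kwalk_le_cst => // y; case/andP: (bnd y).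
Qed.

Lemma ewalk_caloric : caloric_in F mesh Omega ewalk.
Proof.
move=> t x t0 Ox; have [d d0 Hd] := open_normP oO Ox.
exists d, 1; split=> //; apply: filterS ED => i ed k z _ Hz.
have /andP[w0 w1] := ewalk_bnd k z ed; split; first by rewrite ger0_norm.
by apply: kwalk_in; apply: Hd; rewrite distrC.
Qed.

(** Since [psi = rho^(-k) P^k psi], smoothing over one or two units of time transfers to [psi]
    itself at the cost of [1 / b] or [1 / b^2]. *)
Lemma psi_estimates : exists2 C : R, 0 < C & \forall i \near F,
  (forall z w, ~ Omega w -> psi i z <= C * (`|pt (mesh i) z - w| + mesh i)) /\
  (forall z v, `|psi i (z + v) - psi i z| <= C * `|pt (mesh i) v|).
Proof.
have [D D0 HD] := bounded_by.
have [C [h0 [C0 h00 H]]] := kwalk_smoothing hn oO bO r0 ext D0 HD.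
exists (C / b ^+ 2 + C / b).
  by rewrite addr_gt0// divr_gt0// exprn_gt0.
apply: filterS2 ED (mesh_lim Foo h00) => i ed hi; have mp := mesh_gt0 (R := R) i.
have [/andP[rp r1] off bnd _ _ low _] := ed.
have [|H1 H2] := H (mesh i) _ (psi i) 1 ler01 bnd off; first by rewrite mp ltW.
have k4 : 4 * n%:R <= (unit_steps i)%:R * mesh i ^+ 2 by rewrite unit_stepsE.
have p0 z : 0 <= psi i z by case/andP: (bnd z).
split.
  move=> z w nw; have := H1 _ k4 z w nw.
  rewrite -/(ewalk i _ z) ewalkE// mulr1 => HH.
  have HH2 : b * psi i z <= C * (`|pt (mesh i) z - w| + mesh i).
    by apply: le_trans HH; rewrite ler_wpM2r.
  apply: (@le_trans _ _ (C / b * (`|pt (mesh i) z - w| + mesh i))).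
    by rewrite mulrAC ler_pdivlMr// mulrC.
  rewrite ler_wpM2r ?addr_ge0// ?(ltW mp)// lerDr.
  by apply: divr_ge0; [exact: ltW|exact: exprn_ge0 (ltW b0)].
move=> z v; have := H2 _ _ k4 k4 z v.
rewrite -/(ewalk i _ z) -/(ewalk i _ (z + v)) !ewalkE// mulr1 -mulrBr normrM ger0_norm; last first.
  by rewrite exprn_ge0// ltW.
move=> HH; apply: (@le_trans _ _ (C / b ^+ 2 * `|pt (mesh i) v|)); last first.
  by rewrite ler_wpM2r// lerDl divr_ge0// ltW.
rewrite mulrAC ler_pdivlMr ?exprn_gt0// mulrC; apply: le_trans HH.
rewrite ler_wpM2r// exprD expr2 ler_pM//; exact: ltW.
Qed.

(** Time [1] stands for any positive time: smoothness is available there, and the function is a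
    positive multiple of [profile]. *)
Definition eigenfun := limfun F mesh ewalk 1.
Definition profile x : R := lim ((fun i => psi i (rnd (mesh i) x)) @ F).

Lemma profile_cvg x : (fun i => psi i (rnd (mesh i) x)) @ F --> profile x.
Proof.
apply: bF; exists 1; apply: filterS ED => i [_ _ bnd _ _ _ _].
by case/andP: (bnd (rnd (mesh i) x)) => p0 p1; rewrite ger0_norm.
Qed.

Lemma limfun_ewalk t x : 0 <= t -> limfun F mesh ewalk t x = expR (- (lim_rate * t)) * profile x.
Proof.
move=> t0; apply: cvg_lim => //.
have H : (fun i => rho i ^+ stepno i t * psi i (rnd (mesh i) x)) @ F --> expR (- (lim_rate * t)) * profile x.
  by apply: cvgM; [exact: rho_cvg|exact: profile_cvg].
apply: cvg_trans H; apply: near_eq_cvg; apply: filterS ED => i ed.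
by rewrite /sample ewalkE.
Qed.

Lemma profile_ge0 x : 0 <= profile x.
Proof.
apply: limr_ge; first by apply/cvg_ex; eexists; exact: profile_cvg.
by apply: filterS ED => i [_ _ bnd _ _ _ _]; case/andP: (bnd (rnd (mesh i) x)).
Qed.

Lemma profile_lipschitz : exists2 C : R, 0 < C & forall x y, `|profile x - profile y| <= C * `|x - y|.
Proof.
have [C C0 H] := psi_estimates; exists C => // x y.
rewrite /profile -limB; [|by apply/cvg_ex; eexists; exact: profile_cvg|by apply/cvg_ex; eexists; exact: profile_cvg].
have cB : cvg ((fun i => psi i (rnd (mesh i) x) - psi i (rnd (mesh i) y)) @ F).
  by apply: is_cvgB; apply/cvg_ex; eexists; exact: profile_cvg.
apply: (lim_norm_le (F := F) cB) => e e0.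
have hs := @lim_small _ _ F PF mesh (@mesh_gt0 R) (mesh_lim Foo) (2 * C) e e0.
apply: filterS2 H hs => i [_ Hi] hsi.
have := Hi (rnd (mesh i) y) (rnd (mesh i) x - rnd (mesh i) y).
rewrite [rnd _ y + _]addrC subrK => /le_trans; apply.
rewrite ptD ptN; have := rnd_dist y x (mesh_gt0 (R := R) i) => Hr.
apply: (le_trans (ler_wpM2l (ltW C0) Hr)).
by rewrite mulrDr lerD2l mulrA [C * 2]mulrC.
Qed.

Lemma profile_out w : ~ Omega w -> profile w = 0.
Proof.
move=> nw; have [C C0 H] := psi_estimates.
apply/le_anti; rewrite profile_ge0 andbT.
apply: (lim_le (F := F)); first by apply/cvg_ex; eexists; exact: profile_cvg.
move=> e e0; have hs := @lim_small _ _ F PF mesh (@mesh_gt0 R) (mesh_lim Foo) (2 * C) e e0.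
apply: filterS2 H hs => i [Hi _] hsi; rewrite add0r (le_trans (Hi _ w nw))//.
apply: le_trans hsi; rewrite [2 * C]mulrC -mulrA ler_pM2l// mulrDl mul1r lerD2r.
exact: rnd_near (mesh_gt0 (R := R) i).
Qed.

(** The maximum [1] must not be lost in the limit. The points where it is attained converge along
    [F], and the uniform Lipschitz bound keeps the value at least [1/2] at their limit, which is in
    [Omega] because [profile] vanishes outside. *)
Lemma profile_pos : exists2 x, Omega x & 0 < profile x.
Proof.
have [C C0 H] := psi_estimates; have [D D0 HD] := bounded_by.
have /boolp.choice[z Hz] : forall i, exists z, eigen_data b Y i (rho i) (psi i) ->
    Omega (pt (mesh i) z) /\ psi i z = 1.
  move=> i; have [ed|] := pselect (eigen_data b Y i (rho i) (psi i)); last by exists 0.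
  by have [z] := ed_max ed; exists z.
have zc j : cvg ((fun i => pt (mesh i) (z i) 0 j) @ F).
  apply: bF; exists D; apply: filterS ED => i /Hz[Oz _].
  exact: le_trans (coord_le_norm _ _) (HD _ Oz).
pose x : V := \row_j lim ((fun i => pt (mesh i) (z i) 0 j) @ F).
have dist0 : (fun i => \sum_j `|pt (mesh i) (z i) 0 j - x 0 j|) @ F --> (\sum_(j < n) 0 : R).
  apply: cvg_ord_sum => j.
  have -> : 0 = `|x 0 j - x 0 j| by rewrite subrr normr0.
  apply: cvg_norm; apply: cvgB; last exact: cvg_cst.
  by rewrite [X in _ --> X]mxE; exact: zc.
have e0 : 0 < (4 * C)^-1 by rewrite invr_gt0 mulr_gt0.
have near1 : \forall i \near F, `|pt (mesh i) (z i) - x| <= (4 * C)^-1.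
  move/cvgrPdist_le : dist0 => /(_ _ e0); apply: filterS => i.
  rewrite big1// sub0r normrN ger0_norm ?sumr_ge0// => H2.
  apply: norm_le_coord => [|j]; first exact: ltW.
  apply: le_trans H2; have := le_sum_term (F := fun j => `|pt (mesh i) (z i) 0 j - x 0 j|) j (fun _ => normr_ge0 _).
  by rewrite !mxE.
have half : 2^-1 <= profile x.
  apply: limr_ge; first by apply/cvg_ex; eexists; exact: profile_cvg.
  have hs := mesh_lim Foo e0.
  apply: filterS2 (filterI ED near1) (filterI H hs) => i [ed n1] [[_ Hi] n2].
  have [_ z1] := Hz i ed.
  have := Hi (z i) (rnd (mesh i) x - z i); rewrite [z i + _]addrC subrK z1 ptD ptN.
  have dd : `|pt (mesh i) (rnd (mesh i) x) - pt (mesh i) (z i)| <= (4 * C)^-1 + (4 * C)^-1.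
    have -> : pt (mesh i) (rnd (mesh i) x) - pt (mesh i) (z i) =
      (pt (mesh i) (rnd (mesh i) x) - x) - (pt (mesh i) (z i) - x) by rewrite opprB addrA subrK.
    rewrite (le_trans (ler_normB _ _))// lerD//.
    by rewrite (le_trans (rnd_near x (mesh_gt0 (R := R) i)))// ltW.
  have CE : C * ((4 * C)^-1 + (4 * C)^-1) = 2^-1 by field; rewrite gt_eqF.
  have := ler_wpM2l (ltW C0) dd; rewrite CE => H1 H2.
  have := le_trans H2 H1; rewrite distrC ler_norml => /andP[_]; lra.
have pp : 0 < profile x by rewrite (lt_le_trans _ half)// invr_gt0.
exists x => //; apply: contrapT => nO; move: pp; rewrite profile_out// ltxx.
by [].
Qed.

Lemma lim_rate_eigenvalue : dirichlet_eigenvalue Omega lim_rate.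
Proof.
have efE x : eigenfun x = expR (- lim_rate) * profile x.
  by rewrite /eigenfun limfun_ewalk// mulr1.
exists eigenfun; split.
- split.
    apply/within_contP => x _ e e0; have [C C0 HC] := profile_lipschitz.
    have EC : 0 < expR (- lim_rate) * C by rewrite mulr_gt0// expR_gt0.
    exists (e / (expR (- lim_rate) * C)); first by rewrite divr_gt0.
    move=> y _; rewrite ltr_pdivlMr// => H; rewrite !efE -mulrBr normrM gtr0_norm ?expR_gt0//.
    by apply: le_lt_trans H; rewrite [leRHS]mulrC -mulrA ler_pM2l ?expR_gt0.
  by move=> x /(bdry_out oO) nx; rewrite efE profile_out// mulr0.
- exact: (limfun_Ck2 hn (@mesh_gt0 R) (mesh_lim Foo) bF oO ewalk_caloric ltr01).
- have [x Ox px] := profile_pos; exists x => //.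
  by rewrite efE mulf_neq0// gt_eqF// expR_gt0.
move=> x Ox.
have [_ E] := limfun_C12 hn (@mesh_gt0 R) (mesh_lim Foo) bF oO ewalk_caloric.
have := E 1 x ltr01 Ox; rewrite -/eigenfun.
have D : dird ((limfun F mesh ewalk)^~ x) 1 1 (- lim_rate * eigenfun x).
  have I : dird (fun s : R => s) (1 : R) 1 1 by apply/dirdP; exact: is_derive_id.
  have I2 := dirdZ (- lim_rate) I.
  have De : dird expR (- lim_rate * 1) 1 (expR (- lim_rate * 1)).
    by apply/dirdP; exact: is_derive_expR.
  have H := dirdZ (profile x) (dird_chain (f := fun s : R => - lim_rate * s) I2 De).
  have := dird_eq (g := (limfun F mesh ewalk)^~ x) _ H.
  rewrite !mulr1 efE => HH.
  rewrite (_ : - lim_rate * _ = profile x * (expR (- lim_rate) * - lim_rate)); last by ring.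
  apply: HH; exists 1 => // s s1; rewrite limfun_ewalk.
    by rewrite mulrC mulNr.
  by rewrite /= [s *: _]mulr1; move: s1; rewrite ltr_norml => /andP[]; lra.
have [_ De] := dird_is D.
rewrite derive1E De => /eqP; rewrite subr_eq0 mulNr => /eqP <-.
by rewrite opprK.
Qed.

Lemma heat_lim_decay t x : 0 <= t -> heat_lim Omega f F t x <= Y * expR (- (lim_rate * t)).
Proof.
move=> t0; apply: lim_le; first exact: (sample_cvg hn bO f0 fO L0 fL bF).
move=> e e0; have H : (fun i => Y * rho i ^+ stepno i t) @ F --> Y * expR (- (lim_rate * t)).
  by apply: cvgM; [exact: cvg_cst|exact: rho_cvg].
move/cvgrPdist_le : H => /(_ e e0); apply: filterS2 ED => i [_ _ _ _ _ _ dec] H.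
rewrite (le_trans (dec _ _))//; move: H; rewrite distrC ler_norml => /andP[_]; lra.
Qed.

(** The last unit of time is spent on boundary smoothing, starting from the sup bound at step
    [k - unit_steps i]; the time lost costs the factor [1 / b]. *)
Lemma heat_lim_bdry_decay : exists2 C : R, 0 < C & forall t x w, 1 <= t -> ~ Omega w ->
  heat_lim Omega f F t x <= C * expR (- (lim_rate * t)) * `|x - w|.
Proof.
have [D D0 HD] := bounded_by.
have [C [h0 [C0 h00 H]]] := kwalk_smoothing hn oO bO r0 ext D0 HD.
have K0 : 0 < C * Y / b by rewrite divr_gt0// mulr_gt0.
exists (C * Y / b) => // t x w t1 nw; have t0 := le_trans ler01 t1.
apply: lim_le; first exact: (sample_cvg hn bO f0 fO L0 fL bF).
move=> e e0.
have HH : (fun i => C * Y / b * rho i ^+ stepno i t * `|x - w|) @ F --> C * Y / b * expR (- (lim_rate * t)) * `|x - w|.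
  apply: cvgM; last exact: cvg_cst.
  by apply: cvgM; [exact: cvg_cst|exact: rho_cvg].
have e2 : 0 < e / 2 by rewrite divr_gt0.
move/cvgrPdist_le : HH => /(_ _ e2) HH.
have hs := @lim_small _ _ F PF mesh (@mesh_gt0 R) (mesh_lim Foo) (2 * (C * Y / b)) _ e2.
apply: filterS2 (filterI ED (mesh_lim Foo h00)) (filterI HH hs) => i [ed hi] [Hi hsi].
have [/andP[rp r1] off bnd _ _ low dec] := ed; have mp := mesh_gt0 (R := R) i.
rewrite /sample; set k := stepno i t in Hi *; set z := rnd _ x.
have kk : (unit_steps i <= k)%N.
  have tp := tau_gt0 hn (@mesh_gt0 R) i.
  rewrite /k /stepno truncn_ge_nat; last by rewrite divr_ge0// ltW.
  by rewrite ler_pdivlMr// unit_steps_tau.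
have Yr : 0 < Y * rho i ^+ (k - unit_steps i) by rewrite mulr_gt0// exprn_gt0.
have gm y : 0 <= W i (k - unit_steps i) y <= Y * rho i ^+ (k - unit_steps i).
  by rewrite dec andbT; apply: kwalk_ge0.
have og : offzero Omega (mesh i) (W i (k - unit_steps i)).
  by apply: kwalk_out => y; exact: fO.
have [|H1 _] := H (mesh i) _ _ _ (ltW Yr) gm og; first by rewrite mp ltW.
have k4 : 4 * n%:R <= (unit_steps i)%:R * mesh i ^+ 2 by rewrite unit_stepsE.
have := H1 _ k4 z w nw; rewrite -kwalkD subnKC// => H2.
have rb : rho i ^+ (k - unit_steps i) <= rho i ^+ k / b.
  rewrite ler_pdivlMr// -{2}(subnK kk) exprD ler_pM2l// exprn_gt0//.
have zx : `|pt (mesh i) z - w| + mesh i <= `|x - w| + 2 * mesh i.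
  have := rnd_near x mp; rewrite -/z => N.
  have -> : pt (mesh i) z - w = (x - w) + (pt (mesh i) z - x) by rewrite [RHS]addrC addrA subrK.
  have := ler_normD (x - w) (pt (mesh i) z - x); lra.
have rk1 : rho i ^+ k <= 1 by rewrite exprn_ile1// ltW.
have S1 : W i k z <= C * Y / b * rho i ^+ k * (`|x - w| + 2 * mesh i).
  apply: (le_trans H2); apply: ler_pM => //.
  - by rewrite mulr_ge0// ?(ltW C0)// ltW.
  - by rewrite addr_ge0// ltW.
  have -> : C * Y / b * rho i ^+ k = C * (Y * (rho i ^+ k / b)) by ring.
  by rewrite ler_pM2l// ler_pM2l.
apply: (le_trans S1); rewrite mulrDr.
have S2 : C * Y / b * rho i ^+ k * (2 * mesh i) <= e / 2.
  apply: le_trans hsi; move: (C * Y / b) K0 => K K0.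
  rewrite [leLHS](_ : _ = 2 * K * mesh i * rho i ^+ k); last by ring.
  by rewrite ler_piMr//; apply: mulr_ge0; [apply: mulr_ge0 => //; exact: ltW|exact: ltW].
move: Hi; rewrite distrC ler_norml => /andP[_]; lra.
Qed.

End Limit.

Theorem heat_decay : exists mu C : R, [/\ dirichlet_eigenvalue Omega mu, 0 < C,
  forall t x, 0 <= t -> heat_lim Omega f F t x <= C * expR (- (mu * t)) &
  forall t x w, 1 <= t -> ~ Omega w -> heat_lim Omega f F t x <= C * expR (- (mu * t)) * `|x - w|].
Proof.
have [b [Y [b0 Y0 [rho [psi ED]]]]] := eigen_family.
have [C C0 HC] := heat_lim_bdry_decay b0 Y0 ED.
exists (lim_rate rho), (Y + C); split.
- exact: lim_rate_eigenvalue ED.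
- by rewrite addr_gt0.
- move=> t x t0; rewrite (le_trans (heat_lim_decay b0 ED x t0))// ler_wpM2r ?expR_ge0//.
  by rewrite lerDl ltW.
- move=> t x w t1 nw; rewrite (le_trans (HC t x w t1 nw))// ler_wpM2r// ler_wpM2r ?expR_ge0//.
  by rewrite lerDr ltW.
Qed.

End HeatDecay.

(** * Comparison and data vanishing on the boundary *)

Section Comparison.
Context {R : realType} {n : nat}.
Local Notation V := 'rV[R]_n.
Local Notation ee i := (delta_mx 0 i : V).
Hypothesis hn : (0 < n)%N.
Variable Omega : set V.
Hypotheses (oO : open Omega) (bO : bounded_set Omega).
Local Notation halfcyl := [set z : R * V | 0 <= z.1 /\ closure Omega z.2].

Lemma comparison v w :
  {within halfcyl, continuous (fun z : R * V => v z.1 z.2)} ->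
  {within halfcyl, continuous (fun z : R * V => w z.1 z.2)} ->
  (forall x, closure Omega x -> v 0 x <= w 0 x) ->
  (forall t x, 0 < t -> bdry Omega x -> v t x <= w t x) ->
  (forall t x, 0 < t -> Omega x -> exists a g H a' g' H',
    [/\ jet v t x a g H, jet w t x a' g' H' &
      (forall i, g i = g' i) -> a - \sum_i H i <= a' - \sum_i H' i]) ->
  forall t x, 0 <= t -> closure Omega x -> v t x <= w t x.
Proof.
move=> cv cw v0 vb J t x t0 cx; rewrite -subr_le0.
have T0 : 0 < t + 1 by rewrite ltr_wpDl.
apply: (@max_principle R n Omega (t + 1) (fun t x => v t x - w t x)) => //.
- have sub : [set z : R * V | 0 <= z.1 <= t + 1 /\ closure Omega z.2] `<=` halfcyl.
    by move=> z [/andP[z0 _] cz].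
  have cv' := continuous_subspaceW sub cv; have cw' := continuous_subspaceW sub cw.
  by move=> z; apply: continuousB; [exact: cv'|exact: cw'].
- by move=> y cy; rewrite subr_le0 v0.
- by move=> s y /andP[s0 _] by_; rewrite subr_le0 vb.
- move=> s y /andP[s0 _] Oy _; have [a [g [H [a' [g' [H' [Jv Jw E]]]]]]] := J s y s0 Oy.
  exists (a - a'), (fun i => g i - g' i), (fun i => H i - H' i); split; first exact: jetB.
  move=> gE; have : a - \sum_i H i <= a' - \sum_i H' i.
    by apply: E => i; apply/eqP; rewrite -subr_eq0 gE.
  rewrite sumrB; lra.
- by rewrite t0/= lerDl.
Qed.

Lemma jet_cst (k : R) t x : jet (fun _ _ => k : R) t x 0 (fun=> 0) (fun=> 0 : R) (n := n).
Proof.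
split; first exact: dird_cst.
by move=> i; exists (fun=> 0); split=> //; [exists 1 => // s _|]; exact: dird_cst.
Qed.

Lemma jet_sqn (t : R) (x : V) : jet (fun _ => @sqn R n) t x 0 (fun i => 2 * x 0 i) (fun=> 2).
Proof.
split; first exact: dird_cst.
move=> i; exists (fun y => 2 * y 0 i); split=> //.
  exists 1 => // s _ e e0; exists e => // q qe; rewrite (sqn_delta (x + s *: ee i)).
  rewrite (_ : _ - _ = q * q); last by ring.
  by rewrite normrM ler_wpM2r// ltW.
move=> e e0; exists 1 => // s _; rewrite !mxE !eqxx/= !mulr1.
rewrite (_ : _ - _ = 0); last by ring.
by rewrite normr0 mulr_ge0// ltW.
Qed.

Lemma Ck2_jet (phi : V -> R) t x : Ck 2 Omega phi -> Omega x ->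
  jet (fun=> phi) t x 0 (fun i => partial i phi x) (fun i => partial i (partial i phi) x).
Proof.
move=> [dphi dd] Ox; split; first exact: dird_cst.
move=> i; have [r r0 Hr] := open_normP oO Ox; have [ddi _] := dd i.
exists (partial i phi); split=> //; last by apply: diff_dird; exact: ddi.
exists r => // s sr; apply: diff_dird; apply: dphi; apply: Hr.
by rewrite opprD addrA subrr sub0r normrN; exact: le_lt_trans (norm_scale_delta i s) sr.
Qed.

Lemma closure_bounded : exists2 D : R, 0 < D & forall x, closure Omega x -> `|x| < D.
Proof.
have [M [Mr HM]] := compact_bounded (compact_closure bO).
exists (`|M| + 2); first by rewrite ltr_wpDl.
move=> x cx; apply: (@le_lt_trans _ _ (`|M| + 1)); last by rewrite ltrD2l ltr1n.
by apply: HM => //; rewrite (le_lt_trans (ler_norm M))// ltrDl.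
Qed.

(** Elliptic maximum principle: for [lam <= 0] and [c] the sign of [phi x1], the function
    [c phi + e |x|^2] has an interior maximum at which its Laplacian [- lam c phi + 2 n e] is
    positive. *)
Lemma eigenvalue_gt0 lam : dirichlet_eigenvalue Omega lam -> 0 < lam.
Proof.
move=> [phi [[cphi phib] C2 [x1 Ox1 nx1] eqn]]; rewrite ltNge; apply/negP => lam0.
have [D D0 HD] := closure_bounded.
pose c : R := Num.sg (phi x1).
have cp : 0 < c * phi x1 by rewrite /c -normrEsg normr_gt0.
have nr : 0 < n%:R :> R by rewrite ltr0n.
(* The perturbation stays below half of [c * phi x1], so the maximum is not on the boundary and
   [c * phi] is positive there. *)
pose e : R := c * phi x1 / (2 * (n%:R * D ^+ 2)).
have nD : 0 < n%:R * D ^+ 2 by rewrite mulr_gt0// exprn_gt0.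
have e0 : 0 < e by rewrite divr_gt0// mulr_gt0.
have esq x : closure Omega x -> e * sqn x <= c * phi x1 / 2.
  move=> cx; apply: (@le_trans _ _ (e * (n%:R * D ^+ 2))).
    by rewrite ler_pM2l//; apply: sqn_le_norm; rewrite ltW// HD.
  by rewrite /e le_eqVlt; apply/orP; left; apply/eqP; field; rewrite !gt_eqF.
pose w (t : R) x := c * phi x - (- e) * sqn x.
have Jw x : Omega x -> jet w 0 x (c * 0 - (- e) * 0) (fun i => c * partial i phi x - (- e) * (2 * x 0 i))
    (fun i => c * partial i (partial i phi) x - (- e) * 2).
  by move=> Ox; apply: jetB; apply: jetZ; [exact: Ck2_jet|exact: jet_sqn].
have csq : continuous (@sqn R n).
  move=> x; apply: (cvg_ord_sum (F := nbhs x) (f := fun i (y : V) => y 0 i ^+ 2)) => i.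
  by rewrite expr2; under eq_fun do rewrite expr2; apply: cvgM; exact: coord_continuous.
have cw : {within closure Omega, continuous (w 0)}.
  suff : {within closure Omega, continuous (fun x => c * phi x - (- e) * sqn x)} by [].
  move=> x; have c1 : {for x, continuous (phi : subspace (closure Omega) -> R)} by exact: cphi.
  have c2 : {for x, continuous (@sqn R n : subspace (closure Omega) -> R)} by exact: (continuous_subspaceT csq).
  apply: (@continuousB R R^o (subspace (closure Omega)) (fun x => c * phi x) (fun x => - e * sqn x)).
    by apply: (@continuousM R (subspace (closure Omega)) (fun=> c) phi) => //; exact: cst_continuous.
  by apply: (@continuousM R (subspace (closure Omega)) (fun=> - e) sqn); [exact: cst_continuous|exact: c2].
have [|x /set_mem cx M] := compact_EVT_max _ (compact_closure bO) cw.
  by exists x1; exact: subset_closure.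
have Mx1 := M x1; rewrite inE in Mx1; have {}Mx1 := Mx1 (subset_closure Ox1).
have s1 : 0 <= e * sqn x1 by rewrite mulr_ge0 ?sqn_ge0// ltW.
have Ex := esq x cx.
have [Ox|bx] := closure_split oO cx; last first.
  by move: Mx1; rewrite /w (phib x bx) mulr0 !mulNr !opprK; lra.
have px : 0 < c * phi x by move: Mx1; rewrite /w !mulNr !opprK; lra.
have [r r0 Hr] := open_normP oO Ox.
have [||_ _ HH] := jet_max r0 _ _ (Jw x Ox).
- by [].
- move=> i s sr; apply: M; rewrite inE; apply: subset_closure; apply: Hr.
  by rewrite opprD addrA subrr sub0r normrN; exact: le_lt_trans (norm_scale_delta i s) sr.
have : \sum_i (c * partial i (partial i phi) x - - e * 2) <= 0 by exact: sumr_le0.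
rewrite sumrB sumr_const card_ord -mulr_sumr -/(laplacian phi x).
have -> : laplacian phi x = - (lam * phi x) by rewrite -eqn// opprK.
rewrite mulNr mulNrn opprK mulrN -mulr_natr => H1.
have H2 : 0 <= - lam * (c * phi x) by rewrite mulr_ge0 ?oppr_ge0// ltW.
have H3 : 0 < e * 2 * n%:R by apply: mulr_gt0 => //; exact: mulr_gt0.
by move: H1 H2; rewrite mulrCA mulNr; lra.
Qed.

End Comparison.

(** * Data of class [C^1] and their extension by zero *)

Section C1Data.
Context {R : realType} {n : nat}.
Local Notation V := 'rV[R]_n.
Local Notation ee i := (delta_mx 0 i : V).
Hypothesis hn : (0 < n)%N.
Variable Omega : set V.
Hypotheses (oO : open Omega) (bO : bounded_set Omega).

Lemma within_comp (T : topologicalType) (A : set T) (g : T -> R) (phi : R -> R) : continuous phi ->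
  {within A, continuous g} -> {within A, continuous (fun x => phi (g x))}.
Proof. by move=> cphi cg; apply: within_continuous_comp cg => y _; exact: cphi. Qed.

Lemma dird_continuous (phi phi1 : R -> R) : (forall s, dird phi s 1 (phi1 s)) -> continuous phi.
Proof.
move=> H s; have [d _] := dird_is (H s).
by apply: differentiable_continuous; apply/derivable1_diffP.
Qed.

Lemma C1_closure_comp (g : V -> R) (phi phi1 phi2 : R -> R) :
  (forall s, dird phi s 1 (phi1 s)) -> (forall s, dird phi1 s 1 (phi2 s)) ->
  C1_closure Omega g -> C1_closure Omega (fun x => phi (g x)).
Proof.
move=> D1 D2 [cg [dg pg] eg].
have c0 := dird_continuous D1; have c1 := dird_continuous D2.
have pE x i : Omega x -> partial i (fun x => phi (g x)) x = phi1 (g x) * partial i g x.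
  by move=> Ox; have [_ E] := dird_is (dird_chain (diff_dird (ee i) (dg x Ox)) (D1 (g x))).
split; first exact: within_comp.
- split.
    move=> x Ox; apply: (@differentiable_comp _ _ _ _ g phi); first exact: dg.
    by apply/derivable1_diffP; have [] := dird_is (D1 (g x)).
  move=> i x Ox; have [r r0 Hr] := open_normP oO Ox.
  have cH : {for x, continuous (fun y => phi1 (g y) * partial i g y)}.
    apply: continuousM; last exact: pg.
    by apply: continuous_comp; [exact: differentiable_continuous (dg x Ox)|exact: c1].
  apply/contP => e e0; have [q q0 Hq] := (contP _ _).1 cH e e0.
  exists (Num.min r q) => [|y]; first by rewrite lt_min r0.
  by rewrite lt_min => /andP[yr yq]; rewrite (pE x i Ox) (pE y i (Hr y yr)); exact: Hq.
- move=> i; have [g' [cg' Eg]] := eg i.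
  exists (fun x => phi1 (g x) * g' x); split; last by move=> x Ox; rewrite Eg// pE.
  have cc := within_comp c1 cg.
  by move=> x; apply: (@continuousM R (subspace (closure Omega)) (fun x => phi1 (g x)) g'); [exact: cc|exact: cg'].
Qed.

Definition extend0 (g : V -> R) (x : V) : R := if `[< Omega x >] then g x else 0.

Lemma extend0_in g x : Omega x -> extend0 g x = g x.
Proof. by move=> Ox; rewrite /extend0 asboolT. Qed.

Lemma extend0_out g x : ~ Omega x -> extend0 g x = 0.
Proof. by move=> Ox; rewrite /extend0 asboolF. Qed.

Lemma extend0_closure g x : C0_closure Omega g -> closure Omega x -> extend0 g x = g x.
Proof.
move=> [_ gb] cx; have [Ox|bx] := closure_split oO cx; first exact: extend0_in.
by rewrite extend0_out ?gb//; exact: bdry_out.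
Qed.

Lemma C1_closure_partial g : C1_closure Omega g ->
  exists2 B : R, 0 <= B & forall i x, Omega x -> `|partial i g x| <= B.
Proof.
move=> [_ _ eg].
have /boolp.choice[B HB] : forall i, exists B : R, 0 <= B /\ forall x, Omega x -> `|partial i g x| <= B.
  move=> i; have [g' [cg' Eg]] := eg i.
  have [M [Mr HM]] := compact_bounded (continuous_compact cg' (compact_closure bO)).
  exists (`|M| + 1); split; first by rewrite addr_ge0.
  move=> x Ox; rewrite -Eg//; apply: (HM (`|M| + 1)).
    by rewrite (le_lt_trans (ler_norm M))// ltrDl.
  by exists x => //; exact: subset_closure.
exists (\sum_i B i); first by apply: sumr_ge0 => i _; case: (HB i).
move=> i x Ox; have [_ H] := HB i; apply: (le_trans (H x Ox)).
by apply: le_sum_term => j; case: (HB j).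
Qed.

(** The derivative bound holds only inside [Omega], so the mean value theorem is applied up to a
    point [y] just before the exit, where continuity up to the boundary makes [g] small. *)
Lemma extend0_exit g B x z : C0_closure Omega g -> Ck 1 Omega g -> 0 <= B ->
  (forall i x, Omega x -> `|partial i g x| <= B) -> Omega x -> ~ Omega z ->
  `|g x| <= n%:R * B * `|x - z|.
Proof.
move=> [cg gb] [dg _] B0 HB Ox nz.
have [c /andP[c0 c1] [bw inO]] := exit_point oO Ox nz.
set w := x + c *: (z - x) in bw.
have cp : 0 < c.
  rewrite lt_neqAle c0 andbT; apply/eqP => cE; apply: (bdry_out oO bw).
  by rewrite /w -cE scale0r addr0.
apply/ler_addgt0Pr => e e0.
have [r r0 Hr] := (within_contP _ _).1 cg w bw.1 e e0.
have zx1 : 0 < `|z - x| + 1 by rewrite ltr_wpDl.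
pose c' := Num.max 0 (c - r / (`|z - x| + 1) / 2).
have dp : 0 < r / (`|z - x| + 1) / 2 by rewrite !divr_gt0.
have c'0 : 0 <= c' by rewrite le_max lexx.
have c'c : c' < c by rewrite gt_max cp ltrBlDr ltrDl.
have cc' : c - c' <= r / (`|z - x| + 1) / 2.
  by rewrite lerBlDr -lerBlDl le_max lexx orbT.
set y := x + c' *: (z - x).
have Oy : Omega y by apply: inO; rewrite c'0.
have wy : `|w - y| < r.
  rewrite /w /y opprD addrACA subrr add0r -scalerBl normrZ ger0_norm ?subr_ge0 ?ltW//.
  apply: (@le_lt_trans _ _ (r / (`|z - x| + 1) / 2 * (`|z - x| + 1))).
    by rewrite ler_pM ?subr_ge0 ?(ltW c'c)// lerDl.
  by rewrite mulrAC divfK ?gt_eqF// ltr_pdivrMr// ltr_pMr// ltr1n.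
have gy := Hr y (subset_closure Oy) wy.
rewrite gb// sub0r normrN in gy.
have yE : y - x = c' *: (z - x) by rewrite /y addrC addKr.
have [s /andP[s0 s1]|q /andP[q0 q1] E] := @segment_MVT R n g x y.
  apply: dg; rewrite yE scalerA; apply: inO.
  by rewrite mulr_ge0//= (le_lt_trans _ c'c)// ler_piMl.
have yx : `|y - x| <= `|x - z|.
  rewrite yE normrZ ger0_norm// distrC ler_piMl//.
  by rewrite (le_trans (ltW c'c)).
have gyx : `|g y - g x| <= n%:R * B * `|x - z|.
  rewrite E (le_trans (ler_norm_sum _ _ _))//.
  have -> : n%:R * B * `|x - z| = \sum_(i < n) B * `|x - z|.
    by rewrite sumr_const card_ord -[RHS]mulr_natl mulrA.
  apply: ler_sum => i _; rewrite normrM mulrC ler_pM//.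
    apply: HB; rewrite yE scalerA; apply: inO.
    by rewrite mulr_ge0 ?(ltW q0)//= (le_lt_trans _ c'c)// ler_piMl// ltW.
  exact: le_trans (coord_le_norm _ _) yx.
rewrite (_ : g x = g y - (g y - g x)); last by ring.
by rewrite (le_trans (ler_normB _ _))// addrC lerD// ltW.
Qed.

(** [Omega] need not be convex: a segment that leaves it contains a point outside, and both end
    values are bounded by their distances to that point. *)
Lemma extend0_lipschitz g : C0_closure Omega g -> C1_closure Omega g ->
  exists2 L : R, 0 <= L & forall x y, `|extend0 g x - extend0 g y| <= L * `|x - y|.
Proof.
move=> C0 C1; have [B B0 HB] := C1_closure_partial C1; have [_ Ck1 _] := C1.
pose L := n%:R * B; have L0 : 0 <= L by rewrite mulr_ge0.
have out x y : Omega x -> ~ Omega y -> `|g x| <= L * `|x - y| by exact: extend0_exit.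
exists (2 * L); first by rewrite mulr_ge0.
have LL (x y : V) : L * `|x - y| <= 2 * L * `|x - y|.
  by rewrite ler_wpM2r// mulrDl mul1r lerDl.
move=> x y; have [Ox|nx] := pselect (Omega x); have [Oy|ny] := pselect (Omega y); last first.
- by rewrite !extend0_out// subrr normr0 mulr_ge0// mulr_ge0.
- rewrite extend0_out// extend0_in// sub0r normrN distrC.
  by apply: le_trans (LL y x); exact: out.
- by rewrite extend0_in// extend0_out// subr0; apply: le_trans (LL x y); exact: out.
rewrite !extend0_in//.
have [H|] := pselect (forall s : R, 0 <= s <= 1 -> Omega (x + s *: (y - x))).
  have [s s01|c /andP[c0 c1] E] := @segment_MVT R n g x y.
    by case: Ck1 => dg _; apply: dg; exact: H.
  apply: le_trans (LL x y); rewrite distrC E (le_trans (ler_norm_sum _ _ _))//.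
  have -> : L * `|x - y| = \sum_(i < n) B * `|x - y|.
    by rewrite sumr_const card_ord -[RHS]mulr_natl mulrA.
  apply: ler_sum => i _; rewrite normrM mulrC ler_pM//.
    by apply: HB; apply: H; rewrite !ltW.
  by rewrite distrC; exact: coord_le_norm.
move=> /existsNP[s /not_implyP[/andP[s0 s1] nz]].
rewrite (le_trans (ler_normB _ _))// mulrDl mul1r mulrDl; apply: lerD.
  apply: (le_trans (out _ _ Ox nz)); rewrite ler_wpM2l//.
  rewrite opprD addrA subrr sub0r normrN normrZ ger0_norm// [`|y - x|]distrC.
  by rewrite ler_piMl.
apply: (le_trans (out _ _ Oy nz)); rewrite ler_wpM2l//.
rewrite (_ : y - _ = (1 - s) *: (y - x)); last by apply/rowP => j; rewrite !mxE; ring.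
rewrite normrZ ger0_norm ?subr_ge0// [`|y - x|]distrC ler_piMl//; lra.
Qed.

End C1Data.

(** * Existence and decay of heat flows for [C^1] data *)

Section HeatBounds.
Context {R : realType} {n : nat}.
Local Notation V := 'rV[R]_n.
Local Notation ee i := (delta_mx 0 i : V).
Hypothesis hn : (0 < n)%N.
Variable Omega : set V.
Hypotheses (oO : open Omega) (bO : bounded_set Omega) (C3 : C3_boundary Omega).

Lemma limit_filter : exists F : set_system nat,
  [/\ ProperFilter F, bounded_cvg (R := R) F & \oo `<=` F].
Proof.
have [F [UF oF]] := ultraFilterLemma (eventually_filter : ProperFilter \oo).
by exists F; split=> //; [exact: ultra_proper|exact: ultra_bounded_cvg].
Qed.

Lemma heat_exists g : C0plus_closure Omega g -> C1_closure Omega g ->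
  exists u, heat_solution Omega g u.
Proof.
move=> [C0 g0] C1; have [F [PF bF oF]] := limit_filter.
have [r r0 ext] := C3_exterior_ball oO bO C3.
have [L L0 HL] := extend0_lipschitz oO bO C0 C1.
have e0 x : 0 <= extend0 Omega g x.
  rewrite /extend0; case: asboolP => // Ox; apply: g0; exact: subset_closure.
have [A1 A2 A3 A4 A5] := heat_lim_solution hn oO bO r0 ext e0 (@extend0_out R n Omega g) L0 HL bF oF.
exists (heat_lim Omega (extend0 Omega g) F); split=> // x cx.
by rewrite A5// extend0_closure.
Qed.

(** [xget] returns a solution as soon as one exists, and the comparisons below apply to whichever is
    chosen. *)
Lemma heat_semigroup_solution g : C0plus_closure Omega g -> C1_closure Omega g ->
  heat_solution Omega g (fun t => heat_semigroup Omega t g).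
Proof.
move=> C0 C1; have := heat_exists C0 C1.
exact: (@xgetPex _ (fun _ _ => 0) [set u | heat_solution Omega g u]).
Qed.

Lemma heat_upper lam g : first_dirichlet_eigenvalue Omega lam ->
  C0plus_closure Omega g -> C1_closure Omega g ->
  exists f U C, [/\ heat_solution Omega f U, forall x, closure Omega x -> g x <= f x, 0 < C &
    [/\ forall t x, 0 <= t -> U t x <= C * expR (- (lam * t)),
        forall t x w, 0 <= t -> ~ Omega w -> U t x <= C * `|x - w| &
        forall t x w, 1 <= t -> ~ Omega w -> U t x <= C * expR (- (lam * t)) * `|x - w|]].
Proof.
move=> [[phi [_ _ [x0 Ox0 _] _]] lmin] [C0 g0] C1; have [F [PF bF oF]] := limit_filter.
have [r r0 ext] := C3_exterior_ball oO bO C3.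
have [L L0 HL] := extend0_lipschitz oO bO C0 C1.
have e0 x : 0 <= extend0 Omega g x.
  rewrite /extend0; case: asboolP => // Ox; apply: g0; exact: subset_closure.
have [d d0 Hd] := open_normP oO Ox0.
(* A small cone inside [Omega] makes the datum positive somewhere even if [g] vanishes identically;
   normalising the iterates requires this. Enlarging the datum is harmless, as [U] only serves as a
   majorant. *)
pose bump (x : V) := Num.max 0 (d - `|x0 - x|).
have b0 x : 0 <= bump x by rewrite le_max lexx.
have bO' x : ~ Omega x -> bump x = 0.
  move=> nx; apply/max_idPl; rewrite subr_le0 leNgt; apply/negP => H; apply: nx; exact: Hd.
have bL x y : `|bump x - bump y| <= `|x - y|.
  have le1 x' y' : bump x' - bump y' <= `|x' - y'|.
    rewrite lerBlDr ge_max addr_ge0//= (le_trans _ (lerD (lexx _) _ : `|x' - y'| + (d - `|x0 - y'|) <= _))//.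
      have := ler_normD (x0 - x') (x' - y'); rewrite addrA subrK; lra.
    by rewrite le_max lexx orbT.
  by rewrite ler_norml le1 andbT lerNl opprB distrC.
pose f x := extend0 Omega g x + bump x.
have f0 x : 0 <= f x by rewrite addr_ge0.
have fO x : ~ Omega x -> f x = 0 by move=> nx; rewrite /f extend0_out// bO'// addr0.
have L10 : 0 <= L + 1 by rewrite addr_ge0.
have fL x y : `|f x - f y| <= (L + 1) * `|x - y|.
  rewrite /f opprD addrACA mulrDl mul1r (le_trans (ler_normD _ _))// lerD//.
have fx0 : 0 < f x0.
  by rewrite /f ltr_wpDl// lt_max subrr normr0 subr0 d0 orbT.
have hs := heat_lim_solution hn oO bO r0 ext f0 fO L10 fL bF oF.
have [C1' C1'0 H1] := heat_lim_bdry hn oO bO r0 ext f0 fO L10 fL bF oF.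
have [mu [C2 [emu C20 H2 H3]]] := heat_decay hn oO bO r0 ext f0 fO L10 fL fx0 bF oF.
have lmu := lmin mu emu.
have exple t : 0 <= t -> expR (- (mu * t)) <= expR (- (lam * t)).
  by move=> t0; rewrite ler_expR lerN2 ler_wpM2r.
exists f, (heat_lim Omega f F), (C1' + C2); split; [exact: hs| |exact: addr_gt0|split].
- by move=> x cx; rewrite /f extend0_closure// lerDl.
- move=> t x t0; apply: (le_trans (H2 t x t0)); apply: ler_pM; [exact: ltW|exact: expR_ge0| |exact: exple].
  by rewrite lerDr ltW.
- move=> t x w t0 nw; apply: (le_trans (H1 t x w t0 nw)); rewrite ler_wpM2r// lerDl; exact: ltW.
- move=> t x w t1 nw; apply: (le_trans (H3 t x w t1 nw)); rewrite ler_wpM2r//.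
  apply: ler_pM; [exact: ltW|exact: expR_ge0| |apply: exple; exact: le_trans t1].
  by rewrite lerDr ltW.
Qed.

End HeatBounds.

(** * From doubling to gradient bounds *)

Section GradientBounds.
Context {R : realType} {n : nat}.
Local Notation V := 'rV[R]_n.
Local Notation ee i := (delta_mx 0 i : V).
Hypothesis hn : (0 < n)%N.
Variable Omega : set V.
Hypotheses (oO : open Omega) (bO : bounded_set Omega).

Lemma enorm_sqr (v : V) : enorm v ^+ 2 = \sum_i v 0 i ^+ 2.
Proof. by rewrite sqr_sqrtr//; apply: sumr_ge0 => i _; exact: sqr_ge0. Qed.

Lemma enorm_le (v : V) B : 0 <= B -> (forall i, `|v 0 i| <= B) -> enorm v <= n%:R * B.
Proof.
move=> B0 H; have nB : 0 <= n%:R * B by rewrite mulr_ge0.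
rewrite -(@ler_pXn2r _ 2)// ?nnegrE ?sqrtr_ge0// enorm_sqr.
apply: (@le_trans _ _ (\sum_(i < n) B ^+ 2)).
  apply: ler_sum => i _; rewrite -[leLHS]real_normK ?num_real// lerXn2r// nnegrE//.
rewrite sumr_const card_ord -[_ *+ n]mulr_natl exprMn ler_wpM2r ?sqr_ge0//.
by rewrite expr2 ler_peMl// ler1n.
Qed.

Lemma symmetric_difference_bound (f : V -> R) x v (d c A r : R) : 0 < r ->
  dird f x v d -> c = 1 \/ c = -1 ->
  (forall s, 0 < s < r -> c * (f (x + s *: v) - f (x - s *: v)) <= 2 * A * s) -> c * d <= A.
Proof.
move=> r0 D c1 H; rewrite leNgt; apply/negP => Ad.
pose e := (c * d - A) / 2; have e0 : 0 < e by rewrite divr_gt0// subr_gt0.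
have [q q0 Hq] := D e e0; pose s : R := Num.min r q / 2.
have m0 : 0 < Num.min r q by rewrite lt_min r0.
have s0 : 0 < s by rewrite divr_gt0.
have sm : s < Num.min r q by rewrite /s; lra.
move: sm; rewrite lt_min => /andP[sr sq].
have sn : `|s| < q by rewrite gtr0_norm.
have sn' : `|- s| < q by rewrite normrN.
have := Hq s sn; have := Hq (- s) sn'; rewrite normrN (gtr0_norm s0) scaleNr.
have := H s; rewrite s0 sr => /(_ isT).
move: (f (x + s *: v)) (f (x - s *: v)) (f x) => p m f0 H1.
rewrite !ler_norml => /andP[a1 a2] /andP[b1 b2].
have eE : 2 * e = c * d - A by rewrite /e; field.
have es : 0 < e * s by rewrite mulr_gt0.
have E2 : 2 * e * s = (c * d - A) * s by rewrite eE.
case: c1 => cE; rewrite cE in H1 E2; lra.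
Qed.

(** Doubling with both signs and in every direction bounds symmetric differences by
    [K s (2 D - s) <= 2 K D s], hence each partial derivative by [K D]. *)
Lemma gradient_doubling (F : V -> R) u0 u (t0 t1 K D m : R) :
  classical_solution Omega F u0 u -> 0 <= t0 -> t0 < t1 -> 0 <= m -> m < 2 * K ->
  (forall x, closure Omega x -> `|x| < D) ->
  (forall t x, t0 <= t <= t1 -> closure Omega x -> 0 <= u t x) ->
  (forall t x z, t0 < t <= t1 -> closure Omega x -> bdry Omega z ->
     u t x <= K * D / 2 * `|x - z|) ->
  (forall x y, closure Omega x -> closure Omega y ->
     u t0 x - u t0 y <= K * D / 2 * `|x - y| + m * (t1 - t0)) ->
  forall x, Omega x -> enorm (grad (u t1) x) <= n%:R * (K * D).
Proof.
move=> us t00 t01 m0 mK hD hpos hb h0 x Ox; have K0 : 0 < K by lra.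
have D0 : 0 < D by apply: le_lt_trans (hD x (subset_closure Ox)).
have KD0 : 0 < K * D / 2 by rewrite divr_gt0// mulr_gt0.
have t10 : 0 < t1 by exact: le_lt_trans t01.
apply: enorm_le => [|i]; first by rewrite mulr_ge0// ltW.
rewrite mxE; have [_ C2 _ _ _] := us; have [du _ _ _ _] := C2.
have [_ dx _] := du t1 x (conj t10 Ox).
have [r r0 Hr] := open_normP oO Ox.
have inO s : `|s| < r -> closure Omega (x + s *: ee i).
  move=> sr; apply: subset_closure; apply: Hr; rewrite opprD addrA subrr sub0r normrN.
  exact: le_lt_trans (norm_scale_delta i s) sr.
have main c : c = 1 \/ c = -1 -> c * partial i (u t1) x <= K * D.
  move=> c1; apply: (symmetric_difference_bound r0 (diff_dird (ee i) dx) c1) => s /andP[s0 sr].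
  have sn : `|s| < r by rewrite gtr0_norm.
  have sn' : `|- s| < r by rewrite normrN.
  have I1 := inO _ sn; have I2 := inO _ sn'; rewrite scaleNr in I2.
  have := @doubling R n Omega F u0 u i t0 t1 K D m c oO bO us t00 t01 m0 mK c1 hD hpos.
  move=> DD; apply: (@le_trans _ _ (K * (s * (2 * D - s)))); last first.
    rewrite [leRHS](_ : _ = K * (s * (2 * D))); last by ring.
    by rewrite ler_pM2l// ler_pM2l// gerBl ltW.
  apply: DD; [| |exact: ltW|exact: I1|exact: I2].
    move=> t y z q tt cy bz q0 yz; apply: (le_trans (hb t y z tt cy bz)).
    rewrite ler_pM2l//; have E : y - z = q *: ee i \/ y - z = (- q) *: ee i.
      by case: yz => ->; [left|right]; rewrite addrC addKr// scaleNr.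
    by case: E => ->; rewrite (le_trans (norm_scale_delta i _))// ?normrN ger0_norm.
  move=> y q q0 H1 H2.
  have dq : `|(y + q *: ee i) - (y - q *: ee i)| <= 2 * q.
    rewrite (_ : _ - _ = (2 * q) *: ee i); last by apply/rowP => j; rewrite !mxE; ring.
    by rewrite (le_trans (norm_scale_delta i _))// ger0_norm// mulr_ge0.
  have qD : q <= D.
    have := hD _ H1; have := hD _ H2.
    have := coord_le_norm (y + q *: ee i) i; have := coord_le_norm (y - q *: ee i) i.
    rewrite !mxE !eqxx !mulr1 !ler_norml => /andP[_ A1] /andP[_ A2] A3 A4.
    have := coord_le_norm (y - q *: ee i) i; rewrite !mxE !eqxx !mulr1 ler_norml => /andP[A5 _].
    lra.
  have HH : K * D / 2 * `|(y + q *: ee i) - (y - q *: ee i)| <= K * (q * (2 * D - q)).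
    apply: (@le_trans _ _ (K * D / 2 * (2 * q))); first by rewrite ler_pM2l.
    rewrite [leLHS](_ : _ = K * (q * D)); last by field.
    by rewrite ler_pM2l// ler_wpM2l//; lra.
  case: c1 => ->; rewrite ?mul1r ?mulN1r ?opprB.
    by apply: (le_trans (h0 _ _ H1 H2)); rewrite lerD2r.
  by apply: (le_trans (h0 _ _ H2 H1)); rewrite lerD2r distrC.
rewrite ler_norml; apply/andP; split.
  by have := main (-1) (or_intror erefl); rewrite mulN1r lerNl.
by have := main 1 (or_introl erefl); rewrite mul1r.
Qed.

End GradientBounds.

Section ExponentialTransform.
Context {R : realType}.
Implicit Types (c s : R).

(** Dividing by [c] makes the derivative [e^(c s)], so for either sign of [c] the transform is
    increasing, vanishes at [0] and has slope one there. *)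
Definition cexp c s : R := (expR (c * s) - 1) / c.

Lemma cexp0 c : cexp c 0 = 0.
Proof. by rewrite /cexp mulr0 expR0 subrr mul0r. Qed.

Lemma cexp_dird2 c s : dird (fun s : R => expR (c * s)) s 1 (c * expR (c * s)).
Proof.
have I : dird (fun s : R => s) s 1 1 by apply/dirdP; exact: is_derive_id.
have De : dird expR (c * s) 1 (expR (c * s)) by apply/dirdP; exact: is_derive_expR.
have := dird_chain (f := fun s : R => c * s) (dirdZ c I) De.
by rewrite mulr1 mulrC.
Qed.

Lemma cexp_dird c : c != 0 -> forall s, dird (cexp c) s 1 (expR (c * s)).
Proof.
move=> c0 s; have := dirdZ c^-1 (dirdB (cexp_dird2 c s) (dird_cst (1 : R) s (1 : R))).
rewrite subr0 mulrA mulVf// mul1r; apply: dird_eq; exists 1 => // t _.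
by rewrite /cexp mulrC.
Qed.

Lemma cexp_ge c s : 0 < c -> s <= cexp c s.
Proof.
by move=> c0; rewrite /cexp ler_pdivlMr// mulrC lerBrDl expR_ge1Dx.
Qed.

Lemma cexp_le c s : c < 0 -> cexp c s <= s.
Proof.
by move=> c0; rewrite /cexp ler_ndivrMr// mulrC lerBrDl expR_ge1Dx.
Qed.

Lemma cexp_ge0 c s : c != 0 -> 0 <= s -> 0 <= cexp c s.
Proof.
rewrite neq_lt => /orP[c0|c0] s0; last exact: le_trans (cexp_ge s c0).
rewrite /cexp ler_ndivlMr// mul0r subr_le0 -expR0 ler_expR.
by rewrite mulr_le0_ge0// ltW.
Qed.

Lemma cexp_neq0 c s : c != 0 -> s != 0 -> cexp c s != 0.
Proof.
move=> c0 s0; rewrite /cexp mulf_neq0 ?invr_eq0// subr_eq0 -expR0.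
by apply/eqP => /expR_inj/eqP; rewrite mulf_eq0 (negbTE c0) (negbTE s0).
Qed.

End ExponentialTransform.

(** * The viscous Hamilton-Jacobi equation *)

Section HamiltonJacobi.
Context {R : realType} {n : nat}.
Local Notation V := 'rV[R]_n.
Local Notation ee i := (delta_mx 0 i : V).
Hypothesis hn : (0 < n)%N.
Variables (Omega : set V) (p a : R) (u0 : V -> R) (u : R -> V -> R).
Hypotheses (oO : open Omega) (bO : bounded_set Omega) (hp : 2 < p).
Hypothesis us : vhj_solution Omega a p u0 u.

Lemma solution_jet (F : V -> R) f v t x : classical_solution Omega F f v -> 0 < t -> Omega x ->
  exists d g H, [/\ jet v t x d g H, grad (v t) x = \row_i g i &
    d - \sum_i H i = F (\row_i g i)].
Proof.
move=> [_ C2 eqn _ _] t0 Ox; have J := C12_jet oO C2 t0 Ox.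
by do 3 eexists; split; [exact: J|by []|exact: eqn].
Qed.

Lemma enorm_row_sqr (g : 'I_n -> R) : enorm (\row_i g i) ^+ 2 = \sum_i g i ^+ 2.
Proof. by rewrite enorm_sqr; apply: eq_bigr => i _; rewrite mxE. Qed.

(** Here [p > 2] enters: under a gradient bound [M] the nonlinearity is dominated by the quadratic
    one that the exponential removes. *)
Lemma powR_quadratic (q M : R) : 0 <= q <= M -> q `^ p <= M `^ (p - 2) * q ^+ 2.
Proof.
move=> /andP[q0 qM]; have p2 : 0 <= p - 2 by rewrite subr_ge0 ltW.
have -> : q `^ p = q `^ (p - 2) * q `^ 2.
  rewrite -powRD ?subrK//; apply/implyP => /eqP H; move: hp; rewrite H; lra.
rewrite (powR_mulrn 2 q0); apply: ler_wpM2r; first exact: sqr_ge0.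
by apply: ge0_ler_powR => //; rewrite nnegrE// (le_trans q0).
Qed.

Lemma solution_ge0 : (forall x, closure Omega x -> 0 <= u0 x) ->
  forall t x, 0 <= t -> closure Omega x -> 0 <= u t x.
Proof.
move=> u00; have [cu C2 eqn ub ui] := us.
apply: (@comparison R n Omega oO bO (fun _ _ => 0) u) => //.
- by move=> z; exact: cst_continuous.
- by move=> x cx; rewrite ui// u00.
- by move=> t x t0 bx; rewrite ub.
move=> t x t0 Ox; have [d [g [H [J _ E]]]] := solution_jet us t0 Ox.
exists 0, (fun=> 0), (fun=> 0), d, g, H; split=> //; first exact: jet_cst.
move=> g0; rewrite E big1// subr0.
have -> : enorm (\row_i g i) = 0.
  by rewrite /enorm big1 ?sqrtr0// => i _; rewrite mxE -g0 expr0n.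
rewrite powR0 ?mulr0//; apply/eqP => p0; move: hp; rewrite p0; lra.
Qed.

Lemma heat_compare_below f U : 0 <= a -> heat_solution Omega f U ->
  (forall x, closure Omega x -> f x <= u0 x) ->
  forall t x, 0 <= t -> closure Omega x -> U t x <= u t x.
Proof.
move=> a0 hs fu; have [cu C2 eqn ub ui] := us; have [cU CU2 eqnU Ub Ui] := hs.
apply: comparison => //.
- by move=> x cx; rewrite ui// Ui// fu.
- by move=> t x t0 bx; rewrite ub// Ub.
move=> t x t0 Ox; have [d [g [H [J _ E]]]] := solution_jet us t0 Ox.
have [d' [g' [H' [J' _ E']]]] := solution_jet hs t0 Ox.
exists d', g', H', d, g, H; split=> // _.
by rewrite E E' mulr_ge0// powR_ge0.
Qed.

Lemma heat_compare_above f U : a <= 0 -> heat_solution Omega f U ->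
  (forall x, closure Omega x -> u0 x <= f x) ->
  forall t x, 0 <= t -> closure Omega x -> u t x <= U t x.
Proof.
move=> a0 hs fu; have [cu C2 eqn ub ui] := us; have [cU CU2 eqnU Ub Ui] := hs.
apply: comparison => //.
- by move=> x cx; rewrite ui// Ui// fu.
- by move=> t x t0 bx; rewrite ub// Ub.
move=> t x t0 Ox; have [d [g [H [J _ E]]]] := solution_jet us t0 Ox.
have [d' [g' [H' [J' _ E']]]] := solution_jet hs t0 Ox.
exists d, g, H, d', g', H'; split=> // _.
by rewrite E E' mulr_le0_ge0// powR_ge0.
Qed.

Lemma transform_jet c M t x : c = a * M `^ (p - 2) -> c != 0 ->
  (forall t x, 0 < t -> Omega x -> enorm (grad (u t) x) <= M) -> 0 < t -> Omega x ->
  exists d g H, [/\ jet (fun t x => cexp c (u t x)) t x d g H,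
    0 <= a -> d - \sum_i H i <= 0 & a <= 0 -> 0 <= d - \sum_i H i].
Proof.
move=> cE c0 HM t0 Ox; have [d [g [H [J gE E]]]] := solution_jet us t0 Ox.
have J2 := jet_comp (cexp_dird c0) (cexp_dird2 c _) J.
set e := expR (c * u t x) in J2; have e0 : 0 < e by exact: expR_gt0.
exists (e * d), (fun i => e * g i), (fun i => e * H i + c * e * g i ^+ 2).
(* The residual of the transformed function in the heat equation: [a |g|^p] against the quadratic
   term produced by the second derivative of [cexp]. By [powR_quadratic] its sign is opposite to
   that of [a]. *)
have -> : e * d - \sum_i (e * H i + c * e * g i ^+ 2) =
    a * (e * (enorm (\row_i g i) `^ p - M `^ (p - 2) * enorm (\row_i g i) ^+ 2)).
  rewrite big_split/= -!mulr_sumr -enorm_row_sqr.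
  rewrite [LHS](_ : _ = e * (d - \sum_i H i) - c * e * enorm (\row_i g i) ^+ 2); last by ring.
  by rewrite E cE; ring.
have q0 : 0 <= enorm (\row_i g i) <= M by rewrite -gE HM// andbT sqrtr_ge0.
have P : e * (enorm (\row_i g i) `^ p - M `^ (p - 2) * enorm (\row_i g i) ^+ 2) <= 0.
  by rewrite pmulr_rle0// subr_le0 powR_quadratic.
by split=> // a0; [rewrite mulr_ge0_le0|rewrite mulr_le0].
Qed.

Lemma transform_continuous c :
  {within [set z : R * V | 0 <= z.1 /\ closure Omega z.2],
    continuous (fun z : R * V => cexp c (u z.1 z.2))}.
Proof.
have [cu _ _ _ _] := us; apply: (within_comp (phi := cexp c)) cu.
have [->|c0] := eqVneq c 0.
  by move=> s; rewrite /cexp invr0; under eq_fun do rewrite mulr0; exact: cst_continuous.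
exact: (dird_continuous (cexp_dird c0)).
Qed.

Lemma heat_compare_exp_above c M f U : c = a * M `^ (p - 2) -> 0 < a -> 0 < c ->
  (forall t x, 0 < t -> Omega x -> enorm (grad (u t) x) <= M) -> heat_solution Omega f U ->
  (forall x, closure Omega x -> cexp c (u0 x) <= f x) ->
  forall t x, 0 <= t -> closure Omega x -> u t x <= U t x.
Proof.
move=> cE a0 c0 HM hs fu t x t0 cx; apply: (le_trans (cexp_ge _ c0)).
have [cu C2 eqn ub ui] := us; have [cU CU2 eqnU Ub Ui] := hs.
apply: (@comparison R n Omega oO bO (fun t x => cexp c (u t x)) U) => //.
- exact: transform_continuous.
- by move=> y cy; rewrite ui// Ui// fu.
- by move=> s y s0 by_; rewrite ub// Ub// cexp0.
move=> s y s0 Oy; have [|d [g [H [J E _]]]] := transform_jet cE _ HM s0 Oy.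
  by rewrite gt_eqF.
have [d' [g' [H' [J' _ E']]]] := solution_jet hs s0 Oy.
exists d, g, H, d', g', H'; split=> // _.
by rewrite E' E// ltW.
Qed.

Lemma heat_compare_exp_below c M f U : c = a * M `^ (p - 2) -> a < 0 -> c < 0 ->
  (forall t x, 0 < t -> Omega x -> enorm (grad (u t) x) <= M) -> heat_solution Omega f U ->
  (forall x, closure Omega x -> f x <= cexp c (u0 x)) ->
  forall t x, 0 <= t -> closure Omega x -> U t x <= u t x.
Proof.
move=> cE a0 c0 HM hs fu t x t0 cx; apply: le_trans (cexp_le _ c0).
have [cu C2 eqn ub ui] := us; have [cU CU2 eqnU Ub Ui] := hs.
apply: (@comparison R n Omega oO bO U (fun t x => cexp c (u t x))) => //.
- exact: transform_continuous.
- by move=> y cy; rewrite ui// Ui// fu.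
- by move=> s y s0 by_; rewrite ub// Ub// cexp0.
move=> s y s0 Oy; have [|d [g [H [J _ E]]]] := transform_jet cE _ HM s0 Oy.
  by rewrite lt_eqF.
have [d' [g' [H' [J' _ E']]]] := solution_jet hs s0 Oy.
exists d', g', H', d, g, H; split=> // _.
by rewrite E' E// ltW.
Qed.

End HamiltonJacobi.

(** * Boundedness and decay of the gradient of the solution *)

Section MainEstimates.
Context {R : realType} {n : nat}.
Local Notation V := 'rV[R]_n.
Hypothesis hn : (0 < n)%N.
Variables (Omega : set V) (p a lam : R) (u0 : V -> R).
Hypotheses (oO : open Omega) (bO : bounded_set Omega) (C3 : C3_boundary Omega) (hp : 2 < p).
Hypothesis first : first_dirichlet_eigenvalue Omega lam.
Hypotheses (hC0 : C0plus_closure Omega u0) (hC1 : C1_closure Omega u0).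

Let lam0 : 0 < lam. Proof. by apply: (eigenvalue_gt0 hn oO bO); case: first. Qed.

(** A heat flow lies above [u], so its linear growth from the boundary bounds [u] there at all
    times. The doubling starts at time [0], with no slack since the datum is Lipschitz. *)
Lemma gradient_bounded_neg : a < 0 -> exists M : R, forall u, vhj_solution Omega a p u0 u ->
  forall t x, 0 < t -> Omega x -> enorm (grad (u t) x) <= M.
Proof.
move=> a0; have [f [U [C [hs fu C0 [_ HC _]]]]] := heat_upper hn oO bO C3 first hC0 hC1.
have [L L0 HL] := extend0_lipschitz oO bO hC0.1 hC1.
have [D D0 HD] := closure_bounded bO.
(* Gives [K * D / 2 = C + L], above both the boundary constant and the Lipschitz constant of the
   datum. *)
pose K := (2 * (C + L)) / D.
have K0 : 0 < K by rewrite divr_gt0// mulr_gt0// ltr_pwDl.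
have KE : K * D / 2 = C + L by rewrite /K; field; rewrite gt_eqF.
exists (n%:R * (K * D)) => u us t x t0 Ox.
have uU := heat_compare_above oO bO us (ltW a0) hs fu.
have [_ _ _ _ ui] := us.
apply: (@gradient_doubling R n hn Omega oO bO _ u0 u 0 t K D 0 us) => //.
- by rewrite mulr_gt0.
- by move=> s y /andP[s0 _] cy; apply: (solution_ge0 oO bO hp us) => //; case: hC0.
- move=> s y z /andP[s0 _] cy bz; apply: (le_trans (uU s y (ltW s0) cy)).
  apply: (le_trans (HC s y z (ltW s0) (bdry_out oO bz))).
  by rewrite ler_wpM2r// KE lerDl.
- move=> y z cy cz; rewrite ui// ui// mul0r addr0 KE.
  have := HL y z; rewrite !extend0_closure//; [|by case: hC0|by case: hC0].
  move=> H; apply: (le_trans (ler_norm _)); apply: (le_trans H).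
  by rewrite ler_wpM2r// lerDr ltW.
Qed.

(** At time [t - 1] the solution is at most [m], which the doubling accepts as a jump, and the
    boundary-weighted decay covers the times in between. For [t >= 2] this window lies in times at
    least [1], where that decay is available. *)
Lemma gradient_decay u C U : vhj_solution Omega a p u0 u -> 0 < C ->
  (forall t x, 0 <= t -> closure Omega x -> u t x <= U t x) ->
  (forall t x, 0 <= t -> U t x <= C * expR (- (lam * t))) ->
  (forall t x w, 1 <= t -> ~ Omega w -> U t x <= C * expR (- (lam * t)) * `|x - w|) ->
  forall D, 0 < D -> (forall x, closure Omega x -> `|x| < D) ->
  forall t x, 2 <= t -> Omega x ->
    enorm (grad (u t) x) <= n%:R * (C * (D + 2)) * expR lam * expR (- (lam * t)).
Proof.
move=> us C0 uU H1 H2 D D0 HD t x t2 Ox.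
have t1 : 1 <= t - 1 by rewrite lerBrDr.
pose m := C * expR (- (lam * (t - 1))); have m0 : 0 < m by rewrite mulr_gt0// expR_gt0.
(* [D + 2] secures both [m < 2 * K] and [m <= K * D / 2]. *)
pose K := m * (D + 2) / D.
have K0 : 0 < K by rewrite divr_gt0// mulr_gt0// addr_gt0.
have KE : K * D = m * (D + 2) by rewrite /K divfK// gt_eqF.
have KD : m <= K * D / 2 by rewrite KE ler_pdivlMr// ler_pM2l// lerDr ltW.
have mE : m = C * (expR lam * expR (- (lam * t))).
  by rewrite /m -expRD; congr (_ * expR _); ring.
have pos := solution_ge0 oO bO hp us (proj2 hC0).
have dec s : t - 1 <= s -> C * expR (- (lam * s)) <= m.
  by move=> ts; rewrite ler_pM2l// ler_expR lerN2 ler_pM2l.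
rewrite [leRHS](_ : _ = n%:R * (K * D)); last by rewrite KE mE; ring.
apply: (@gradient_doubling R n hn Omega oO bO _ u0 u (t - 1) t K D m us) => //.
- exact: le_trans t1.
- by rewrite ltrBlDr ltrDl.
- exact: ltW.
- by rewrite /K mulrA ltr_pdivlMr// mulrCA ltr_pM2l//; lra.
- by move=> s y /andP[s0 _] cy; apply: pos => //; apply: le_trans s0; exact: le_trans t1.
- move=> s y z /andP[s0 _] cy bz.
  have s1 : 1 <= s by apply: ltW; exact: le_lt_trans s0.
  apply: (le_trans (uU s y (le_trans ler01 s1) cy)).
  apply: (le_trans (H2 s y z s1 (bdry_out oO bz))).
  by rewrite ler_wpM2r// (le_trans (dec s (ltW s0))).
- move=> y z cy cz; have t10 : 0 <= t - 1 by exact: le_trans t1.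
  rewrite opprB addrCA subrr addr0 mulr1.
  have A1 := le_trans (uU _ y t10 cy) (le_trans (H1 _ y t10) (dec _ (lexx _))).
  have A2 := pos _ z t10 cz.
  have A3 : 0 <= K * D / 2 * `|y - z| by rewrite mulr_ge0// ltW// divr_gt0// mulr_gt0.
  lra.
Qed.

(** Uniqueness identifies [u] with the solution that is bounded in [C^1], so the bound depends on
    [u0] and not on [u]; agreement on the open set [Omega] passes to gradients. *)
Lemma gradient_bounded_pos eps0 : small_data_constant Omega a p eps0 ->
  (C1norm Omega u0 <= eps0%:E)%E -> exists M : R, forall u, vhj_solution Omega a p u0 u ->
  forall t x, 0 < t -> Omega x -> enorm (grad (u t) x) <= M.
Proof.
move=> [_ /(_ u0 hC0 hC1) H] /H[v [vs uniq_v _ fin]].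
set S := ereal_sup _ in fin.
exists (fine S) => u us t x t0 Ox.
have gE : grad (u t) x = grad (v t) x.
  apply/rowP => i; rewrite !mxE; have [_ [dv _ _ _ _] _ _ _] := us.
  have [_ dx _] := dv t x (conj t0 Ox).
  have [r r0 Hr] := open_normP oO Ox.
  have := dird_eq (g := v t) _ (diff_dird (delta_mx 0 i) dx).
  move=> Hd; have [] := dird_is (Hd _); last by [].
  exists r => // s sr; apply: (uniq_v u us); first exact: ltW.
  apply: subset_closure; apply: Hr; rewrite opprD addrA subrr sub0r normrN.
  exact: le_lt_trans (norm_scale_delta i s) sr.
have s1 : (0 <= supnorm Omega (v t))%E.
  apply: (@le_trans _ _ (`|v t x|%:E)); first by rewrite lee_fin.
  by apply: ereal_sup_ubound; exists x.
have s2 : ((enorm (grad (v t) x))%:E <= grad_supnorm Omega (v t))%E.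
  apply: (@le_trans _ _ (`|enorm (grad (v t) x)|%:E)); first by rewrite lee_fin ler_norm.
  by apply: ereal_sup_ubound; exists x.
have s3 : ((enorm (grad (v t) x))%:E <= S)%E.
  apply: (@le_trans _ _ (C1norm Omega (v t))).
    by rewrite /C1norm; apply: (le_trans s2); rewrite leeDr.
  by apply: ereal_sup_ubound; exists t => //=; exact: ltW.
have Sf : S \is a fin_num.
  rewrite fin_numE (lt_eqF fin) andbT; apply/eqP => SE; move: s3; rewrite SE.
  by rewrite leeNy_eq.
by rewrite gE -lee_fin fineK.
Qed.

End MainEstimates.

(** On the side where the sign of [a] already gives a comparison the datum is [u0]; only the other
    one is transformed. The upper comparison admits any majorant of [W0], so it serves both the heat
    flow of [W0] and a larger flow with known decay. *)
Lemma barrier_data (R : realType) (n : nat) (Omega : set 'rV[R]_n) (p a M : R) (u0 : 'rV[R]_n -> R) :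
  open Omega -> bounded_set Omega -> 2 < p -> a != 0 -> 0 < M ->
  C0plus_closure Omega u0 -> C1_closure Omega u0 ->
  exists w0 W0 : 'rV[R]_n -> R,
    [/\ [/\ C0plus_closure Omega w0, C1_closure Omega w0,
        C0plus_closure Omega W0 & C1_closure Omega W0],
      forall x, u0 x != 0 -> w0 x != 0 /\ W0 x != 0,
      0 < a -> w0 = u0, a < 0 -> W0 = u0 &
      forall u, vhj_solution Omega a p u0 u ->
        (forall t x, 0 < t -> Omega x -> enorm (grad (u t) x) <= M) ->
        (forall U, heat_solution Omega w0 U ->
          forall t x, 0 <= t -> closure Omega x -> U t x <= u t x) /\
        (forall f U, heat_solution Omega f U -> (forall x, closure Omega x -> W0 x <= f x) ->
          forall t x, 0 <= t -> closure Omega x -> u t x <= U t x)].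
Proof.
move=> oO bO hp a0 M0 hC0 hC1.
pose c := a * M `^ (p - 2); have Mp : 0 < M `^ (p - 2) by exact: powR_gt0.
have c0 : c != 0 by rewrite mulf_neq0// gt_eqF.
have zC0 : C0plus_closure Omega (fun x => cexp c (u0 x)).
  have [[cu bu] pu] := hC0; split; [split|].
  - exact: (within_comp (dird_continuous (cexp_dird c0)) cu).
  - by move=> x bx; rewrite bu// cexp0.
  - by move=> x cx; apply: cexp_ge0 => //; exact: pu.
have zC1 : C1_closure Omega (fun x => cexp c (u0 x)).
  exact: (C1_closure_comp oO (cexp_dird c0) (cexp_dird2 c) hC1).
have z0 x : u0 x != 0 -> cexp c (u0 x) != 0 by exact: cexp_neq0.
have [an|ap] := ltP a 0.
- exists (fun x => cexp c (u0 x)), u0; split=> //; first by move=> x ux; split=> //; exact: z0.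
    by move=> ap; move: (lt_trans an ap); rewrite ltxx.
  move=> u us HM; split.
    move=> U hs; apply: (heat_compare_exp_below oO bO hp us (c := c) (M := M) erefl an _ HM hs) => //.
    by rewrite /c pmulr_llt0.
  by move=> f U hs fu; exact: (heat_compare_above oO bO us (ltW an) hs fu).
- have {}ap : 0 < a by rewrite lt_neqAle eq_sym a0.
  exists u0, (fun x => cexp c (u0 x)); split=> //; first by move=> x ux; split=> //; exact: z0.

  move=> u us HM; split.
    by move=> U hs; apply: (heat_compare_below oO bO us (ltW ap) hs).
  move=> f U hs fu; apply: (heat_compare_exp_above oO bO hp us (c := c) (M := M) erefl ap _ HM hs fu).
  by rewrite /c mulr_gt0.
Qed.

Theorem theorem1p3 (R : realType) (n : nat) (Omega : set 'rV[R]_n)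
  (p a eps0 lambda1 : R) (u0 : 'rV[R]_n -> R)
  (hn : (0 < n)%N)
  (hopen : open Omega) (hbounded : bounded_set Omega)
  (hC3 : C3_boundary Omega)
  (hp : 2 < p) (ha : a != 0)
  (hu0 : C0plus_closure Omega u0) (hu0C1 : C1_closure Omega u0)
  (heps0 : 0 < a -> small_data_constant Omega a p eps0)
  (hcase : a < 0 \/ 0 < a /\ (C1norm Omega u0 <= eps0%:E)%E)
  (hlambda1 : first_dirichlet_eigenvalue Omega lambda1) :
  0 < lambda1 /\
  exists2 K : R, 0 < K &
  forall u : R -> 'rV[R]_n -> R, vhj_solution Omega a p u0 u ->
    (exists w0 W0 : 'rV[R]_n -> R,
      [/\ C0plus_closure Omega w0 /\ C1_closure Omega w0,
          C0plus_closure Omega W0 /\ C1_closure Omega W0,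
          (exists2 x, closure Omega x & u0 x != 0) ->
            (exists2 x, closure Omega x & w0 x != 0) /\
            (exists2 x, closure Omega x & W0 x != 0),
          (0 < a -> forall x, closure Omega x -> w0 x = u0 x) /\
          (a < 0 -> forall x, closure Omega x -> W0 x = u0 x) &
          \forall t \near +oo, forall x, closure Omega x ->
            heat_semigroup Omega t w0 x <= u t x <= heat_semigroup Omega t W0 x])
    /\
    (forall t : R, 0 < t ->
      (grad_supnorm Omega (u t) <=
        (K * (1 + (Num.sqrt t)^-1) * expR (- (t * lambda1)))%:E)%E).
Proof.
have lam0 : 0 < lambda1 by apply: (eigenvalue_gt0 hn hopen hbounded); case: hlambda1.
split=> //.
have [M0 HM0] : exists M : R, forall u, vhj_solution Omega a p u0 u ->
    forall t x, 0 < t -> Omega x -> enorm (grad (u t) x) <= M.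
  case: hcase => [an|[ap small]].
    exact: (gradient_bounded_neg hn hopen hbounded hC3 hp hlambda1 hu0 hu0C1 an).
  exact: (gradient_bounded_pos hopen hu0 hu0C1 (heps0 ap) small).
(* Positivity of [M] gives [c] the sign of [a] and keeps it away from zero. *)
pose M := `|M0| + 1; have Mp : 0 < M by rewrite ltr_wpDl.
have HM u : vhj_solution Omega a p u0 u ->
    forall t x, 0 < t -> Omega x -> enorm (grad (u t) x) <= M.
  move=> us t x t0 Ox; apply: (le_trans (HM0 u us t x t0 Ox)).
  by rewrite (le_trans (ler_norm _))// lerDl.
have [w0 [W0 [[C0w C1w C0W C1W] nz wu Wu cmp]]] :=
  barrier_data hopen hbounded hp ha Mp hu0 hu0C1.
have [f [U [C [hs Wf C0 [H1 _ H2]]]]] := heat_upper hn hopen hbounded hC3 hlambda1 C0W C1W.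
have [D D0 HD] := closure_bounded hbounded.
pose K1 := n%:R * (C * (D + 2)) * expR lambda1.
have K10 : 0 <= K1.
  by rewrite !mulr_ge0 ?expR_ge0 ?addr_ge0// ltW.
(* For [t < 2] the constant bound [M] is at most [K2 e^(- lambda1 t)]; the decay estimate with [K1]
   takes over from [t = 2]. *)
pose K2 := M * expR (2 * lambda1); have K20 : 0 < K2 by rewrite mulr_gt0// expR_gt0.
exists (K1 + K2); first by rewrite ltr_wpDl.
move=> u us; have [lo up] := cmp u us (HM u us); split.
  exists w0, W0; split=> //.
  - by move=> [x cx /nz[nw nW]]; split; exists x.
  - by split=> [ap x _|an x _]; rewrite ?wu ?Wu.
  near=> t => x cx; have t0 : 0 <= t by near: t; exact: nbhs_pinfty_ge.
  apply/andP; split.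
    exact: (lo _ (heat_semigroup_solution hn hopen hbounded hC3 C0w C1w)).
  exact: (up _ _ (heat_semigroup_solution hn hopen hbounded hC3 C0W C1W)).
move=> t t0; apply: ub_ereal_sup => _ [x Ox <-].
rewrite lee_fin ger0_norm ?sqrtr_ge0// [t * _]mulrC.
have E0 := expR_gt0 (- (lambda1 * t)).
(* The factor [1 + t^(-1/2)] is at least one and is dropped: for these data the gradient stays
   bounded as [t] tends to zero. *)
apply: (@le_trans _ _ ((K1 + K2) * expR (- (lambda1 * t)))); last first.
  rewrite ler_wpM2r ?(ltW E0)// ler_peMr//; first by rewrite addr_ge0// ltW.
  by rewrite lerDl invr_ge0 sqrtr_ge0.
rewrite mulrDl; have [t2|t2] := leP 2 t.
  have := gradient_decay hn hopen hbounded hp hlambda1 hu0 us C0 (up f U hs Wf) H1 H2 D0 HD t2 Ox.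
  by move=> /le_trans; apply; rewrite lerDl mulr_ge0// ltW.
apply: (le_trans (HM u us t x t0 Ox)).
apply: (@le_trans _ _ (K2 * expR (- (lambda1 * t)))); last by rewrite lerDr mulr_ge0// ltW.
rewrite /K2 -mulrA -expRD ler_peMr ?(ltW Mp)// -[X in X <= _]expR0 ler_expR.
by rewrite [2 * _]mulrC -mulrBr mulr_ge0 ?(ltW lam0)// subr_ge0 ltW.
Unshelve. all: by end_near. Qed.
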